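(* Let $p=p_n$ be positive integers with $n>p+1$ for all $n\geq 3$ and $\lim_{n\to\infty}p/n=y\in(0,1]$. For each $n$, let $\mathbf{x}_1,\dots,\mathbf{x}_n$ be i.i.d. $N_p(\boldsymbol{\mu},\boldsymbol{\Sigma})$ random vectors, and put $$\bar{\mathbf{x}}=\frac1n\sum_{i=1}^n\mathbf{x}_i,\qquad \mathbf{S}=\frac1n\sum_{i=1}^n(\mathbf{x}_i-\bar{\mathbf{x}})(\mathbf{x}_i-\bar{\mathbf{x}})',\qquad V_n=|\mathbf{S}|\cdot\Big(\frac{\operatorname{tr}(\mathbf{S})}{p}\Big)^{-p}.$$ Assume the null hypothesis $H_0:\boldsymbol{\Sigma}=\lambda\mathbf{I}_p$ for some (unspecified) $\lambda>0$. Then $(\log V_n-\mu_n)/\sigma_n$ converges in distribution to $N(0,1)$ as $n\to\infty$, where $$\mu_n=-p-\Big(n-p-\frac32\Big)\log\Big(1-\frac{p}{n-1}\Big),\qquad \sigma_n^2=-2\Big[\frac{p}{n-1}+\log\Big(1-\frac{p}{n-1}\Big)\Big].$$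
   Context: $|\cdot|$ denotes the determinant, $\mathbf{I}_p$ the $p\times p$ identity matrix, and $'$ transposition. $V_n$ is the likelihood ratio (sphericity) statistic for testing $H_0:\boldsymbol{\Sigma}=\lambda\mathbf{I}_p$. *)

(* Defs.v *)
From HB Require Import structures.
From mathcomp Require Import all_boot all_order all_algebra.
From mathcomp Require Import all_classical all_reals all_analysis.
Set Implicit Arguments. Unset Strict Implicit. Unset Printing Implicit Defensive.
Import Order.TTheory GRing.Theory Num.Theory.
Import numFieldNormedType.Exports.
Local Open Scope classical_set_scope.
Local Open Scope ring_scope.

Definition gaussian_rv d (T : measurableType d) (R : realType)
  (P : probability T R) (Y : T -> R) (m v : R) : Prop :=
  0 <= v /\
  if v == 0 then P [set t | Y t = m] = 1%E
  else forall A : set R, measurable A ->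
         P (Y @^-1` A) = normal_prob m (Num.sqrt v) A.

(* Random vector X : T -> R^p is N_p(mu, Sigma) (Cramer-Wold definition). *)
Definition mvnormal d (T : measurableType d) (R : realType) (p : nat)
  (P : probability T R) (X : T -> 'cV[R]_p) (mu : 'cV[R]_p) (Sigma : 'M[R]_p) : Prop :=
  forall a : 'cV[R]_p,
    gaussian_rv P (fun t => (a^T *m X t) ord0 ord0) ((a^T *m mu) ord0 ord0) ((a^T *m Sigma *m a) ord0 ord0).

Definition mutually_independent_vectors d (T : measurableType d) (R : realType)
  (n p : nat) (P : probability T R) (X : 'I_n -> T -> 'cV[R]_p) : Prop :=
  forall A : 'I_n -> 'I_p -> set R, (forall i j, measurable (A i j)) ->
    P [set t | forall i j, A i j (X i t j ord0)] =
    (\prod_(i < n) P [set t | forall j, A i j (X i t j ord0)])%E.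

Definition sample_mean (R : realType) (n p : nat) (x : 'I_n -> 'cV[R]_p) : 'cV[R]_p :=
  (n%:R)^-1 *: \sum_(i < n) x i.

Definition sample_cov (R : realType) (n p : nat) (x : 'I_n -> 'cV[R]_p) : 'M[R]_p :=
  (n%:R)^-1 *: \sum_(i < n) ((x i - sample_mean x) *m (x i - sample_mean x)^T).

Definition sphericity_stat (R : realType) (n p : nat) (x : 'I_n -> 'cV[R]_p) : R :=
  \det (sample_cov x) * ((\tr (sample_cov x) / p%:R) ^- p).

Definition mu_n (R : realType) (n p : nat) : R :=
  - p%:R - (n%:R - p%:R - 3%:R / 2%:R) * ln (1 - p%:R / (n%:R - 1)).

Definition sigma2_n (R : realType) (n p : nat) : R :=
  - 2%:R * (p%:R / (n%:R - 1) + ln (1 - p%:R / (n%:R - 1))).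

Definition std_normal_cdf (R : realType) (x : R) : R :=
  fine (normal_prob 0 1 `]-oo, x]).

(* Main.v *)
(** Under the null hypothesis the standardized data form a family of independent standard normal
variables (the characteristic function of the family is given by the Cramer-Wold definition and
determines its law).  A rotation removes the sample mean, so that with m = n - 1 the statistic is
V = |ZZ'| (tr ZZ' / p)^(-p) for a p x m standard Gaussian matrix Z.  Adding the rows of Z one by one,
each rotated according to the others, (|ZZ'|, tr ZZ') has the law of (C_1 ... C_p, sum of all z_kl^2),
where C_k is the sum of squares of the last d_k = n - 1 - p + k entries of row k.

Expanding ln C_k and ln tr ZZ' to second order at their means, (ln V - mu_n) / sigma_n is a quadratic
chaos sum of c_kl (z_kl^2 - 1) plus a remainder.  With q = n - 1 - p, the variance of the chaos differs
from 1 by O(1 / (q sigma_n^2)), and the remainder is O(1 / sqrt (q sigma_n^2)) in mean: the centered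
second-order terms are orthogonal across rows, the third-order terms are of size d_k^(-3/2), and the
deterministic part is a Stirling-type sum.  The chaos is compared with a normal variable by Gaussian
integration by parts along a rotation, which yields an explicit bound for smooth test functions.
Finally q sigma_n^2 tends to infinity whether or not q does. *)
Require Import Defs.
From HB Require Import structures.
From mathcomp Require Import all_boot all_order all_algebra.
From mathcomp Require Import all_classical all_reals all_analysis measurable_realfun.
From mathcomp Require Import ring lra zify.
Set Implicit Arguments. Unset Strict Implicit. Unset Printing Implicit Defensive.
Import Order.TTheory GRing.Theory Num.Theory.
Import numFieldNormedType.Exports.
Local Open Scope classical_set_scope.
Local Open Scope ring_scope.

(** The obstacle is the boundary case [y = 1], where [q = n - 1 - p] may stay bounded: the
    logarithms of the rows with few degrees of freedom are then far from normal, and no limit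
    theorem applies row by row. All errors are therefore bounded at fixed [n] and measured by the
    single quantity [tau = q * sigma_n ^ 2], in which the growth of [sigma_n] outweighs the bad
    rows. Densities of chi-square variables and digamma functions are avoided: chi-square moments,
    the control of the logarithm near 0, characteristic functions and the comparison with the normal
    law all come from one identity, [E (x * h x) = E (h' x)], applied in one coordinate with the
    others frozen. Laws of families are compared through functions measurable for a product
    sigma-algebra, so the probability space can be exchanged, in particular for a product that
    supplies independent copies. The smoothing parameters stay free until the end, where they are
    fixed before [n] grows. *)

Notation intg P f := ((P : {measure set _ -> \bar _}).-integrable [set: _] (EFin \o f)).

(** * Expectations and Gaussian families *)

Section expectation.
Context d (T : measurableType d) (R : realType) (P : probability T R).
Implicit Types f g : T -> R.

Lemma intg_measurable f : intg P f -> measurable_fun setT f.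
Proof. by move=> /integrableP[/measurable_EFinP]. Qed.

Lemma intg_bound f C : measurable_fun setT f -> (forall x, `|f x| <= C) -> intg P f.
Proof.
move=> mf fC; apply: measurable_bounded_integrable => //.
  by rewrite (le_lt_trans (probability_le1 P measurableT)) ?ltry.
by exists C; split; [exact: num_real|move=> x Cx y _ /=; rewrite (le_trans (fC y))// ltW].
Qed.

Lemma intg_cst (c : R) : intg P (fun=> c).
Proof. by apply: (@intg_bound _ `|c|) => //; exact: measurable_cst. Qed.

Lemma intgD f g : intg P f -> intg P g -> intg P (fun x => f x + g x).
Proof. by move=> fi gi; exact: (integrableD measurableT fi gi). Qed.

Lemma intgB f g : intg P f -> intg P g -> intg P (fun x => f x - g x).
Proof. by move=> fi gi; exact: (integrableB measurableT fi gi). Qed.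

Lemma intgZ c f : intg P f -> intg P (fun x => c * f x).
Proof. by move=> fi; exact: (integrableZl measurableT c fi). Qed.

Lemma intg_sum (I : Type) (s : seq I) (F : I -> T -> R) :
  (forall i, intg P (F i)) -> intg P (fun x => \sum_(i <- s) F i x).
Proof.
move=> Fi; have := @integrable_sum _ _ _ P _ measurableT _ s xpredT (fun i => EFin \o F i) (fun i _ => Fi i).
by apply: eq_integrable => // x _; rewrite /= sumEFin.
Qed.

Lemma intg_le f g : measurable_fun setT f -> (forall x, `|f x| <= g x) -> intg P g -> intg P f.
Proof.
move=> mf fg gi; apply: (le_integrable measurableT _ _ gi).
  exact/measurable_EFinP.
by move=> x _ /=; rewrite lee_fin (le_trans (fg x))// ler_norm.
Qed.

Lemma intg_abs f : intg P f -> intg P (fun x => `|f x|).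
Proof. by move=> fi; exact: integrable_norm. Qed.

Lemma ExD f g : intg P f -> intg P g -> \int[P]_x (f x + g x) = \int[P]_x f x + \int[P]_x g x.
Proof. by move=> fi gi; exact: RintegralD. Qed.

Lemma ExB f g : intg P f -> intg P g -> \int[P]_x (f x - g x) = \int[P]_x f x - \int[P]_x g x.
Proof. by move=> fi gi; exact: RintegralB. Qed.

Lemma ExZ c f : intg P f -> \int[P]_x (c * f x) = c * \int[P]_x f x.
Proof. by move=> fi; exact: RintegralZl. Qed.

Lemma ExN f : intg P f -> \int[P]_x (- f x) = - \int[P]_x f x.
Proof.
by move=> fi; rewrite -mulN1r -ExZ//; apply: eq_Rintegral => x _; rewrite mulN1r.
Qed.

Lemma Ex_cst c : \int[P]_x c = c.
Proof. by rewrite Rintegral_cst// [X in fine X]probability_setT /= mulr1. Qed.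

Lemma Ex_le f g : intg P f -> intg P g -> (forall x, f x <= g x) -> \int[P]_x f x <= \int[P]_x g x.
Proof. by move=> fi gi fg; exact: le_Rintegral. Qed.

Lemma Ex_abs f : intg P f -> `|\int[P]_x f x| <= \int[P]_x `|f x|.
Proof. by move=> fi; exact: le_normr_Rintegral. Qed.

Lemma Ex_sum (I : Type) (s : seq I) (F : I -> T -> R) : (forall i, intg P (F i)) ->
  \int[P]_x (\sum_(i <- s) F i x) = \sum_(i <- s) \int[P]_x F i x.
Proof.
move=> Fi; elim: s => [|a s IH].
  by rewrite big_nil -[RHS](Ex_cst 0); apply: eq_Rintegral => x _; rewrite big_nil.
rewrite big_cons -IH -ExD//; last exact: intg_sum.
by apply: eq_Rintegral => x _; rewrite big_cons.
Qed.

Lemma ExE f : intg P f -> (\int[P]_x (f x)%:E)%E = (\int[P]_x f x)%:E.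
Proof. by move=> fi; rewrite fineK//; exact: integrable_fin_num. Qed.

Lemma intg_ge0 f (c : R) : measurable_fun setT f -> (forall x, 0 <= f x) ->
  (\int[P]_x (f x)%:E <= c%:E)%E -> intg P f /\ \int[P]_x f x <= c.
Proof.
move=> mf f0 fc; have fi : intg P f.
  apply/integrableP; split; first exact/measurable_EFinP.
  under eq_integral do rewrite /= ger0_norm//.
  by rewrite (le_lt_trans fc) ?ltry.
by split => //; rewrite -lee_fin -ExE.
Qed.

Lemma Ex_indic (A : set T) : measurable A -> \int[P]_x \1_A x = fine (P A).
Proof. by move=> mA; rewrite /Rintegral integral_indic// setIT. Qed.

End expectation.

Section pushforward.
Context d1 d2 (T1 : measurableType d1) (T2 : measurableType d2) (R : realType).

Lemma Rintegral_pushforward (mu : {measure set T1 -> \bar R}) (phi : T1 -> T2) (f : T2 -> R) :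
  measurable_fun setT phi -> measurable_fun setT f ->
  fine (\int[pushforward mu phi]_y (f y)%:E)%E = \int[mu]_x f (phi x).
Proof.
move=> mphi mf; congr fine.
have mf' : measurable_fun setT (fun y => (f y)%:E) by exact/measurable_EFinP.
rewrite [LHS]integralE [in RHS]integralE; congr (_ - _)%E.
  rewrite (ge0_integral_pushforward mphi)// ?preimage_setT.
    by apply: eq_integral => x _; rewrite /= !(funepos.unlock, funeneg.unlock).
  exact: measurable_funepos.
rewrite (ge0_integral_pushforward mphi)// ?preimage_setT.
  by apply: eq_integral => x _; rewrite /= !(funepos.unlock, funeneg.unlock).
exact: measurable_funeneg.
Qed.

End pushforward.

Section density.
Context d (T : measurableType d) (R : realType).
Variables (mu nu : {measure set T -> \bar R}) (w : T -> R).
Hypotheses (mw : measurable_fun setT w) (w0 : forall x, 0 <= w x).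
Hypothesis nuE : forall A, measurable A -> nu A = (\int[mu]_(x in A) (w x)%:E)%E.
Local Open Scope ereal_scope.

Import HBNNSimple.

(** The defining identity of [nu] on sets extends to simple functions by linearity, and to [f] by
    monotone convergence on both sides. *)
Lemma ge0_integral_density (f : T -> \bar R) : measurable_fun setT f -> (forall x, 0 <= f x) ->
  \int[nu]_x f x = \int[mu]_x (f x * (w x)%:E).
Proof.
move=> mf f0; have mw' : measurable_fun setT (EFin \o w) by exact/measurable_EFinP.
pose h := nnsfun_approx measurableT mf.
have -> : \int[nu]_x f x = lim (\int[nu]_x (EFin \o h n) x @[n --> \oo]).
  have fE x : f x = lim ((EFin \o h n) x @[n --> \oo]).
    by apply/esym/cvg_lim => //; exact: cvg_nnsfun_approx.
  under eq_integral => x _ do rewrite fE.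
  apply: monotone_convergence => //.
  - by move=> n; apply/measurable_EFinP; exact/measurable_funP.
  - by move=> n x Ex //=; rewrite lee_fin.
  - by move=> x Ex a b ab; rewrite lee_fin; exact/lefP/nd_nnsfun_approx.
have -> : \int[mu]_x (f x * (w x)%:E) =
    lim (\int[mu]_x ((EFin \o h n) x * (w x)%:E) @[n --> \oo]).
  have fg x : f x * (w x)%:E = lim ((EFin \o h n) x * (w x)%:E @[n --> \oo]).
    by apply/esym/cvg_lim => //; apply: cvgeZr => //; exact: cvg_nnsfun_approx.
  under eq_integral => x _ do rewrite fg.
  apply: monotone_convergence => [//| | |].
  - by move=> n; apply/emeasurable_funM => //; exact/measurable_EFinP.
  - by move=> n x Ex /=; rewrite mule_ge0 ?lee_fin.
  - by move=> x Ex a b ab/=; rewrite lee_wpmul2r ?lee_fin//; exact/lefP/nd_nnsfun_approx.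
suff suf n : \int[mu]_x ((EFin \o h n) x * (w x)%:E) = \int[nu]_x (EFin \o h n) x.
  by under [in RHS]eq_fun do rewrite suf.
transitivity (\int[nu]_x
   (\sum_(y \in range (h n)) (y * \1_(h n @^-1` [set y]) x)%:E)); last first.
  by apply: eq_integral => t tE; rewrite /= fimfunE -fsumEFin.
have indich m r : measurable_fun setT (fun x => (r * \1_(h m @^-1` [set r]) x)%:E).
  by apply/measurable_EFinP; exact: measurable_funM.
rewrite ge0_integral_fsum//; last by move=> m y Ey; exact: nnfun_muleindic_ge0.
transitivity (\int[mu]_x (\sum_(y \in range (h n))
    (y * \1_(h n @^-1` [set y]) x)%:E * (w x)%:E)).
  under [RHS]eq_integral => x xE.
    rewrite -ge0_mule_fsuml => [|y]; last exact: nnfun_muleindic_ge0.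
    rewrite fsumEFin // -(fimfunE _ x); over.
  by [].
rewrite ge0_integral_fsum//; last 2 first.
  - by move=> y; apply: emeasurable_funM => //; exact: measurable_funTS.
  - by move=> m y Ey; rewrite mule_ge0 ?lee_fin// -lee_fin nnfun_muleindic_ge0.
apply: eq_fsbigr => r rhn.
under [RHS]eq_integral do rewrite EFinM.
rewrite integralZl_indic_nnsfun => //.
under eq_integral do rewrite EFinM -muleA.
rewrite ge0_integralZl//.
- under eq_integral do rewrite muleC.
  rewrite (eq_integral ((EFin \o w) \_ (h n @^-1` [set r]))); last first.
    by move=> x xE; rewrite epatch_indic.
  by rewrite -integral_mkcondr -nuE ?integral_indic// ?setIT ?setTI.
- by apply: emeasurable_funM => //; exact/measurable_EFinP.
- by move=> x _; rewrite mule_ge0 ?lee_fin.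
- by move: rhn; rewrite inE => -[t _ <-]; rewrite lee_fin.
Qed.

End density.

Section gaussian_family.
Context (R : realType).

Definition boxes (I : finType) : set (set (I -> R)) :=
  [set B | exists A : I -> set R, (forall i, measurable (A i)) /\ B = [set x | forall i, A i (x i)]].

(** The product sigma-algebra on families indexed by an arbitrary finite type. Boxes generate it and
    are stable under intersection, which is what uniqueness of laws requires. *)
Definition rvT (I : finType) := g_sigma_algebraType (@boxes I).

Section rvT.
Variable I : finType.

Lemma measurable_box (A : I -> set R) : (forall i, measurable (A i)) ->
  measurable ([set x | forall i, A i (x i)] : set (rvT I)).
Proof. by move=> mA; apply: sub_sigma_algebra; exists A. Qed.

Lemma measurable_coord (i : I) : measurable_fun setT (fun x : rvT I => x i).
Proof.
move=> _ Y mY; rewrite setTI.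
rewrite (_ : _ @^-1` _ = [set x : rvT I | forall j, (if j == i then Y else setT) (x j)]).
  by apply: (@measurable_box (fun j => if j == i then Y else setT)) => j; case: ifP.
apply/seteqP; split => x /=; first by move=> Yx j; case: eqP => // ->.
by move=> /(_ i); rewrite eqxx.
Qed.

Lemma measurable_boxpre d (T : measurableType d) (f : I -> T -> R) (A : I -> set R) :
  (forall i, measurable_fun setT (f i)) -> (forall i, measurable (A i)) ->
  measurable [set t | forall i, A i (f i t)].
Proof.
move=> mf mA.
rewrite (_ : [set t | _] = \bigcap_(i in [set: I]) (f i @^-1` A i)).
  apply: fin_bigcap_measurable => // i _.
  by rewrite -[X in measurable X]setTI; exact: mf.
by apply/seteqP; split => t /= H i; [move=> _|]; exact: H.
Qed.

Lemma measurable_torv d (T : measurableType d) (f : I -> T -> R) :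
  (forall i, measurable_fun setT (f i)) ->
  measurable_fun setT (fun t => (f^~ t) : rvT I).
Proof.
move=> mf; apply: (@measurability _ _ _ (rvT I) _ _ (@boxes I)) => //.
move=> _ [_ [A [mA ->]] <-]; rewrite setTI /=.
exact: (measurable_boxpre mf mA).
Qed.

End rvT.

(* [gfam P xi]: under [P], the [xi i] are independent standard normal variables. *)
Definition gfam d (T : measurableType d) (P : probability T R) (I : finType) (xi : I -> T -> R) :=
  (forall i, measurable_fun setT (xi i)) /\
  forall A : I -> set R, (forall i, measurable (A i)) ->
    fine (P [set t | forall i, A i (xi i t)]) = \prod_i fine (normal_prob 0 1 (A i)).

Lemma probE d (T : measurableType d) (P : probability T R) (A : set T) : measurable A -> P A = (fine (P A))%:E.
Proof. by move=> mA; rewrite fineK// fin_num_measure. Qed.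

Section law.
Context d (T : measurableType d) (P : probability T R) (I : finType) (xi : I -> T -> R).
Context d' (T' : measurableType d') (P' : probability T' R) (xi' : I -> T' -> R).
Hypotheses (g : gfam P xi) (g' : gfam P' xi').

Let X t : rvT I := xi^~ t.
Let X' t : rvT I := xi'^~ t.

(** Both laws are finite and agree on boxes, a generating pi-system. Consequently every expectation
    of a Gaussian family may be computed on any convenient probability space. *)
Lemma gfam_law (B : set (rvT I)) : measurable B -> pushforward P X B = pushforward P' X' B.
Proof.
move: g g' => [mx gx] [mx' gx'].
have mX : measurable_fun setT X by exact: measurable_torv.
have mX' : measurable_fun setT X' by exact: measurable_torv.
pose m1 := measure_function_pushforward__canonical__measure_function_Measure P mX.
pose m2 := measure_function_pushforward__canonical__measure_function_Measure P' mX'.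
move=> mB.
apply: (@g_sigma_algebra_measure_unique _ _ (rvT I) (@boxes I) _ (fun=> setT) _ _ m1 m2) => //.
- by move=> _ [A [mA ->]]; exact: measurable_box.
- by move=> i; exists (fun=> setT); split => //; apply/seteqP; split.
- by rewrite bigcup_const//; exists 0%N.
- move=> _ _ [A [mA ->]] [C [mC ->]]; exists (fun i => A i `&` C i); split.
    by move=> i; exact: measurableI.
  by apply/seteqP; split => x /=; [move=> [a c] i; split|move=> ac; split => i; have [] := ac i].
- move=> _ [A [mA ->]]; rewrite /m1 /m2 /pushforward /= /preimage /=.
  have E : P [set t | forall i, A i (xi i t)] = P' [set t | forall i, A i (xi' i t)].
    rewrite (probE P (measurable_boxpre mx mA)) (probE P' (measurable_boxpre mx' mA)).
    by rewrite gx// gx'.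
  exact: E.
- by move=> _; rewrite (_ : m1 _ = 1%E) ?ltry//; exact: (probability_setT P).
Qed.

Lemma gfam_ge0 (f : rvT I -> \bar R) : measurable_fun [set: rvT I] f -> (forall x, 0 <= f x)%E ->
  (\int[P]_t f (xi^~ t) = \int[P']_t f (xi'^~ t))%E.
Proof.
move: g g' => [mx gx] [mx' gx'] mf f0.
have mX : measurable_fun setT X by exact: measurable_torv.
have mX' : measurable_fun setT X' by exact: measurable_torv.
have := @ge0_integral_pushforward _ _ _ _ _ _ mX P _ f measurableT mf (fun x _ => f0 x).
rewrite preimage_setT /= => <-.
have := @ge0_integral_pushforward _ _ _ _ _ _ mX' P' _ f measurableT mf (fun x _ => f0 x).
rewrite preimage_setT /= => <-.
apply: eq_measure_integral => A mA _.
exact: gfam_law.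
Qed.

Lemma gfam_Ex (f : rvT I -> R) : measurable_fun [set: rvT I] f ->
  \int[P]_t f (xi^~ t) = \int[P']_t f (xi'^~ t).
Proof.
move: g g' => [mx gx] [mx' gx'] mf.
have mX : measurable_fun setT X by exact: measurable_torv.
have mX' : measurable_fun setT X' by exact: measurable_torv.
rewrite -(Rintegral_pushforward P mX mf) -(Rintegral_pushforward P' mX' mf).
by congr fine; apply: eq_measure_integral => A mA _; exact: gfam_law.
Qed.

Lemma gfam_intg (f : rvT I -> R) : measurable_fun [set: rvT I] f ->
  intg P (fun t => f (xi^~ t)) -> intg P' (fun t => f (xi'^~ t)).
Proof.
move=> mf /integrableP[_ fi]; apply/integrableP; split.
  apply/measurable_EFinP; apply: (measurableT_comp mf).
  by apply: measurable_torv; have [] := g'.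
rewrite /= in fi *.
rewrite -(@gfam_ge0 (fun x => `|(f x)%:E|)%E)//.
by apply: measurableT_comp => //; exact/measurable_EFinP.
Qed.

End law.

Section mix.
Context d1 (T1 : measurableType d1) (P1 : probability T1 R) (I : finType) (x1 : I -> T1 -> R).
Context d2 (T2 : measurableType d2) (P2 : probability T2 R) (x2 : I -> T2 -> R) (J : pred I).

(* Taking the coordinates in [J] from an independent copy lets Fubini integrate them
   with the other coordinates frozen. *)
Definition mix (i : I) (t : T1 * T2) := if J i then x2 i t.2 else x1 i t.1.

(** A box for the mixed family is a rectangle: each factor constrains only the coordinates that it
    supplies, and an unconstrained coordinate contributes a factor 1. *)
Lemma gfam_mix : gfam P1 x1 -> gfam P2 x2 -> gfam (P1 \x P2)%E mix.
Proof.
move=> [m1 g1] [m2 g2]; split.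
  move=> i; rewrite /mix; case: (J i); first exact: (measurableT_comp (m2 i) measurable_snd).
  exact: (measurableT_comp (m1 i) measurable_fst).
move=> A mA.
pose A1 i := if J i then setT else A i.
pose A2 i := if J i then A i else setT.
have mA1 i : measurable (A1 i) by rewrite /A1; case: ifP.
have mA2 i : measurable (A2 i) by rewrite /A2; case: ifP.
rewrite (_ : [set t | _] = [set t | forall i, A1 i (x1 i t)] `*` [set t | forall i, A2 i (x2 i t)]).
  have B1 := measurable_boxpre m1 mA1; have B2 := measurable_boxpre m2 mA2.
  rewrite [X in fine X]product_measure1E// fineM ?fin_num_measure// g1// g2//.
  rewrite -big_split; apply: eq_bigr => i _ /=; rewrite /A1 /A2.
  have N1 : fine (normal_prob 0 1 [set: R]) = 1 :> R by rewrite (probability_setT (normal_prob 0 1)).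
  by case: (J i); rewrite N1 ?mul1r ?mulr1.
apply/seteqP; split => -[a b] /=.
  rewrite /mix /= => H; split => i; have := H i; rewrite /A1 /A2; by case: (J i).
by rewrite /mix /= => -[H K] i; have := H i; have := K i; rewrite /A1 /A2; case: (J i).
Qed.

End mix.

End gaussian_family.

(** * Gaussian integration by parts *)

Section gauss1.
Context (R : realType).
Notation mu := (@lebesgue_measure R).
Notation gam := (@normal_prob R 0 1).
Notation phi := (@normal_pdf R 0 1).

(** Polynomial growth, measured by powers of [1 + x ^+ 2]: this base is at least 1, so exponents can
    be raised freely. *)
Definition pg1 (h : R -> R) := exists C k, 0 <= C /\ forall x, `|h x| <= C * (1 + x ^+ 2) ^+ k.

Lemma phiE x : phi x = normal_peak 1 * expR (- (x ^+ 2 / 2)).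
Proof.
rewrite normal_pdfE ?oner_neq0// /normal_fun subr0; congr (_ * expR _).
by rewrite expr1n mulNr.
Qed.

Lemma phi_gt0 x : 0 < phi x.
Proof. by rewrite phiE mulr_gt0 ?expR_gt0// normal_peak_gt0// oner_neq0. Qed.

Lemma is_derive_phi (x : R) : is_derive x 1 phi (- x * phi x).
Proof.
have -> : phi = normal_peak 1 \*: (expR \o (fun x : R => - (x ^+ 2 / 2))).
  by apply/funext => y; rewrite phiE.
have d1 : is_derive x 1 (fun x : R => - (x ^+ 2 / 2)) (- x).
  apply: (is_derive_eq (f := fun x : R => - (x ^+ 2 / 2))).
  by rewrite /GRing.scale /= ; field.
apply: is_derive_eq.
rewrite -[_ *: _]/(normal_peak 1 * (expR (- (x ^+ 2 / 2)) * - x)).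
by rewrite -[(_ \*: _) x]/(normal_peak 1 * expR (- (x ^+ 2 / 2))); ring.
Qed.

Lemma measurable_phi : measurable_fun setT phi.
Proof. exact: measurable_normal_pdf. Qed.

Lemma Ex_gauss (f : R -> R) : measurable_fun setT f ->
  \int[gam]_x f x = \int[mu]_x (f x * phi x).
Proof.
move=> mf; rewrite /Rintegral; congr fine.
have mf' : measurable_fun setT (fun y => (f y)%:E) by exact/measurable_EFinP.
have D (g : R -> \bar R) := @ge0_integral_density _ _ _ mu gam phi measurable_phi (fun x => ltW (phi_gt0 x)) (fun A _ => erefl) g.
rewrite [LHS]integralE [in RHS]integralE; congr (_ - _)%E.
  rewrite D//; last exact: measurable_funepos.
  apply: eq_integral => x _; rewrite !funepos.unlock EFinM.
  rewrite -[maxe (f x)%:E 0%R]EFin_max -!EFinM -[maxe (f x * phi x)%:E 0%R]EFin_max.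
  by rewrite maxr_pMl ?mul0r// ltW// phi_gt0.
rewrite D//; last exact: measurable_funeneg.
apply: eq_integral => x _; rewrite !funeneg.unlock EFinM.
rewrite -EFinM -!EFinN -[maxe (- f x)%:E 0%R]EFin_max -!EFinM -[maxe (- (f x * phi x))%:E 0%R]EFin_max.
by rewrite -mulNr maxr_pMl ?mul0r// ltW// phi_gt0.
Qed.

Lemma intg_gauss (f : R -> R) : measurable_fun setT f ->
  intg gam f <-> mu.-integrable setT (fun x => (f x * phi x)%:E).
Proof.
move=> mf.
have mf' : measurable_fun setT (fun y => (f y)%:E) by exact/measurable_EFinP.
have D (g : R -> \bar R) := @ge0_integral_density _ _ _ mu gam phi measurable_phi (fun x => ltW (phi_gt0 x)) (fun A _ => erefl) g.
have E : (\int[gam]_x `|(f x)%:E| = \int[mu]_x `|(f x * phi x)%:E|)%E.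
  rewrite D//; last by apply: measurableT_comp.
  by apply: eq_integral => x _ /=; rewrite normrM EFinM [X in (_ * X%:E)%E]gtr0_norm// phi_gt0.
have mfp : measurable_fun setT (fun y => (f y * phi y)%:E).
  by apply/measurable_EFinP; apply: measurable_funM => //; exact: measurable_phi.
by split=> /integrableP[_ H]; apply/integrableP; split; rewrite //= ?E// -?E.
Qed.

(** The exponential dominates the term of degree [k.+1] of its series at [(1 + x ^+ 2) / 4]. The
    rate 1/4 is half that of the Gaussian density, so a factor [expR (- (x ^+ 2 / 4))] is left
    over. *)
Lemma poly_le_exp k (x : R) : (1 + x ^+ 2) ^+ k <= 4 ^+ k.+1 * (k.+1)`!%:R * expR (1/4) * expR (x ^+ 2 / 4).
Proof.
have x2 : 0 <= x ^+ 2 by rewrite sqr_ge0.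
have y1 : 1 <= 1 + x ^+ 2 by lra.
have := @expR_ge1Dxn R ((1 + x ^+ 2) / 4) k ltac:(lra).
rewrite -mulrA -expRD (_ : 1 / 4 + x ^+ 2 / 4 = (1 + x ^+ 2) / 4); last by field.
set e := expR _ => He.
have k0 : 0 < (k.+1)`!%:R :> R by rewrite ltr0n fact_gt0.
have p4 : 0 < 4 ^+ k.+1 :> R by rewrite exprn_gt0.
apply: (@le_trans _ _ ((1 + x ^+ 2) ^+ k.+1)).
  exact: ler_weXn2l.
have : ((1 + x ^+ 2) / 4) ^+ k.+1 / (k.+1)`!%:R <= e by lra.
rewrite ler_pdivrMr// expr_div_n ler_pdivrMr// => /le_trans; apply.
by rewrite [leRHS]mulrC [leRHS]mulrA [leRHS]mulrAC.
Qed.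

Lemma intg_poly_gauss k : intg gam (fun x => (1 + x ^+ 2) ^+ k).
Proof.
have mp : measurable_fun setT (fun x : R => (1 + x ^+ 2) ^+ k).
  by apply/measurable_funX/measurable_funD => //; exact: measurable_funX.
apply/intg_gauss => //.
have s2 : Num.sqrt 2 != 0 :> R by rewrite gt_eqF// sqrtr_gt0.
(* The left-over factor [expR (- (x ^+ 2 / 4))] is the normal density of variance 2 up to the ratio
   of the peaks, so that density serves as dominating function. *)
pose A : R := 4 ^+ k.+1 * (k.+1)`!%:R * expR (1/4) * (normal_peak 1 / normal_peak (Num.sqrt 2)).
have I := @integrable_normal_pdf R 0 (Num.sqrt 2).
apply: (@le_integrable _ _ _ mu _ measurableT _ (fun x => (A%:E * (normal_pdf 0 (Num.sqrt 2) x)%:E)%E)).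
- by apply/measurable_EFinP/measurable_funM => //; exact: measurable_phi.
- move=> x _; rewrite -EFinM lee_fin ger0_norm; last first.
    by rewrite mulr_ge0 ?ltW ?phi_gt0// exprn_gt0// ltr_pwDl ?sqr_ge0.
  apply: le_trans (ler_norm _).
  rewrite phiE normal_pdfE// /A /normal_fun subr0 sqr_sqrtr//.
  have -> : - x ^+ 2 / (2 *+ 2) = x ^+ 2 / 4 - x ^+ 2 / 2 by rewrite -mulr_natr; field.
  rewrite expRD.
  have np : 0 < normal_peak (Num.sqrt 2) :> R by rewrite normal_peak_gt0.
  rewrite (_ : _ * (normal_peak 1 / _) * _ = 4 ^+ k.+1 * (k.+1)`!%:R * expR (1/4) * expR (x ^+ 2 / 4) * (normal_peak 1 * expR (- (x ^+ 2 / 2)))).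
    by rewrite ler_wpM2r ?poly_le_exp// -phiE ltW// phi_gt0.
  by field; rewrite gt_eqF.
exact: (integrableZl measurableT A I).
Qed.

Lemma pg1_intg h : measurable_fun setT h -> pg1 h -> intg gam h.
Proof.
move=> mh [C [k [C0 hC]]]; apply: (@intg_le _ _ _ gam _ (fun x => C * (1 + x ^+ 2) ^+ k)) => //.
exact/intgZ/intg_poly_gauss.
Qed.

Lemma pg1_idM h : pg1 h -> pg1 (fun x => x * h x).
Proof.
move=> [C [k [C0 hC]]]; exists C, k.+1; split=> // x.
rewrite normrM exprS mulrCA ler_pM//.
rewrite ler_norml; apply/andP; split; nra.
Qed.

(** These are the boundary terms of the integration by parts; integers suffice because the line is
    exhausted by intervals with integer ends. *)
Lemma phi_cvg0 h : pg1 h -> (fun n : nat => h n%:R * phi n%:R) @ \oo --> 0 /\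
   (fun n : nat => h (- n%:R) * phi (- n%:R)) @ \oo --> 0.
Proof.
move=> [C [k [C0 hC]]].
pose A : R := C * (4 ^+ k.+1 * (k.+1)`!%:R * expR (1/4)) * normal_peak 1 * 4.
have H (n : nat) (x : R) : x ^+ 2 = n%:R ^+ 2 -> `|h x * phi x| <= A * harmonic n.
  move=> xn; rewrite normrM [X in _ * X]gtr0_norm ?phi_gt0//.
  apply: (@le_trans _ _ (C * (4 ^+ k.+1 * (k.+1)`!%:R * expR (1/4) * expR (x ^+ 2 / 4)) * phi x)).
    apply: ler_wpM2r; first exact/ltW/phi_gt0.
    by apply: (le_trans (hC x)); rewrite ler_wpM2l// poly_le_exp.
  rewrite phiE /A (_ : - (x ^+ 2 / 2) = - (x ^+ 2 / 4) - x ^+ 2 / 4); last by field.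
  rewrite expRD !expRN.
  (* Here [expR (n^2 / 4) >= 1 + n^2 / 4 >= (n + 1) / 4]. *)
  have e1 : (expR (x ^+ 2 / 4))^-1 <= 4 * harmonic n.
    rewrite /harmonic -ler_pV2 ?inE ?unitfE ?mulr_gt0 ?gt_eqF ?invr_gt0 ?expR_gt0 ?mulr_gt0 ?invr_gt0 ?ltr0n//.
    rewrite invfM !invrK.
    apply: le_trans (expR_ge1Dx _); rewrite xn -[n.+1%:R]natr1.
    have : 0 <= n%:R :> R by [].
    have : (n%:R - 1) ^+ 2 >= 0 :> R by rewrite sqr_ge0.
    by nra.
  have e0 := expR_gt0 (x ^+ 2 / 4).
  rewrite [X in X <= _](_ : _ = C * (4 ^+ k.+1 * (k.+1)`!%:R * expR (1 / 4)) * normal_peak 1 * (expR (x ^+ 2 / 4))^-1).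
    rewrite -[leRHS]mulrA; apply: ler_wpM2l => //.
    by rewrite !mulr_ge0 ?normal_peak_ge0 ?expR_ge0 ?exprn_ge0.
  by field; rewrite gt_eqF.
have A0 : (fun n : nat => A * harmonic n) @ \oo --> 0.
  by rewrite -(mulr0 A); apply: cvgM; [exact: cvg_cst|exact: cvg_harmonic].
have A0' : (fun n : nat => - (A * harmonic n)) @ \oo --> 0.
  by rewrite -oppr0; exact: cvgN.
split.
  apply: (squeeze_cvgr _ A0' A0); apply: nearW => n.
  by rewrite -ler_norml H.
apply: (squeeze_cvgr _ A0' A0); apply: nearW => n.
by rewrite -ler_norml H// sqrrN.
Qed.

(** The derivative of [h * phi] is [(h' - x * h) * phi]. Its integral over a symmetric interval is a
    boundary term that tends to 0, and it also tends to the integral over the line by dominated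
    convergence. *)
Lemma gauss_ibp (h h' : R -> R) : (forall x : R, is_derive x 1 h (h' x)) -> continuous h' ->
  pg1 h -> pg1 h' -> \int[gam]_x (x * h x) = \int[gam]_x h' x.
Proof.
move=> dh ch' ph ph'.
have ch : continuous h.
  by move=> x; apply: differentiable_continuous; apply/derivable1_diffP; case: (dh x).
have mh : measurable_fun setT h by exact: continuous_measurable_fun.
have mh' : measurable_fun setT h' by exact: continuous_measurable_fun.
have mxh : measurable_fun setT (fun x : R => x * h x) by exact: measurable_funM.
have i1 : intg gam (fun x => x * h x) by apply: pg1_intg => //; exact: pg1_idM.
have i2 : intg gam h' by exact: pg1_intg.
apply/eqP; rewrite -subr_eq0; apply/eqP; rewrite -opprB -ExB//.
pose g x := h' x - x * h x.
have ig : intg gam g by exact: intgB.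
have mg : measurable_fun setT g by exact: measurable_funB.
rewrite (_ : \int[gam]_x _ = 0) ?oppr0//.
rewrite Ex_gauss// -/g.
have cp : continuous phi by apply: continuous_normal_pdf; rewrite oner_neq0.
pose F := (h * phi)%R.
have dF (x : R) : is_derive x 1 F (g x * phi x).
  have := is_derive_phi x => ?; have := dh x => ?.
  by apply: is_derive_eq; rewrite /GRing.scale /= /g; ring.
have cF : continuous F.
  by move=> x; apply: differentiable_continuous; apply/derivable1_diffP; case: (dF x).
have cg : continuous (fun x => g x * phi x).
  move=> x; apply: cvgM; last exact: cp.
  by apply: cvgB; [exact: ch'|apply: cvgM; [exact: cvg_id|exact: ch]].
pose J (n : nat) : set R := [set` `[- n.+1%:R, n.+1%:R]].
have S (n : nat) : (\int[mu]_(x in J n) (g x * phi x)%:E)%E = (F n.+1%:R - F (- n.+1%:R))%:E.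
  rewrite (@continuous_FTC2 _ _ F)//.
  - by rewrite -subr_gt0 opprK addr_gt0.
  - exact: continuous_subspaceT.
  - split.
    + by move=> x _; case: (dF x).
    + by apply: cvg_at_right_filter; exact: cF.
    + by apply: cvg_at_left_filter; exact: cF.
  - by move=> x _; rewrite derive1E; case: (dF x).
have L1 : (fun n : nat => (F n.+1%:R - F (- n.+1%:R))%:E) @ \oo --> 0%:E.
  apply: cvg_EFin; first by exact: nearW.
  have [c1 c2] := phi_cvg0 ph.
  move: c1 c2; rewrite -cvg_shiftS => c1; rewrite -cvg_shiftS => c2.
  by have := cvgB c1 c2; rewrite subr0; exact.
have L2 : (fun n : nat => \int[mu]_(x in J n) (g x * phi x)%:E)%E @ \oo --> (\int[mu]_x (g x * phi x)%:E)%E.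
  under eq_fun do rewrite integral_mkcond.
  have ig' := (intg_gauss mg).1 ig.
  have mgp : measurable_fun setT (fun x => (g x * phi x)%:E) by case/integrableP : ig'.
  apply: (@dominated_cvg _ _ _ mu _ measurableT _ _ (fun x => `|(g x * phi x)%:E|%E)) => //.
  - move=> n; apply/(measurable_restrictT (fun x => (g x * phi x)%:E)).
      exact: measurable_itv.
    exact: measurable_funTS.
  - move=> x _; apply: cvg_near_cst.
    exists (Num.truncn `|x|) => // n /= xn; rewrite patchE mem_set// /J /= in_itv/=.
    rewrite -ler_norml (le_trans (ltW (truncnS_gt _)))// ler_nat.
    by rewrite ltnS.
  - exact: integrable_abse.
  - move=> n x _; rewrite patchE; case: ifP => // _; rewrite abse0//.
rewrite /Rintegral.
suff -> : (\int[mu]_x (g x * phi x)%:E = 0)%E by [].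
apply: (cvg_unique _ L2).
  exact: ereal_hausdorff.
rewrite /= (_ : (fun n => _) = (fun n => (F n.+1%:R - F (- n.+1%:R))%:E))//.
exact/funext.
Qed.

End gauss1.

Section fubini.
Context d1 (T1 : measurableType d1) d2 (T2 : measurableType d2) (R : realType).
Variables (P1 : probability T1 R) (P2 : probability T2 R).

Lemma Ex_prod (f : T1 * T2 -> R) : intg (P1 \x P2)%E f -> (forall x, intg P2 (fun y => f (x, y))) ->
  \int[(P1 \x P2)%E]_z f z = \int[P1]_x \int[P2]_y f (x, y).
Proof.
move=> fi fi2; rewrite /Rintegral; congr fine.
rewrite -(@integral12_prod_meas1 _ _ _ _ _ P1 P2 (EFin \o f))//.
by apply: eq_integral => x _; rewrite /fubini_F /= -ExE.
Qed.

End fubini.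

(** * Polynomial growth and integration by parts in several variables *)

Section poly_growth.
Context (R : realType) (I : finType).
Implicit Types (F G : (I -> R) -> R) (x : I -> R).

Definition nrm x := 1 + \sum_i x i ^+ 2.
Definition pg F := exists C k, 0 <= C /\ forall x, `|F x| <= C * nrm x ^+ k.
Definition upd x i (t : R) : I -> R := fun j => if j == i then t else x j.

Lemma nrm_ge1 x : 1 <= nrm x.
Proof. by rewrite lerDl sumr_ge0// => i _; rewrite sqr_ge0. Qed.

Lemma nrm_ge0 x : 0 <= nrm x. Proof. exact: le_trans (nrm_ge1 x). Qed.

Lemma nrmX_ge1 x k : 1 <= nrm x ^+ k. Proof. exact/exprn_ege1/nrm_ge1. Qed.

Lemma pg_le F G : (forall x, `|F x| <= `|G x|) -> pg G -> pg F.
Proof. by move=> FG [C [k [C0 H]]]; exists C, k; split=> // x; apply: le_trans (H x). Qed.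

Lemma pg_cst c : pg (fun=> c).
Proof. by exists `|c|, 0%N; split=> // x; rewrite expr0 mulr1. Qed.

Lemma pg_bounded F C : (forall x, `|F x| <= C) -> pg F.
Proof.
move=> H; apply: (@pg_le _ (fun=> C)); last exact: pg_cst.
by move=> x; rewrite (le_trans (H x))// ler_norm.
Qed.

Lemma pg_coord i : pg (fun x => x i).
Proof.
exists 1, 1%N; split=> // x; rewrite mul1r expr1 /nrm (bigD1 i)//= addrA.
have : 0 <= \sum_(j | j != i) x j ^+ 2 by apply: sumr_ge0 => j _; rewrite sqr_ge0.
by move=> s0; rewrite ler_norml; apply/andP; split; nra.
Qed.

Lemma pgD F G : pg F -> pg G -> pg (fun x => F x + G x).
Proof.
move=> [C [k [C0 H]]] [D [l [D0 K]]]; exists (C + D), (k + l)%N; split=> [|x]; first exact: addr_ge0.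
rewrite (le_trans (ler_normD _ _))// mulrDl lerD//.
  rewrite (le_trans (H x))// ler_wpM2l// exprD ler_peMr ?nrmX_ge1// exprn_ge0// nrm_ge0//.
rewrite (le_trans (K x))// ler_wpM2l// exprD ler_peMl ?nrmX_ge1// exprn_ge0// nrm_ge0//.
Qed.

Lemma pgM F G : pg F -> pg G -> pg (fun x => F x * G x).
Proof.
move=> [C [k [C0 H]]] [D [l [D0 K]]]; exists (C * D), (k + l)%N; split=> [|x]; first exact: mulr_ge0.
by rewrite normrM exprD mulrACA ler_pM.
Qed.

Lemma pgZ c F : pg F -> pg (fun x => c * F x).
Proof. by move=> H; apply: pgM => //; exact: pg_cst. Qed.

Lemma pgN F : pg F -> pg (fun x => - F x).
Proof. by apply: pg_le => x; rewrite normrN. Qed.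

Lemma pgB F G : pg F -> pg G -> pg (fun x => F x - G x).
Proof. by move=> f g; apply: pgD => //; exact: pgN. Qed.

Lemma pgX F n : pg F -> pg (fun x => F x ^+ n).
Proof.
move=> H; elim: n => [|n IH]; first exact: (@pg_le _ (fun=> 1) _ (pg_cst 1)).
apply: (@pg_le _ (fun x => F x * F x ^+ n)); last exact: pgM.
by move=> x; rewrite exprS.
Qed.

Lemma pg_sum (J : Type) (s : seq J) (H : J -> (I -> R) -> R) : (forall j, pg (H j)) ->
  pg (fun x => \sum_(j <- s) H j x).
Proof.
move=> h; elim: s => [|a s IH].
  by apply: (pg_le _ (pg_cst 0)) => x; rewrite big_nil.
apply: (@pg_le _ (fun x => H a x + \sum_(j <- s) H j x)); last exact: pgD.
by move=> x; rewrite big_cons.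
Qed.

(** A power of a sum is controlled by its largest term. The bound is a sum of functions of one
    coordinate each, so integrability under a Gaussian family reduces to one-dimensional moments. *)
Lemma nrm_pow x k : nrm x ^+ k <= (1 + #|I|%:R) ^+ k * (1 + \sum_i (x i ^+ 2) ^+ k).
Proof.
have B (M : R) : 1 <= M -> (forall i, x i ^+ 2 <= M) -> nrm x <= (1 + #|I|%:R) * M.
  move=> M1 H; rewrite /nrm mulrDl mul1r lerD// mulr_natl -sumr_const.
  by apply: ler_sum => i _; exact: H.
have s0 : 0 <= \sum_i (x i ^+ 2) ^+ k by apply: sumr_ge0 => i _; rewrite exprn_ge0// sqr_ge0.
have N0 : 0 <= 1 + #|I|%:R :> R by rewrite addr_ge0.
(* If some square exceeds 1, the largest one bounds every term including the constant 1; otherwise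
   all terms are at most 1. *)
have [/existsP[i0 hi0]|/existsPn all1] := boolP [exists i, 1 < x i ^+ 2].
  case: (@arg_maxP _ _ _ i0 xpredT (fun i => x i ^+ 2)) => // j _ jmax.
  have j1 : 1 <= x j ^+ 2 by apply: (le_trans (ltW hi0)); exact: jmax.
  apply: (@le_trans _ _ (((1 + #|I|%:R) * x j ^+ 2) ^+ k)).
    have M0 : 0 <= (1 + #|I|%:R) * x j ^+ 2 by apply: mulr_ge0 => //; exact: sqr_ge0.
    rewrite lerXn2r ?nnegrE ?nrm_ge0//.
    by apply: B => // i; exact: jmax.
  rewrite exprMn ler_wpM2l ?exprn_ge0// (bigD1 j)//= addrCA lerDl addr_ge0//.
  by apply: sumr_ge0 => i _; rewrite exprn_ge0// sqr_ge0.
apply: (@le_trans _ _ (((1 + #|I|%:R) * 1) ^+ k)).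
  rewrite lerXn2r ?nnegrE ?nrm_ge0 ?mulr_ge0 ?sqr_ge0//.
  apply: B => // i; rewrite leNgt; exact: all1.
by rewrite mulr1 ler_peMr ?exprn_ge0// lerDl.
Qed.

Lemma nrm_upd x i t : nrm (upd x i t) <= nrm x * (1 + t ^+ 2).
Proof.
have -> : nrm (upd x i t) = 1 + t ^+ 2 + \sum_(j | j != i) x j ^+ 2.
  rewrite /nrm (bigD1 i)//= /upd eqxx addrA; congr (_ + _).
  by apply: eq_bigr => j /negbTE ->.
have -> : nrm x = 1 + x i ^+ 2 + \sum_(j | j != i) x j ^+ 2 by rewrite /nrm (bigD1 i)//= addrA.
have : 0 <= \sum_(j | j != i) x j ^+ 2 by apply: sumr_ge0 => j _; rewrite sqr_ge0.
set s := \sum_(j | _) _ => s0.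
have : 0 <= t ^+ 2 by rewrite sqr_ge0.
have : 0 <= x i ^+ 2 by rewrite sqr_ge0.
by nra.
Qed.

Lemma pg_upd F x i : pg F -> pg1 (fun t => F (upd x i t)).
Proof.
move=> [C [k [C0 H]]]; exists (C * nrm x ^+ k), k; split=> [|t].
  by rewrite mulr_ge0// exprn_ge0// nrm_ge0.
rewrite (le_trans (H _))// -mulrA ler_wpM2l// -exprMn lerXn2r ?nnegrE ?nrm_ge0 ?nrm_upd//.
by rewrite mulr_ge0 ?nrm_ge0// addr_ge0// sqr_ge0.
Qed.

End poly_growth.

Section gfam_sub.
Context (R : realType) d (T : measurableType d) (P : probability T R).
Context (I J : finType) (xi : I -> T -> R) (f : J -> I).

Lemma gfam_sub : injective f -> gfam P xi -> gfam P (fun j => xi (f j)).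
Proof.
move=> fi [mx gx]; split=> [j|A mA]; first exact: mx.
(* Quantifying over preimages avoids choosing an inverse of [f]: off the image the condition is
   vacuous and [B i] is the whole line. *)
pose B i : set R := [set x | forall j, f j = i -> A j x].
have Bf j : B (f j) = A j.
  by apply/seteqP; split => x /=; [apply|move=> Ax k /fi ->].
have Bn i : i \notin codom f -> B i = setT.
  by move=> ni; apply/seteqP; split => x //= _ j fj; move: ni; rewrite -fj codom_f.
have mB i : measurable (B i).
  have [/codomP[j ->]|/Bn ->//] := boolP (i \in codom f); by rewrite Bf.
rewrite (_ : [set t | _] = [set t | forall i, B i (xi i t)]).
  rewrite gx// (bigID (mem (codom f)))/= [X in _ * X]big1 ?mulr1.
    rewrite -big_uniq/=; last by rewrite map_inj_uniq// enum_uniq.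
    by rewrite big_map big_enum /=; apply: eq_bigr => j _; rewrite Bf.
  by move=> i /Bn ->; rewrite (probability_setT (normal_prob 0 1)).
apply/seteqP; split => t /= H; first by move=> i j <-.
by move=> j; apply: (H (f j)).
Qed.

End gfam_sub.

Section gfam_coord.
Context (R : realType) d (T : measurableType d) (P : probability T R).
Context (I : finType) (xi : I -> T -> R).
Hypothesis g : gfam P xi.
Notation gam := (@normal_prob R 0 1).

Lemma gfam_id : gfam gam (fun (_ : unit) (x : R) => x).
Proof.
split=> [_|A mA]; first exact: measurable_id.
rewrite (bigD1 tt)//= big1 ?mulr1 => [|[]//]; congr (fine (normal_prob 0 1 _)).
by apply/seteqP; split => x /=; [apply|move=> Ax []].
Qed.

Let g1 i : gfam P (fun _ : unit => xi i).
Proof. by apply: (@gfam_sub _ _ _ _ _ _ _ (fun=> i)) => // -[] []. Qed.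

Lemma gfam_coordE i (h : R -> R) : measurable_fun setT h ->
  \int[P]_t h (xi i t) = \int[gam]_x h x.
Proof.
move=> mh; apply: (gfam_Ex (g1 i) gfam_id (f := fun y : rvT R unit => h (y tt))).
by apply: measurableT_comp => //; exact: measurable_coord.
Qed.

Lemma gfam_coord_intg i (h : R -> R) : measurable_fun setT h ->
  intg gam h -> intg P (fun t => h (xi i t)).
Proof.
move=> mh; apply: (gfam_intg gfam_id (g1 i) (f := fun y : rvT R unit => h (y tt))).
by apply: measurableT_comp => //; exact: measurable_coord.
Qed.

Lemma pg_intg (F : (I -> R) -> R) : measurable_fun [set: rvT R I] F -> pg F ->
  intg P (fun t => F (xi^~ t)).
Proof.
move=> mF [C [k [C0 H]]].
have mxi : measurable_fun setT (fun t => (xi^~ t : rvT R I)).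
  by apply: measurable_torv; case: g.
apply: (@intg_le _ _ _ P _ (fun t => C * ((1 + #|I|%:R) ^+ k * (1 + \sum_i (xi i t ^+ 2) ^+ k)))).
- exact: (measurableT_comp mF mxi).
- by move=> t; rewrite (le_trans (H _))// ler_wpM2l// nrm_pow.
apply/intgZ/intgZ/intgD; first exact: intg_cst.
apply: intg_sum => i.
have mk : measurable_fun setT (fun x : R => (x ^+ 2) ^+ k).
  by apply/measurable_funX/measurable_funX.
apply: (gfam_coord_intg i mk); apply: pg1_intg => //.
exists 1, k; split=> // x; rewrite mul1r ger0_norm; last by apply: exprn_ge0; exact: sqr_ge0.
have x0 := sqr_ge0 x; rewrite lerXn2r ?nnegrE ?lerDr//; exact: addr_ge0.
Qed.

Lemma measurable_upd (F : (I -> R) -> R) x i : measurable_fun [set: rvT R I] F ->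
  measurable_fun setT (fun t => F (upd x i t)).
Proof.
move=> mF; apply: (measurableT_comp (f := F : rvT R I -> R) mF).
by apply: measurable_torv => j; rewrite /upd; case: eqP.
Qed.

(** Coordinate [i] is taken from an independent copy; by Fubini the identity becomes [gauss_ibp] in
    that coordinate, for each fixed value of the others. *)
Lemma gfam_ibp i (F F' : (I -> R) -> R) :
  measurable_fun [set: rvT R I] F -> measurable_fun [set: rvT R I] F' -> pg F -> pg F' ->
  (forall x (t : R), is_derive t 1 (fun s => F (upd x i s)) (F' (upd x i t))) ->
  (forall x, continuous (fun t => F' (upd x i t))) ->
  \int[P]_t (xi i t * F (xi^~ t)) = \int[P]_t F' (xi^~ t).
Proof.
move=> mF mF' pF pF' dF cF'.
have G := gfam_mix (pred1 i) g g.
have key (H : (I -> R) -> R) : measurable_fun [set: rvT R I] H -> pg H ->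
    \int[P]_t H (xi^~ t) = \int[P]_w \int[gam]_s H (upd (xi^~ w) i s).
  move=> mH pH; rewrite (gfam_Ex g G mH).
  have E z : (fun j => mix xi xi (pred1 i) j z) = upd (xi^~ z.1) i (xi i z.2).
    by apply/funext => j; rewrite /mix /upd /=; case: eqP => // ->.
  have iH : intg (P \x P)%E (fun z => H (mix xi xi (pred1 i) ^~ z)).
    by apply: (gfam_intg g G mH); exact: pg_intg.
  rewrite (Ex_prod iH); last first.
    move=> x; under eq_fun do rewrite E /=.
    apply: (@gfam_coord_intg i (fun s => H (upd (xi^~ x) i s))); first exact: measurable_upd.
    by apply: pg1_intg; [exact: measurable_upd|exact: pg_upd].
  apply: eq_Rintegral => w _.
  rewrite -(@gfam_coordE i (fun s => H (upd (xi^~ w) i s))); last exact: measurable_upd.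
  by apply: eq_Rintegral => w' _; rewrite E.
rewrite (key (fun x => x i * F x)); last 2 first.
- by apply: measurable_funM => //; exact: measurable_coord.
- by apply: pgM => //; exact: pg_coord.
rewrite [RHS](key _ mF' pF'); apply: eq_Rintegral => w _.
rewrite -(gauss_ibp (h := fun s => F (upd (xi^~ w) i s)))//; try exact: pg_upd.
by apply: eq_Rintegral => s _; rewrite /upd eqxx.
Qed.

End gfam_coord.

(** * Characteristic functions of Gaussian families *)

Section char_fun.
Context (R : realType) d (T : measurableType d) (P : probability T R).
Context (I : finType) (xi : I -> T -> R).

Definition lin (s : I -> R) (x : I -> R) := \sum_i s i * x i.

Lemma measurable_lin s : measurable_fun [set: rvT R I] (lin s).
Proof.
by apply: measurable_sum => i; apply: measurable_funM => //; exact: measurable_coord.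
Qed.

Lemma pg_lin s : pg (lin s).
Proof. by apply: pg_sum => i; apply: pgZ; exact: pg_coord. Qed.

Lemma lin_upd s x i t : lin s (upd x i t) = s i * t + \sum_(j | j != i) s j * x j.
Proof.
rewrite /lin (bigD1 i)//= /upd eqxx; congr (_ + _).
by apply: eq_bigr => j /negbTE ->.
Qed.

Hypothesis g : gfam P xi.

(** Integration by parts in each coordinate, weighted by [s i] and summed. This is the right-hand
    side of the differential equation used in [gfam_cf]. *)
Lemma cf_ibp s u c :
  \int[P]_t (lin s (xi^~ t) * sin (u * lin s (xi^~ t) + c)) =
  u * (\sum_i s i ^+ 2) * \int[P]_t cos (u * lin s (xi^~ t) + c).
Proof.
have mu_ : measurable_fun [set: rvT R I] (fun x => u * lin s x + c).
  by apply: measurable_funD => //; apply: measurable_funM => //; exact: measurable_lin.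
pose F (x : I -> R) := sin (u * lin s x + c).
pose C (x : I -> R) := cos (u * lin s x + c).
have mF : measurable_fun [set: rvT R I] F.
  by apply: measurableT_comp => //; apply: continuous_measurable_fun; exact: continuous_sin.
have mC : measurable_fun [set: rvT R I] C.
  by apply: measurableT_comp => //; apply: continuous_measurable_fun; exact: continuous_cos.
have pF : pg F.
  by apply: (@pg_bounded _ _ _ 1) => x; rewrite ler_norml sin_geN1 sin_le1.
have pC : pg C.
  by apply: (@pg_bounded _ _ _ 1) => x; rewrite ler_norml cos_geN1 cos_le1.
have iC := pg_intg g mC pC.
have K i : \int[P]_t (xi i t * F (xi^~ t)) = \int[P]_t (u * s i * C (xi^~ t)).
  apply: (gfam_ibp g (F' := fun x => u * s i * C x)) => //.
  - by apply: measurable_funM.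
  - exact: pgZ.
  - move=> x t; rewrite /F /C.
    under eq_fun do rewrite lin_upd. rewrite lin_upd.
    set k := \sum_(j | _) _.
    have h : is_derive t 1 (fun y : R => u * (s i * y + k) + c) (u * s i).
      apply: is_derive_eq.
      by rewrite /GRing.scale /=; ring.
    have := @is_derive1_comp _ sin (fun y : R => u * (s i * y + k) + c) t _ _ (is_derive_sin _) h.
    by rewrite mulrC.
  - move=> x; rewrite /C; under eq_fun do rewrite lin_upd.
    move=> t; apply: cvgM; first exact: cvg_cst.
    apply: continuous_comp; last exact: continuous_cos.
    apply: cvgD; last exact: cvg_cst.
    apply: cvgM; first exact: cvg_cst.
    apply: cvgD; last exact: cvg_cst.
    by apply: cvgM; [exact: cvg_cst|exact: cvg_id].
transitivity (\sum_i s i * \int[P]_t (xi i t * F (xi^~ t))).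
  under eq_Rintegral do rewrite {1}/lin mulr_suml.
  have iF i : intg P (fun t => xi i t * F (xi^~ t)).
    apply: (pg_intg g (F := fun x => x i * F x)).
      by apply: measurable_funM => //; exact: measurable_coord.
    by apply: pgM => //; exact: pg_coord.
  rewrite Ex_sum.
    apply: eq_bigr => i _; rewrite -ExZ//; apply: eq_Rintegral => t _.
    by rewrite mulrA.
  move=> i; apply: eq_integrable (intgZ (s i) (iF i)) => // t _ /=.
  by rewrite mulrA.
under eq_bigr do rewrite K ExZ//.
rewrite mulr_sumr mulr_suml; apply: eq_bigr => i _.
by rewrite /C; ring.
Qed.

(** With [psi u = E cos (u * L + c)] one has [psi' u = - u * v * psi u], so
    [psi u * expR (u ^+ 2 * v / 2)] is constant, equal to [cos c] at 0. The phase [c] makes one real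
    identity carry both the real and the imaginary part of the characteristic function. *)
Lemma gfam_cf s c :
  \int[P]_t cos (lin s (xi^~ t) + c) = cos c * expR (- ((\sum_i s i ^+ 2) / 2)).
Proof.
set v := \sum_i _.
pose L t := lin s (xi^~ t).
have mxi : measurable_fun setT (fun t => (xi^~ t : rvT R I)).
  by apply: measurable_torv; case: g.
have mL : measurable_fun setT L by exact: (measurableT_comp (@measurable_lin s) mxi).
have iL : intg P L by exact: (pg_intg g (@measurable_lin s) (@pg_lin s)).
pose f (u : R) (t : T) := cos (u * L t + c).
have mf u : measurable_fun setT (f u).
  apply: measurableT_comp; first by apply: continuous_measurable_fun; exact: continuous_cos.
  by apply: measurable_funD => //; exact: measurable_funM.
have intf u : intg P (f u).
  by apply: (@intg_bound _ _ _ _ _ 1) => // t; rewrite ler_norml cos_geN1 cos_le1.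
have df (u : R) t : is_derive u 1 (f ^~ t) (- (L t * sin (u * L t + c))).
  have h : is_derive u 1 (fun y : R => y * L t + c) (L t).
    apply: is_derive_eq.
    by rewrite /GRing.scale /=; ring.
  have := @is_derive1_comp _ cos (fun y : R => y * L t + c) u _ _ (is_derive_cos _) h.
  by rewrite mulNr mulrC.
pose psi u := \int[P]_t f u t.
have dpsi (u : R) : is_derive u 1 psi (- (u * v * psi u)).
  have uI : [set` `]u - 1, u + 1[] u by rewrite /= in_itv/=; apply/andP; split; lra.
  have d1E a y : partial1of2 f a y = - (L y * sin (a * L y + c)).
    by rewrite partial1of2E; case: (df a y).
  have d1 a y : [set` `]u - 1, u + 1[] a -> setT y -> derivable (f ^~ y) a 1.
    by move=> _ _; case: (df a y).
  have ub a y : [set` `]u - 1, u + 1[] a -> setT y -> `|partial1of2 f a y| <= `|L y|.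
    move=> _ _; rewrite d1E normrN normrM ler_piMr//.
    by rewrite ler_norml sin_geN1 sin_le1.
  have D := @derivable_under_integral _ _ _ P f setT measurableT u (u - 1) (u + 1) uI
     (fun a _ => intf a) d1 (fun y => `|L y|) (fun y => normr_ge0 _) (intg_abs iL) ub.
  have E := @differentiation_under_integral _ _ _ P f setT measurableT u (u - 1) (u + 1) uI
     (fun a _ => intf a) d1 (fun y => `|L y|) (fun y => normr_ge0 _) (intg_abs iL) ub.
  apply: DeriveDef => //.
  rewrite -derive1E E.
  transitivity (\int[P]_y (- (L y * sin (u * L y + c)))).
    by apply: eq_Rintegral => y _; exact: d1E.
  rewrite ExN ?cf_ibp//.
  apply: (@intg_le _ _ _ _ _ (fun t => `|L t|)) => //.
  - apply: measurable_funM => //; apply: measurableT_comp.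
      by apply: continuous_measurable_fun; exact: continuous_sin.
    by apply: measurable_funD => //; exact: measurable_funM.
  - move=> t; rewrite normrM ler_piMr// ler_norml sin_geN1 sin_le1//.
  - exact: intg_abs.
pose K (u : R) := psi u * expR (u ^+ 2 * v / 2).
have dK (u : R) : is_derive u 1 K 0.
  have h : is_derive u 1 (fun y : R => y ^+ 2 * v / 2) (u * v).
    apply: is_derive_eq.
    by rewrite /GRing.scale /=; field.
  have h2 := @is_derive1_comp _ expR (fun y : R => y ^+ 2 * v / 2) u _ _ (is_derive_expR _) h.
  have := is_deriveM (dpsi u) h2.
  move=> h3; apply: (is_derive_eq h3).
  by rewrite /GRing.scale /=; ring.
have K01 := is_derive_0_is_cst (f := K) 1 0 dK.
have : psi 1 * expR (v / 2) = cos c.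
  move: K01; rewrite /K expr1n mul1r => ->.
  rewrite expr0n /= !mul0r expR0 mulr1 /psi.
  rewrite -[RHS](Ex_cst P); apply: eq_Rintegral => t _.
  by rewrite /f mul0r add0r.
rewrite expRN => <-; rewrite mulfK ?gt_eqF ?expR_gt0// /psi.
by apply: eq_Rintegral => t _; rewrite /f mul1r.
Qed.

End char_fun.

(** * Characteristic functions determine Gaussian families *)

Section fubini_swap.
Context d1 (T1 : measurableType d1) d2 (T2 : measurableType d2) (R : realType).
Variables (P1 : probability T1 R) (P2 : probability T2 R).

Lemma Ex_swap (f : T1 * T2 -> R) M : measurable_fun setT f -> (forall z, `|f z| <= M) ->
  \int[P2]_y \int[P1]_x f (x, y) = \int[P1]_x \int[P2]_y f (x, y).
Proof.
move=> mf bf.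
have i1 y : intg P1 (fun x => f (x, y)).
  by apply: (@intg_bound _ _ _ _ _ M) => //; exact: (measurableT_comp mf (measurable_pair2 y)).
have i2 x : intg P2 (fun y => f (x, y)).
  by apply: (@intg_bound _ _ _ _ _ M) => //; exact: (measurableT_comp mf (measurable_pair1 x)).
have i : intg (P1 \x P2)%E f by exact: (@intg_bound _ _ _ _ _ M).
rewrite -[RHS](Ex_prod i i2) /Rintegral; congr fine.
rewrite -(@integral21_prod_meas1 _ _ _ _ _ P1 P2 (EFin \o f))//.
by apply: eq_integral => y _; rewrite /fubini_G /= -ExE.
Qed.

End fubini_swap.

Section wdensity.
Context d (T : measurableType d) (R : realType) (P : probability T R).
Variable w : T -> R.
Hypotheses (iw : intg P w) (w0 : forall x, 0 <= w x).

Definition wdensity (A : set T) : \bar R := (\int[P]_(x in A) (w x)%:E)%E.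

Let wdensity0 : wdensity set0 = 0%E.
Proof. by rewrite /wdensity integral_set0. Qed.

Let wdensity_ge0 A : (0 <= wdensity A)%E.
Proof. by apply: integral_ge0 => x _; rewrite lee_fin. Qed.

Let wdensity_sigma_additive : semi_sigma_additive wdensity.
Proof.
move=> /= A mA tA mUA.
rewrite /wdensity/= integral_bigcup//=; last first.
  by apply: (integrableS _ _ (subsetT _)) => //; exact: iw.
apply: is_cvg_ereal_nneg_natsum_cond => n _ _.
by apply: integral_ge0 => /= x ?; rewrite lee_fin.
Qed.

HB.instance Definition _ := isMeasure.Build _ _ _
  wdensity wdensity0 wdensity_ge0 wdensity_sigma_additive.

Definition wmeasure : {measure set T -> \bar R} := wdensity.

End wdensity.

Section ramp.
Context (R : realType).

(** This is [min (max t 0) 1], written with absolute values so that continuity is immediate. *)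
Definition clamp (t : R) : R := (`|t| - `|t - 1| + 1) / 2.

Lemma clamp0 t : t <= 0 -> clamp t = 0.
Proof. by move=> t0; rewrite /clamp ler0_norm// ler0_norm; [field|lra]. Qed.

Lemma clamp1 t : 1 <= t -> clamp t = 1.
Proof. by move=> t0; rewrite /clamp ger0_norm ?ger0_norm; [field|lra..]. Qed.

Lemma clamp_ge0 t : 0 <= clamp t.
Proof.
rewrite /clamp; have := ler_normD t (1 - t); have := ler_norm (t - 1); have := ler_norm (-t).
rewrite normrN addrCA subrr addr0 normr1 (distrC 1).
have [h|h] := leP 0 t; [rewrite (ger0_norm h)|rewrite (ltr0_norm h)];
 have [k|k] := leP 0 (t - 1); rewrite ?(ger0_norm k) ?(ltr0_norm k); lra.
Qed.

Lemma clamp_le1 t : clamp t <= 1.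
Proof.
rewrite /clamp.
have [h|h] := leP 0 t; [rewrite (ger0_norm h)|rewrite (ltr0_norm h)];
 have [k|k] := leP 0 (t - 1); rewrite ?(ger0_norm k) ?(ltr0_norm k); lra.
Qed.

Lemma continuous_clamp : continuous clamp.
Proof.
move=> x; apply: cvgM; last exact: cvg_cst.
apply: cvgD; last exact: cvg_cst.
apply: cvgB; first exact: norm_continuous.
apply: cvg_norm.
by apply: cvgB; [exact: cvg_id|exact: cvg_cst].
Qed.

Lemma continuous_ramp (b : R) (n : nat) : continuous (fun x => clamp (n%:R * (x - b))).
Proof.
move=> x; apply: (@continuous_comp _ _ _ (fun x => n%:R * (x - b)) clamp); last exact: continuous_clamp.
apply: cvgM; first exact: cvg_cst.
by apply: cvgB; [exact: cvg_id|exact: cvg_cst].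
Qed.

End ramp.

Section affine.
Context (R : realType).
Notation mu := (@lebesgue_measure R).

Lemma affine_subst (G : R -> R) (m s : R) : 0 < s -> continuous G -> (forall x, 0 <= G x) ->
  (\int[mu]_x (G x)%:E = \int[mu]_x (G (m + s * x) * s)%:E)%E.
Proof.
move=> s0 cG G0; pose F (x : R) := m + s * x.
have dF (x : R) : is_derive x 1 F s.
  by apply: is_derive_eq; rewrite /GRing.scale /=; ring.
have F'E : (F^`())%classic = cst s by apply/funext => x; rewrite derive1E; case: (dF x).
rewrite (@increasing_ge0_integration_by_substitutionT _ F G)//.
- by apply: eq_integral => x _; rewrite F'E.
- by move=> x y xy; rewrite /F ltrD2l ltr_pM2l.
- by rewrite F'E => x; exact: cvg_cst.
- by rewrite F'E; exact: is_cvg_cst.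
- by rewrite F'E; exact: is_cvg_cst.
- apply/cvgrNyPle => B; near=> x.
  have : x <= (B - m) / s by near: x; apply: nbhs_ninfty_le; exact: num_real.
  by rewrite ler_pdivlMr// /F mulrC => ?; lra.
- apply/cvgryPge => B; near=> x.
  have : (B - m) / s <= x by near: x; apply: nbhs_pinfty_ge; exact: num_real.
  by rewrite ler_pdivrMr// /F mulrC => ?; lra.
Unshelve. all: by end_near. Qed.

Lemma normal_pdf_affine (m s x : R) : 0 < s -> normal_pdf m s (m + s * x) * s = normal_pdf 0 1 x.
Proof.
move=> s0; rewrite phiE normal_pdfE ?gt_eqF// /normal_fun.
rewrite addrAC subrr add0r.
have -> : - (s * x) ^+ 2 / (s ^+ 2 *+ 2) = - (x ^+ 2 / 2).
  by rewrite -mulr_natr; field; rewrite gt_eqF.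
rewrite mulrAC; congr (_ * _); rewrite /normal_peak.
rewrite expr1n mul1r -mulrnAr sqrtrM ?sqr_ge0// sqrtr_sqr gtr0_norm// invfM mulrAC mulVf ?gt_eqF// mul1r.
by [].
Qed.

End affine.

Section measurable_compositions.
Context (R : realType) d (T : measurableType d).
Implicit Types f : T -> R.

Lemma measurable_cos f : measurable_fun setT f -> measurable_fun setT (fun t => cos (f t)).
Proof.
move=> mf; apply: measurableT_comp => //.
by apply: continuous_measurable_fun; exact: continuous_cos.
Qed.

Lemma measurable_comp_continuous (h : R -> R) f : continuous h -> measurable_fun setT f ->
  measurable_fun setT (fun t => h (f t)).
Proof.
by move=> ch mf; apply: measurableT_comp => //; exact: continuous_measurable_fun.
Qed.

Lemma measurable_indic_comp (B : set R) f : measurable B -> measurable_fun setT f ->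
  measurable_fun setT (fun t => \1_B (f t) : R).
Proof. by move=> mB mf; apply: (measurableT_comp (f := (\1_B : R -> R))) => //; exact: measurable_indic. Qed.

Lemma indic01 (U : Type) (B : set U) x : 0 <= \1_B x :> R /\ \1_B x <= 1 :> R.
Proof. by rewrite indicE; case: (_ \in _). Qed.

End measurable_compositions.

Section bounded_convergence.
Context (R : realType) d (T : measurableType d) (P : probability T R).

Lemma bounded_cvg_Ex (f_ : nat -> T -> R) (f : T -> R) (M : R) :
  (forall n, measurable_fun setT (f_ n)) -> measurable_fun setT f ->
  (forall x, (fun n => f_ n x) @ \oo --> f x) -> (forall n x, `|f_ n x| <= M) ->
  (fun n => \int[P]_x f_ n x) @ \oo --> \int[P]_x f x.
Proof.
move=> mf_ mf H HM; apply: fine_cvg; rewrite -ExE; last first.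
  apply: (@intg_bound _ _ _ _ _ M) => // x.
  rewrite -(cvg_lim (@Rhausdorff R) (cvg_norm (H x))).
  apply: limr_le; first by apply/cvg_ex; exists `|f x|; exact: cvg_norm.
  by apply: nearW => n; exact: HM.
apply: (@dominated_cvg _ _ _ P _ measurableT _ _ (cst M%:E)) => //.
- by move=> n; exact/measurable_EFinP.
- by move=> x _; apply: cvg_EFin; [exact: nearW|exact: H].
- exact: (intg_cst P M).
- by move=> n x _; rewrite lee_fin.
Qed.

End bounded_convergence.

Section gauss_smoothing.
Context (R : realType) d (T : measurableType d) (P : probability T R).
Notation mu := (@lebesgue_measure R).
Notation gam := (@normal_prob R 0 1).
Variables (X w : T -> R) (M : R).
Hypotheses (mX : measurable_fun setT X) (mw : measurable_fun setT w).
Hypotheses (w0 : forall t, 0 <= w t) (wM : forall t, w t <= M).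

Let wn t : `|w t| <= M. Proof. by rewrite ger0_norm. Qed.

(* The Gaussian kernel is itself a characteristic function, so a Gaussian smoothing of the law of
   [X] only depends on the characteristic function of [X]. *)
Lemma gauss_kernel_cf (a e : R) : 0 < e ->
  \int[P]_t (w t * expR (- ((a - X t) ^+ 2 / (e ^+ 2 * 2)))) =
  \int[gam]_z \int[P]_t (w t * cos (z / e * X t - z / e * a)).
Proof.
move=> e0.
pose f (y : R * T) := w y.2 * cos (y.1 / e * X y.2 - y.1 / e * a).
have mf : measurable_fun setT f.
  apply: measurable_funM; first exact: (measurableT_comp mw measurable_snd).
  apply: measurable_cos; apply: measurable_funB; apply: measurable_funM => //.
  - exact: measurable_funM.
  - exact: (measurableT_comp mX measurable_snd).
  - exact: measurable_funM.
have bf y : `|f y| <= M.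
  rewrite normrM -[leRHS]mulr1 ler_pM//.
  by rewrite ler_norml cos_geN1 cos_le1.
transitivity (\int[P]_t \int[gam]_z f (z, t)).
  apply: eq_Rintegral => t _.
  transitivity (\int[gam]_z (w t * cos ((X t - a) / e * z + 0))).
    rewrite ExZ.
      have := gfam_cf (gfam_id R) (fun=> (X t - a) / e) 0.
      rewrite /lin cos0 mul1r (bigD1 tt)//= big1 ?addr0; last by case.
      rewrite (_ : ((X t - a) / e) ^+ 2 / 2 = (a - X t) ^+ 2 / (e ^+ 2 * 2)); last by field; rewrite gt_eqF.
      move=> <-; congr (_ * _); apply: eq_Rintegral => z _.
      by rewrite (bigD1 tt)//= big1 ?addr0//; case.
    apply: (@intg_bound _ _ _ _ _ 1) => //.
      apply: measurable_cos; apply: measurable_funD => //; exact: measurable_funM.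
    by move=> z; rewrite ler_norml cos_geN1 cos_le1.
  apply: eq_Rintegral => z _; rewrite /f/=; congr (_ * cos _).
  by field; rewrite gt_eqF.
exact: (Ex_swap gam P mf bf).
Qed.

(** The substitution [a = X t + e * z] and Tonelli's theorem turn the smoothing of [h] into an
    integral over [a], in which the law of [X] enters only through the kernel expectation computed
    by [gauss_kernel_cf]. *)
Lemma gauss_smoothing (h : R -> R) (e : R) : 0 < e -> continuous h -> (forall x, 0 <= h x) ->
  (forall x, h x <= 1) ->
  (\int[P]_t \int[gam]_z (w t * h (X t + e * z))%:E =
   \int[mu]_a ((h a * normal_peak e)%:E * (\int[P]_t (w t * expR (- ((a - X t) ^+ 2 / (e ^+ 2 * 2))))%R)%:E))%E.
Proof.
move=> e0 ch h0 h1.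
have mh : measurable_fun setT h by exact: continuous_measurable_fun.
pose k (x a : R) := h a * normal_pdf x e a.
transitivity (\int[P]_t \int[mu]_a (w t * k (X t) a)%:E)%E.
  apply: eq_integral => t _.
  rewrite (@affine_subst _ (fun a => w t * k (X t) a) (X t) e)//; last 2 first.
  - move=> x; apply: cvgM; first exact: cvg_cst.
    by apply: cvgM; [exact: ch|apply: continuous_normal_pdf; rewrite gt_eqF].
  - by move=> x; rewrite mulr_ge0// mulr_ge0// normal_pdf_ge0.
  rewrite (@ge0_integral_density _ _ _ mu gam (normal_pdf 0 1)) //.
  - apply: eq_integral => x _; rewrite -EFinM; congr EFin.
    by rewrite /k -!mulrA normal_pdf_affine.
  - exact: measurable_normal_pdf.
  - by move=> x; rewrite normal_pdf_ge0.
  - apply/measurable_EFinP/measurable_funM => //; apply: measurableT_comp => //.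
    by apply: measurable_funD => //; exact: measurable_funM.
  - by move=> x; rewrite lee_fin mulr_ge0.
pose F (y : T * R) := (w y.1 * k (X y.1) y.2)%:E.
have kE x a : k x a = h a * normal_peak e * expR (- ((a - x) ^+ 2 / (e ^+ 2 * 2))).
  by rewrite /k normal_pdfE ?gt_eqF// /normal_fun mulrA mulNr -mulr_natr.
have mF : measurable_fun setT F.
  apply/measurable_EFinP/measurable_funM; first exact: (measurableT_comp mw measurable_fst).
  under eq_fun do rewrite kE.
  apply: measurable_funM.
    by apply: measurable_funM => //; exact: (measurableT_comp mh measurable_snd).
  apply: measurableT_comp => //; apply: measurableT_comp => //.
  apply: measurable_funM => //; apply: measurable_funX; apply: measurable_funB => //.
  exact: (measurableT_comp mX measurable_fst).
have F0 y : (0 <= F y)%E.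
  by rewrite lee_fin mulr_ge0// /k mulr_ge0// normal_pdf_ge0.
have := @fubini_tonelli _ _ _ _ _ P mu F mF F0.
rewrite /F/= => ->; apply: eq_integral => a _.
rewrite -ExE; last first.
  apply: (@intg_bound _ _ _ _ _ M).
    apply: measurable_funM => //; apply: measurableT_comp => //; apply: measurableT_comp => //.
    by apply: measurable_funM => //; apply: measurable_funX; apply: measurable_funB => //.
  move=> t; rewrite normrM -[leRHS]mulr1 ler_pM// ger0_norm ?expR_ge0//.
  by rewrite -expR0 ler_expR oppr_le0 divr_ge0 ?sqr_ge0// mulr_ge0 ?sqr_ge0.
have c0 : 0 <= h a * normal_peak e by rewrite mulr_ge0// normal_peak_ge0.
rewrite -ge0_integralZl_EFin//.
- by apply: eq_integral => t _; rewrite kE -EFinM; congr EFin; ring.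
- by move=> t _; rewrite lee_fin mulr_ge0// expR_ge0.
apply/measurable_EFinP.
apply: measurable_funM => //; apply: measurableT_comp => //; apply: measurableT_comp => //.
by apply: measurable_funM => //; apply: measurable_funX; apply: measurable_funB => //.
Qed.

Lemma gauss_smoothing_cvg (h : R -> R) : continuous h -> (forall x, 0 <= h x) ->
  (forall x, h x <= 1) ->
  (fun n : nat => (\int[P]_t \int[gam]_z (w t * h (X t + n.+1%:R^-1 * z))%:E)%E) @ \oo -->
   (\int[P]_t (w t * h (X t)))%:E.
Proof.
move=> ch h0 h1.
have mh : measurable_fun setT h by exact: continuous_measurable_fun.
pose f (n : nat) (y : T * R) := w y.1 * h (X y.1 + n.+1%:R^-1 * y.2).
have mf n : measurable_fun setT (f n).
  apply: measurable_funM; first exact: (measurableT_comp mw measurable_fst).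
  apply: measurableT_comp => //; apply: measurable_funD.
    exact: (measurableT_comp mX measurable_fst).
  exact: measurable_funM.
have bf n y : `|f n y| <= M.
  by rewrite normrM -[leRHS]mulr1 ler_pM// ger0_norm.
have if_ n : intg (P \x gam)%E (f n) by apply: (@intg_bound _ _ _ _ _ M); [exact: mf|exact: bf].
pose f0 (y : T * R) := w y.1 * h (X y.1).
have mf0 : measurable_fun setT f0.
  apply: measurable_funM; first exact: (measurableT_comp mw measurable_fst).
  apply: measurableT_comp => //; exact: (measurableT_comp mX measurable_fst).
have -> : \int[P]_t (w t * h (X t)) = \int[(P \x gam)%E]_y f0 y.
  rewrite Ex_prod.
  - by apply: eq_Rintegral => t _; rewrite /f0 /= Ex_cst.
  - apply: (@intg_bound _ _ _ _ _ M) => // y.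
    by rewrite normrM -[leRHS]mulr1 ler_pM// ger0_norm.
  - by move=> x; exact: (intg_cst gam (w x * h (X x))).
have E n : (\int[P]_t \int[gam]_z (w t * h (X t + n.+1%:R^-1 * z))%:E)%E = (\int[(P \x gam)%E]_y f n y)%:E.
  by rewrite -ExE// -(@integral12_prod_meas1 _ _ _ _ _ P gam (EFin \o f n)).
under eq_fun do rewrite E.
apply: cvg_EFin; first exact: nearW.
apply: (@bounded_cvg_Ex _ _ _ _ _ _ M) => // -[t z].
rewrite /f /f0 /=; apply: cvgM; first exact: cvg_cst.
have H : (fun n : nat => X t + n.+1%:R^-1 * z) @ \oo --> X t.
  rewrite -[X in _ --> X]addr0; apply: cvgD; first exact: cvg_cst.
  rewrite -(mul0r z); apply: cvgM; last exact: cvg_cst.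
  exact: cvg_harmonic.
exact: (cvg_comp _ h H (ch (X t))).
Qed.

Lemma ramp_cvg (b : R) : (fun n : nat => \int[P]_t (w t * clamp (n%:R * (X t - b)))) @ \oo -->
  \int[P]_t (w t * \1_(`]b, +oo[%classic) (X t)).
Proof.
pose h (n : nat) (x : R) := clamp (n%:R * (x - b)).
have ch n : continuous (h n) by exact: continuous_ramp.
have hn n x : `|h n x| <= 1 by rewrite ger0_norm ?clamp_ge0// clamp_le1.
have ch1 x : (fun n => h n x) @ \oo --> (\1_(`]b, +oo[%classic) x : R).
  rewrite indicE; have [xb|bx] := leP x b.
    rewrite memNset/=; last by rewrite in_itv/= andbT; apply/negP; rewrite -leNgt.
    apply: cvg_near_cst; apply: nearW => n; rewrite /h clamp0//.
    by rewrite mulr_ge0_le0// subr_le0.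
  rewrite mem_set/=; last by rewrite in_itv/= andbT.
  apply: cvg_near_cst; exists (Num.truncn (x - b)^-1).+1 => // n /= Hn; rewrite /h clamp1//.
  by rewrite -ler_pdivrMr ?subr_gt0// mul1r (le_trans (ltW (truncnS_gt _)))// ler_nat.
apply: (@bounded_cvg_Ex _ _ _ _ _ _ M).
- by move=> n; apply: measurable_funM => //; apply: (measurable_comp_continuous (ch n)).
- by apply: measurable_funM => //; exact: measurable_indic_comp.
- by move=> x; apply: cvgM; [exact: cvg_cst|exact: ch1].
- by move=> n x; rewrite normrM -[leRHS]mulr1 ler_pM//; exact: hn.
Qed.

Lemma pushforward_wmeasure (iw : intg P w) (C : set R) : measurable C ->
  pushforward (wmeasure iw w0) X C = (\int[P]_t (w t * \1_C (X t)))%:E.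
Proof.
move=> mC; rewrite -ExE; last first.
  apply: (@intg_bound _ _ _ _ _ M); first by apply: measurable_funM => //; exact: measurable_indic_comp.
  by move=> t; rewrite normrM -[leRHS]mulr1 ler_pM// ger0_norm; have [] := indic01 R C (X t).
rewrite /pushforward/= /wmeasure/= /wdensity integral_mkcond.
apply: eq_integral => t _; rewrite patchE indicE.
rewrite (_ : (t \in _) = (X t \in C)); last by apply/idP/idP => /set_mem H; apply/mem_set.
by case: ifP => _; rewrite ?mulr1 ?mulr0.
Qed.

End gauss_smoothing.

Section weighted_law.
Context (R : realType).
Context d1 (T1 : measurableType d1) (P1 : probability T1 R) (X1 w1 : T1 -> R).
Context d2 (T2 : measurableType d2) (P2 : probability T2 R) (X2 w2 : T2 -> R).
Variable M : R.
Hypotheses (mX1 : measurable_fun setT X1) (mw1 : measurable_fun setT w1).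
Hypotheses (w10 : forall t, 0 <= w1 t) (w1M : forall t, w1 t <= M).
Hypotheses (mX2 : measurable_fun setT X2) (mw2 : measurable_fun setT w2).
Hypotheses (w20 : forall t, 0 <= w2 t) (w2M : forall t, w2 t <= M).
Hypothesis cf12 : forall s c,
  \int[P1]_t (w1 t * cos (s * X1 t + c)) = \int[P2]_t (w2 t * cos (s * X2 t + c)).

Let eq_continuous (h : R -> R) : continuous h -> (forall x, 0 <= h x) -> (forall x, h x <= 1) ->
  \int[P1]_t (w1 t * h (X1 t)) = \int[P2]_t (w2 t * h (X2 t)).
Proof.
move=> ch h0 h1.
have c1 := gauss_smoothing_cvg (P := P1) mX1 mw1 w10 w1M ch h0 h1.
have c2 := gauss_smoothing_cvg (P := P2) mX2 mw2 w20 w2M ch h0 h1.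
apply: EFin_inj; apply: (cvg_unique _ c1); first exact: ereal_hausdorff.
rewrite /= [X in X @ _ --> _](_ : _ = (fun n : nat =>
  (\int[P2]_t \int[normal_prob 0 1]_z (w2 t * h (X2 t + n.+1%:R^-1 * z))%:E)%E))//.
apply/funext => n.
have e0 : 0 < n.+1%:R^-1 :> R by rewrite invr_gt0.
rewrite (gauss_smoothing P1 mX1 mw1 w10 w1M e0 ch h0 h1).
rewrite (gauss_smoothing P2 mX2 mw2 w20 w2M e0 ch h0 h1).
apply: eq_integral => a _; congr (_ * _%:E)%E.
rewrite (gauss_kernel_cf P1 mX1 mw1 w10 w1M a e0) (gauss_kernel_cf P2 mX2 mw2 w20 w2M a e0).
by apply: eq_Rintegral => z _; rewrite cf12.
Qed.

Let eq_ray (b : R) : \int[P1]_t (w1 t * \1_(`]b, +oo[%classic) (X1 t)) =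
  \int[P2]_t (w2 t * \1_(`]b, +oo[%classic) (X2 t)).
Proof.
pose h (n : nat) (x : R) := clamp (n%:R * (x - b)).
have c1 := @ramp_cvg R _ T1 P1 X1 w1 M mX1 mw1 w10 w1M b.
have c2 := @ramp_cvg R _ T2 P2 X2 w2 M mX2 mw2 w20 w2M b.
apply: (cvg_unique _ c1); first exact: Rhausdorff.
rewrite /= [X in X @ _ --> _](_ : _ = (fun n : nat => \int[P2]_t (w2 t * h n (X2 t))))//.
apply/funext => n; apply: (eq_continuous (@continuous_ramp R b n)) => x; [exact: clamp_ge0|exact: clamp_le1].
Qed.

(** Equal characteristic functions give equal Gaussian smoothings. Letting the smoothing vanish
    gives equal integrals of continuous functions with values in [0, 1], then ramps give equal
    masses of open rays, a pi-system generating the Borel sets. *)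
Lemma weighted_law_unique (B : set R) : measurable B ->
  \int[P1]_t (w1 t * \1_B (X1 t)) = \int[P2]_t (w2 t * \1_B (X2 t)).
Proof.
have iw1 : intg P1 w1 by apply: (@intg_bound _ _ _ _ _ M) => // t; rewrite ger0_norm.
have iw2 : intg P2 w2 by apply: (@intg_bound _ _ _ _ _ M) => // t; rewrite ger0_norm.
pose m1 := measure_function_pushforward__canonical__measure_function_Measure (wmeasure iw1 w10) mX1.
pose m2 := measure_function_pushforward__canonical__measure_function_Measure (wmeasure iw2 w20) mX2.
have E1 C : measurable C -> m1 C = (\int[P1]_t (w1 t * \1_C (X1 t)))%:E.
  exact: (pushforward_wmeasure mX1 mw1 w10 w1M iw1).
have E2 C : measurable C -> m2 C = (\int[P2]_t (w2 t * \1_C (X2 t)))%:E.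
  exact: (pushforward_wmeasure mX2 mw2 w20 w2M iw2).
move=> mB; apply: EFin_inj; rewrite -E1// -E2//.
have mray (b : R) : measurable `]b, +oo[%classic by exact: measurable_itv.
apply: (@g_sigma_algebra_measure_unique _ _ _ (@RGenOInfty.G R) _ (fun n : nat => `](- n%:R), +oo[%classic) _ _ m1 m2).
- by move=> _ [x ->].
- by move=> n; exists (- n%:R).
- apply/seteqP; split => // x _; exists (Num.truncn `|x|).+1 => //=.
  rewrite in_itv/= andbT ltrNl (le_lt_trans _ (truncnS_gt _))//.
  by rewrite -normrN ler_norm.
- move=> _ _ [x ->] [y ->]; exists (Num.max x y).
  by apply/seteqP; split => z /=; rewrite !in_itv/= !andbT gt_max => /andP.
- by move=> _ [x ->]; rewrite E1// E2// eq_ray.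
- by move=> n; rewrite E1// ltry.
- change (@measurable _ (g_sigma_algebraType (@RGenOInfty.G R)) B).
  by rewrite -RGenOInfty.measurableE.
Qed.

End weighted_law.

Section cf_gfam.
Context (R : realType) d (T : measurableType d) (P : probability T R).
Context (I : finType) (xi : I -> T -> R).
Hypothesis mxi : forall i, measurable_fun setT (xi i).
Hypothesis cf : forall s c,
  \int[P]_t cos (lin s (xi^~ t) + c) = cos c * expR (- ((\sum_i s i ^+ 2) / 2)).

Let gamE (A : set R) : R := fine (normal_prob 0 1 A).

Let mlin s : measurable_fun setT (fun t => lin s (xi^~ t)).
Proof. by apply: measurable_sum => i; exact: measurable_funM. Qed.

(* Induction on the coordinates already replaced by indicators: the next one is handled by
   [weighted_law_unique] with the nonnegative weight [Pi * (1 + cos (lin s + c))], from which the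
   same identity with weight [Pi] (take [s = 0], [c = pi / 2]) is subtracted. *)
Lemma cf_gfam_prefix (r : seq I) : uniq r -> forall (A : I -> set R) s c,
  (forall i, measurable (A i)) -> (forall i, i \in r -> s i = 0) ->
  \int[P]_t ((\prod_(j <- r) \1_(A j) (xi j t)) * cos (lin s (xi^~ t) + c)) =
  (\prod_(j <- r) gamE (A j)) * (cos c * expR (- ((\sum_i s i ^+ 2) / 2))).
Proof.
elim: r => [_ A s c mA s0|k r IH /= /andP[kr ur] A s c mA s0].
  rewrite big_nil mul1r -cf; apply: eq_Rintegral => t _.
  by rewrite big_nil mul1r.
have {}IH := IH ur A.
pose Pi t : R := \prod_(j <- r) \1_(A j) (xi j t).
pose G := \prod_(j <- r) gamE (A j).
have Pi01 t : 0 <= Pi t <= 1.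
  rewrite /Pi; elim: (r) => [|j l]; first by rewrite big_nil ler01 lexx.
  rewrite big_cons => /andP[h1 h2]; have [i0 i1] := indic01 R (A j) (xi j t).
  by rewrite mulr_ge0//= mulr_ile1.
have mPi : measurable_fun setT Pi.
  by apply: measurable_prod => j _; exact: measurable_indic_comp.
have G0 : 0 <= G by apply: prodr_ge0 => j _; rewrite fine_ge0.
have mc s' c' : measurable_fun setT (fun t => cos (lin s' (xi^~ t) + c')).
  by apply: measurable_cos; exact: measurable_funD.
have ic s' c' : intg P (fun t => Pi t * cos (lin s' (xi^~ t) + c')).
  apply: (@intg_bound _ _ _ _ _ 1); first exact: measurable_funM.
  move=> t; have /andP[p0 p1] := Pi01 t; rewrite normrM mulr_ile1//; first by rewrite ger0_norm.
  by rewrite ler_norml cos_geN1 cos_le1.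
pose ek (u : R) i : R := if i == k then u else 0.
have sumD s' u : s' k = 0 -> \sum_i (s' i + ek u i) ^+ 2 = \sum_i s' i ^+ 2 + u ^+ 2.
  move=> sk; rewrite (bigD1 k)//= [in RHS](bigD1 k)//= /ek eqxx sk add0r expr0n /= add0r addrC.
  by congr (_ + _); apply: eq_bigr => i /negbTE ->; rewrite addr0.
have linD s' u t : lin (fun i => s' i + ek u i) (xi^~ t) = lin s' (xi^~ t) + u * xi k t.
  rewrite /lin; under eq_bigr do rewrite mulrDl; rewrite big_split; congr (_ + _).
  by rewrite (bigD1 k)//= big1 ?addr0 /ek ?eqxx// => i /negbTE ->; rewrite mul0r.
have sr0 s' u : (forall i, i \in r -> s' i = 0) -> forall i, i \in r -> s' i + ek u i = 0.
  move=> h i ir; rewrite h// /ek add0r; case: eqP => // ik.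
  by move: kr; rewrite -ik ir.
have step s' c' : s' k = 0 -> (forall i, i \in r -> s' i = 0) ->
   \int[P]_t ((Pi t * (1 + cos (lin s' (xi^~ t) + c'))) * \1_(A k) (xi k t)) =
   G * (1 + cos c' * expR (- ((\sum_i s' i ^+ 2) / 2))) * gamE (A k).
  move=> sk sr.
  have e01 : 0 <= expR (- ((\sum_i s' i ^+ 2) / 2)) <= (1 : R).
    rewrite expR_ge0 -expR0 ler_expR oppr_le0 divr_ge0// sumr_ge0// => i _.
    by rewrite sqr_ge0.
  have C0 : 0 <= 1 + cos c' * expR (- ((\sum_i s' i ^+ 2) / 2)).
    by have := cos_geN1 c'; have := cos_le1 c'; case/andP: e01; nra.
  have C2 : 1 + cos c' * expR (- ((\sum_i s' i ^+ 2) / 2)) <= 2.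
    by have := cos_geN1 c'; have := cos_le1 c'; case/andP: e01; nra.
  have G1 : G <= 1.
    apply: prodr_ile1 => j _; rewrite fine_ge0//=.
    have h : (normal_prob 0 1 (A j) <= 1)%E := probability_le1 (normal_prob 0 1) (mA j).
    by rewrite -lee_fin /gamE -(probE (normal_prob 0 1) (mA j)).
  have U := @weighted_law_unique R _ T P (xi k) (fun t => Pi t * (1 + cos (lin s' (xi^~ t) + c')))
    _ _ (normal_prob 0 1) id (fun=> G * (1 + cos c' * expR (- ((\sum_i s' i ^+ 2) / 2)))) 2.
  rewrite U//.
  - rewrite ExZ; last exact: (integrable_indic (normal_prob 0 1) (mA k)).
    by congr (_ * _); exact: (Ex_indic (normal_prob 0 1) (mA k)).
  - by apply: measurable_funM => //; apply: measurable_funD.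
  - move=> t; have /andP[p0 p1] := Pi01 t; by apply: mulr_ge0.
  - clear U => t; have /andP[p0 p1] := Pi01 t.
    by have := cos_geN1 (lin s' (xi^~ t) + c'); have := cos_le1 (lin s' (xi^~ t) + c'); nra.
  - by move=> _; rewrite mulr_ge0.
  - by clear U => _; nra.
  clear U => u b.
  (* Product-to-sum formula: each term is [Pi] times the cosine of a linear form that still vanishes
     on [r], so the induction hypothesis evaluates it. *)
  have E t : Pi t * (1 + cos (lin s' (xi^~ t) + c')) * cos (u * xi k t + b) =
      Pi t * cos (lin (fun i => 0 + ek u i) (xi^~ t) + b) +
      (2^-1 * (Pi t * cos (lin (fun i => s' i + ek u i) (xi^~ t) + (c' + b))) +
       2^-1 * (Pi t * cos (lin (fun i => s' i + ek (- u) i) (xi^~ t) + (c' - b)))).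
    rewrite !linD.
    have -> : lin (fun=> 0) (xi^~ t) = 0 by rewrite /lin big1// => i _; rewrite mul0r.
    rewrite add0r.
    rewrite (_ : lin s' _ + u * xi k t + (c' + b) = (lin s' (xi^~ t) + c') + (u * xi k t + b)); last by ring.
    rewrite (_ : lin s' _ + - u * xi k t + (c' - b) = (lin s' (xi^~ t) + c') - (u * xi k t + b)); last by ring.
    set p := lin s' _ + c'; set q := u * xi k t + b.
    by rewrite (cosD p q) (cosB p q); field.
  under eq_Rintegral do rewrite E.
  rewrite ExD ?ExD ?ExZ//; try (by repeat first [exact: ic | apply: intgZ | apply: intgD]).
  rewrite /Pi (IH (fun i => 0 + ek u i) b)//; last exact: (sr0 (fun=> 0)).
  rewrite (IH (fun i => s' i + ek u i) (c' + b))//; last exact: sr0.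
  rewrite (IH (fun i => s' i + ek (- u) i) (c' - b))//; last exact: sr0.
  rewrite !sumD// sqrrN -/G.
  rewrite [X in cos b * expR (- ((X + _) / 2))]big1; last by move=> i _; rewrite expr0n.
  rewrite add0r.
  have := gfam_cf (gfam_id R) (fun=> u) b.
  rewrite (bigD1 tt)//= big1 ?addr0; last by case.
  have LE (x : R) : lin (fun=> u) (fun _ : unit => x) = u * x.
    by rewrite /lin (bigD1 tt)//= big1 ?addr0//; case.
  under eq_Rintegral do rewrite LE.
  by move=> ->; rewrite mulrDl opprD expRD (cosD c' b) (cosB c' b); field.
  apply: (@intg_bound _ _ _ _ _ 1).
    by apply: measurable_cos; apply: measurable_funD => //; exact: measurable_funM.
  by move=> z; rewrite ler_norml cos_geN1 cos_le1.
have sk : s k = 0 by apply: s0; rewrite mem_head.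
have sr i : i \in r -> s i = 0 by move=> ir; apply: s0; rewrite in_cons ir orbT.
have s1 := step s c sk sr.
have s2 := step (fun=> 0) (pi / 2) erefl (fun _ _ => erefl).
have B s' c' : intg P (fun t => Pi t * (1 + cos (lin s' (xi^~ t) + c')) * \1_(A k) (xi k t)).
  apply: (@intg_bound _ _ _ _ _ 2).
    apply: measurable_funM; last exact: measurable_indic_comp.
    by apply: measurable_funM => //; apply: measurable_funD.
  move=> t; have /andP[p0 p1] := Pi01 t; have [i0 i1] := indic01 R (A k) (xi k t).
  have := cos_geN1 (lin s' (xi^~ t) + c'); have := cos_le1 (lin s' (xi^~ t) + c').
  move=> c1 cN1; rewrite ger0_norm; last by rewrite !mulr_ge0//; lra.
  rewrite -[leRHS]mulr1 ler_pM//; first by rewrite mulr_ge0//; lra.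
  by nra.
transitivity (\int[P]_t (Pi t * (1 + cos (lin s (xi^~ t) + c)) * \1_(A k) (xi k t)) -
   \int[P]_t (Pi t * (1 + cos (lin (fun=> 0) (xi^~ t) + pi / 2)) * \1_(A k) (xi k t))).
  rewrite -ExB//; apply: eq_Rintegral => t _.
  have -> : lin (fun=> 0) (xi^~ t) = 0 by rewrite /lin big1// => i _; rewrite mul0r.
  by rewrite add0r cos_pihalf big_cons /Pi; ring.
by rewrite s1 s2 cos_pihalf big_cons /G; ring.
Qed.

Lemma cf_gfam : gfam P xi.
Proof.
split=> // A mA.
(* At [s = 0] and [c = 0] the cosine is 1, and the product over all coordinates is the indicator of
   the box. *)
have := @cf_gfam_prefix (enum I) (enum_uniq I) A (fun=> 0) 0 mA (fun _ _ => erefl).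
rewrite [X in expR (- (X / 2))]big1; last by move=> i _; rewrite expr0n.
rewrite mul0r oppr0 expR0 cos0 !mulr1 big_enum /= => <-.
rewrite -(Ex_indic P (measurable_boxpre mxi mA)); apply: eq_Rintegral => t _.
rewrite (_ : lin _ _ = 0); last by rewrite /lin big1// => i _; rewrite mul0r.
rewrite addr0 cos0 mulr1 big_enum /= indicE.
have [H|H] := pselect (forall i, A i (xi i t)).
  rewrite mem_set// big1// => i _; rewrite indicE mem_set//.
rewrite memNset//; have /existsNP[i nAi] := H.
by rewrite (bigD1 i)//= indicE memNset// mul0r.
Qed.

End cf_gfam.

Section isometry.
Context (R : realType) d (T : measurableType d) (P : probability T R).
Context (I J : finType) (xi : I -> T -> R) (L : I -> J -> R).

(** Orthonormal columns preserve the quadratic form in the exponent of the characteristic function.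
    Since [L] may be rectangular, the same lemma also discards directions, as centering requires. *)
Lemma gfam_isometry : (forall j j', \sum_i L i j * L i j' = (j == j')%:R) -> gfam P xi ->
  gfam P (fun j t => \sum_i L i j * xi i t).
Proof.
move=> LL g; have mxi : forall i, measurable_fun setT (xi i) by case: g.
apply: cf_gfam => [j|s c].
  by apply: measurable_sum => i; exact: measurable_funM.
have E t : lin s (fun j => \sum_i L i j * xi i t) = lin (fun i => \sum_j s j * L i j) (xi^~ t).
  rewrite /lin; under eq_bigr do rewrite mulr_sumr; rewrite exchange_big /=.
  by apply: eq_bigr => i _; rewrite mulr_suml; apply: eq_bigr => j _; rewrite mulrA.
under eq_Rintegral do rewrite E.
rewrite gfam_cf//; congr (_ * expR (- (_ / 2))).
under eq_bigr do rewrite expr2 mulr_suml.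
rewrite exchange_big /=; apply: eq_bigr => j _.
under eq_bigr do rewrite mulr_sumr.
rewrite exchange_big /= (bigD1 j)//= [X in _ + X]big1 ?addr0 => [|j' j'j].
  under eq_bigr do rewrite mulrACA; rewrite -mulr_sumr LL eqxx mulr1 expr2//.
under eq_bigr do rewrite mulrACA.
by rewrite -mulr_sumr LL eq_sym (negbTE j'j) mulr0.
Qed.

End isometry.

(** * Standardized observations as a Gaussian family *)

Section data.
Context (R : realType).

Lemma std_normal_cf (s c : R) :
  \int[normal_prob 0 1]_x cos (s * x + c) = cos c * expR (- (s ^+ 2 / 2)).
Proof.
have := gfam_cf (gfam_id R) (fun=> s) c.
rewrite (bigD1 tt)//= big1 ?addr0; last by case.
move=> <-; apply: eq_Rintegral => x _.
by rewrite /lin (bigD1 tt)//= big1 ?addr0//; case.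
Qed.

Lemma normal_cf (m s c : R) : 0 < s ->
  \int[normal_prob m s]_x cos (x - m + c) = cos c * expR (- (s ^+ 2 / 2)).
Proof.
move=> s0.
have cc a b : continuous (fun x : R => cos (a * x + b)).
  move=> x; apply: (@continuous_comp _ _ _ (fun x => a * x + b) (@cos R)); last exact: continuous_cos.
  apply: cvgD; last exact: cvg_cst.
  by apply: cvgM; [exact: cvg_cst|exact: cvg_id].
have mc a b : measurable_fun setT (fun x : R => cos (a * x + b)) by exact: continuous_measurable_fun.
have ic (m' s' a b : R) : intg (normal_prob m' s') (fun x : R => cos (a * x + b)).
  by apply: (@intg_bound _ _ _ _ _ 1) => [|x]; [exact: mc|rewrite ler_norml cos_geN1 cos_le1].
have c0 (x : R) : 0 <= 1 + cos x by have := cos_geN1 x; lra.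
(* Adding 1 makes the integrand nonnegative, so that the density formula and the affine substitution
   for nonnegative functions apply. *)
suff : \int[normal_prob m s]_x (1 + cos (1 * x + (c - m))) = \int[normal_prob 0 1]_x (1 + cos (s * x + c)).
  rewrite ExD; [|exact: intg_cst|exact: ic].
  rewrite [in RHS]ExD; [|exact: intg_cst|exact: ic].
  rewrite !Ex_cst => /addrI.
  rewrite std_normal_cf => <-.
  by apply: eq_Rintegral => x _; congr cos; ring.
have mE1 a b : measurable_fun setT (fun x : R => (1 + cos (a * x + b))%:E).
  by apply/measurable_EFinP; apply: measurable_funD.
have substE : (\int[lebesgue_measure]_x ((1 + cos (1 * x + (c - m)))%:E * (normal_pdf m s x)%:E) =
    \int[lebesgue_measure]_x ((1 + cos (s * x + c))%:E * (normal_pdf 0 1 x)%:E))%E.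
  have := @affine_subst R (fun x => (1 + cos (1 * x + (c - m))) * normal_pdf m s x) m s s0.
  move=> ->.
  - apply: eq_integral => x _; rewrite -mulrA normal_pdf_affine// -EFinM.
    by congr ((1 + cos _) * _)%:E; ring.
  - move=> x; apply: cvgM; last by apply: continuous_normal_pdf; rewrite gt_eqF.
    by apply: cvgD; [exact: cvg_cst|exact: cc].
  - by move=> x; rewrite mulr_ge0// normal_pdf_ge0.
have D (m' s' a b : R) : (\int[normal_prob m' s']_x (1 + cos (a * x + b))%:E =
    \int[lebesgue_measure]_x ((1 + cos (a * x + b))%:E * (normal_pdf m' s' x)%:E))%E.
  apply: (@ge0_integral_density _ _ _ lebesgue_measure (normal_prob m' s') (normal_pdf m' s')
    (measurable_normal_pdf m' s') (normal_pdf_ge0 m' s') (fun A _ => erefl)).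
    exact: mE1.
  by move=> x; rewrite lee_fin.
by apply: (congr1 fine); rewrite D D substE.
Qed.

Context d (T : measurableType d) (P : probability T R).

Lemma gaussian_rv_cf (Y : T -> R) (m v c : R) : measurable_fun setT Y ->
  gaussian_rv P Y m v -> v != 0 ->
  \int[P]_t cos (Y t - m + c) = cos c * expR (- (v / 2)).
Proof.
move=> mY [v0 + vn0]; rewrite (negbTE vn0) => H.
have vp : 0 < v by rewrite lt_neqAle v0 andbT eq_sym.
have sp : 0 < Num.sqrt v by rewrite sqrtr_gt0.
rewrite -[in RHS](sqr_sqrtr v0) -(normal_cf m c sp).
have mc : measurable_fun setT (fun x : R => cos (x - m + c)).
  by apply: measurable_cos; apply: measurable_funD => //; exact: measurable_funB.
rewrite -(@Rintegral_pushforward _ _ T (measurableTypeR R) R P Y (fun x => cos (x - m + c)) mY mc).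
apply: (congr1 fine).
pose m1 := @measure_function_pushforward__canonical__measure_function_Measure
  _ _ T (measurableTypeR R) R P Y mY.
pose f (x : measurableTypeR R) := (cos (x - m + c))%:E.
have E : (\int[m1]_x f x = \int[normal_prob m (Num.sqrt v)]_x f x)%E.
  by apply: eq_measure_integral => A mA _; exact: (H A mA).
exact: E.
Qed.

(** In the direction [s / sqrt lam] the Cramer-Wold definition provides a normal variable of
    variance the sum of the [s j ^+ 2]; this is the characteristic function that [cf_gfam] asks
    for. *)
Lemma mvnormal_gfam p (X : T -> 'cV[R]_p) (mu : 'cV[R]_p) (lam : R) : 0 < lam ->
  (forall j, measurable_fun setT (fun t => X t j ord0)) ->
  mvnormal P X mu lam%:M ->
  gfam P (fun (j : 'I_p) t => (X t j ord0 - mu j ord0) / Num.sqrt lam).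
Proof.
move=> l0 mX N.
have sl : 0 < Num.sqrt lam by rewrite sqrtr_gt0.
apply: cf_gfam => [j|s c].
  by apply: measurable_funM => //; exact: measurable_funB.
pose a : 'cV[R]_p := \col_j (s j / Num.sqrt lam).
have aE (Z : 'cV[R]_p) : (a^T *m Z) ord0 ord0 = \sum_j s j / Num.sqrt lam * Z j ord0.
  by rewrite mxE; apply: eq_bigr => j _; rewrite !mxE.
have vE : (a^T *m lam%:M *m a) ord0 ord0 = \sum_j s j ^+ 2.
  rewrite mul_mx_scalar -scalemxAl mxE aE mulr_sumr; apply: eq_bigr => j _.
  rewrite mxE -[X in X * _](sqr_sqrtr (ltW l0)); field.
  by rewrite gt_eqF.
have linE t : lin s (fun j => (X t j ord0 - mu j ord0) / Num.sqrt lam) =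
    (a^T *m X t) ord0 ord0 - (a^T *m mu) ord0 ord0.
  rewrite !aE -sumrB; apply: eq_bigr => j _; field.
  by rewrite gt_eqF.
under eq_Rintegral do rewrite linE.
(* Variance 0 is a separate clause of [gaussian_rv]; here it forces [s = 0], and the linear form
   vanishes identically. *)
have [v0|v0] := eqVneq (\sum_j s j ^+ 2) 0.
  rewrite v0 mul0r oppr0 expR0 mulr1 -[RHS](Ex_cst P).
  apply: eq_Rintegral => t _; rewrite -linE /lin big1 ?add0r// => j _.
  have /eqP := v0; rewrite psumr_eq0; last by move=> i _; rewrite sqr_ge0.
  move=> /allP/(_ j); rewrite mem_index_enum => /(_ isT) /=.
  by rewrite sqrf_eq0 => /eqP ->; rewrite mul0r.
have := N a; rewrite vE => /gaussian_rv_cf; apply => //.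
under eq_fun do rewrite aE.
by apply: measurable_sum => j; exact: measurable_funM.
Qed.

Lemma fine_prod (I : Type) (r : seq I) (F : I -> \bar R) : (forall i, F i \is a fin_num) ->
  fine (\prod_(i <- r) F i)%E = \prod_(i <- r) fine (F i).
Proof.
move=> Ff; have : (\prod_(i <- r) F i)%E = (\prod_(i <- r) fine (F i))%:E; last by move=> ->.
elim: r => [|i r IH]; first by rewrite !big_nil.
by rewrite !big_cons IH EFinM fineK.
Qed.

Lemma data_gfam n p (X : 'I_n -> T -> 'cV[R]_p) (mu : 'cV[R]_p) (lam : R) : 0 < lam ->
  (forall i j, measurable_fun setT (fun t => X i t j ord0)) ->
  mutually_independent_vectors P X -> (forall i, mvnormal P (X i) mu lam%:M) ->
  gfam P (fun (k : 'I_p * 'I_n) t => (X k.2 t k.1 ord0 - mu k.1 ord0) / Num.sqrt lam).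
Proof.
move=> l0 mX ind N; split=> [k|A mA].
  by apply: measurable_funM => //; exact: measurable_funB.
pose h j (x : R) := (x - mu j ord0) / Num.sqrt lam.
have mh j : measurable_fun setT (h j) by apply: measurable_funM => //; exact: measurable_funB.
pose A' i j : set R := h j @^-1` A (j, i).
have mA' i j : measurable (A' i j).
  by rewrite -[A' i j]setTI; exact: mh.
rewrite (_ : [set t | _] = [set t | forall i j, A' i j (X i t j ord0)]); last first.
  by apply/seteqP; split => t /= H; [move=> i j; exact: (H (j, i))|move=> [j i]; exact: H].
rewrite ind// fine_prod; last first.
  by move=> i; rewrite fin_num_measure//; exact: (measurable_boxpre (mX i)).
rewrite [RHS](eq_bigr (fun k => fine (normal_prob 0 1 (A (k.1, k.2))))); last by case.
rewrite -(pair_bigA _ (fun j i => fine (normal_prob 0 1 (A (j, i))))) /=.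
rewrite exchange_big /=; apply: eq_bigr => i _.
have [_ H] := mvnormal_gfam l0 (mX i) (N i).
exact: (H (fun j => A (j, i)) (fun j => mA (j, i))).
Qed.

End data.

(** * Bartlett decomposition *)

Section orthogonal_triangularization.
Context (R : realType).

(** Reflection in the hyperplane orthogonal to [w = v - |v| e_0], which maps [v] to [|v| e_0]. *)
Lemma householder N (v : 'rV[R]_N.+1) :
  exists2 O : 'M[R]_N.+1, O *m O^T = 1%:M & forall l, l != ord0 -> (v *m O) ord0 l = 0.
Proof.
pose n2 := \sum_l v ord0 l ^+ 2.
have n20 : 0 <= n2 by apply: sumr_ge0 => l _; rewrite sqr_ge0.
pose a := Num.sqrt n2.
have aa : a ^+ 2 = n2 by rewrite sqr_sqrtr.
pose w : 'rV[R]_N.+1 := v - a *: delta_mx ord0 ord0.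
have dot1 (x y : 'rV[R]_N.+1) : x *m y^T = (\sum_l x ord0 l * y ord0 l)%:M.
  by rewrite [LHS]mx11_scalar mxE; congr (_%:M); apply: eq_bigr => l _; rewrite mxE.
have wE l : w ord0 l = v ord0 l - a * (l == ord0)%:R.
  by rewrite !mxE eqxx.
have delta_sum (f : 'I_N.+1 -> R) : \sum_l f l * (l == ord0)%:R = f ord0.
  by rewrite (bigD1 ord0)//= mulr1 big1 ?addr0// => i /negbTE ->; rewrite mulr0.
have vw : \sum_l v ord0 l * w ord0 l = n2 - a * v ord0 ord0.
  under eq_bigr do rewrite wE mulrBr -expr2.
  rewrite sumrB; congr (_ - _).
  by under eq_bigr do rewrite mulrA; rewrite delta_sum mulrC.
have ww : \sum_l w ord0 l * w ord0 l = 2 * (n2 - a * v ord0 ord0).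
  transitivity (\sum_l v ord0 l * w ord0 l - a * w ord0 ord0).
    under eq_bigr do rewrite {1}wE mulrBl.
    rewrite sumrB; congr (_ - _).
    by under eq_bigr do rewrite mulrAC; rewrite delta_sum.
  by rewrite vw wE eqxx mulr1 mulrBr -expr2 aa; ring.
pose q := \sum_l w ord0 l * w ord0 l.
(* If [w = 0], then [v] already lies on the first axis and the identity serves. *)
have [q0|q0] := eqVneq q 0.
  exists 1%:M; first by rewrite trmx1 mulmx1.
  move=> l l0; rewrite mulmx1.
  have /eqP : q = 0 := q0.
  rewrite psumr_eq0; last by move=> i _; rewrite -expr2 sqr_ge0.
  move=> /allP/(_ l); rewrite mem_index_enum => /(_ isT) /=.
  by rewrite -expr2 sqrf_eq0 wE (negbTE l0) mulr0 subr0 => /eqP.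
exists (1%:M - (2 / q) *: (w^T *m w)).
  rewrite [X in _ *m X](_ : _ = 1%:M - (2 / q) *: (w^T *m w)); last first.
    by rewrite linearB /= trmx1 linearZ /= trmx_mul trmxK.
  have MM : (w^T *m w) *m (w^T *m w) = q *: (w^T *m w).
    by rewrite -mulmxA (mulmxA w) dot1 -/q mul_scalar_mx -scalemxAr.
  set M := w^T *m w in MM *; set c := 2 / q.
  have -> : (1%:M - c *: M) *m (1%:M - c *: M) = 1%:M - (2 * c - c * c * q) *: M.
    rewrite mulmxBl mul1mx (_ : (c *: M) *m (1%:M - c *: M) = c *: M - (c * c * q) *: M).
      by clearbody M; apply/matrixP => i j; rewrite !mxE; ring.
    by rewrite mulmxBr mulmx1 -scalemxAl -scalemxAr MM !scalerA.
  by rewrite (_ : 2 * c - c * c * q = 0) ?scale0r ?subr0// /c; field.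
move=> l l0; rewrite mulmxBr mulmx1 -scalemxAr mulmxA dot1 vw mul_scalar_mx scalerA.
have -> : 2 / q * (n2 - a * v ord0 ord0) = 1.
  rewrite (_ : n2 - a * v ord0 ord0 = q / 2); last by rewrite /q ww; field.
  by field.
by rewrite scale1r /w opprB addrC subrK !mxE (negbTE l0) andbF mulr0.
Qed.

(** LQ decomposition: a reflection clears the first row beyond its first entry, and induction treats
    the lower right block. *)
Lemma orthogonal_triangularization r N (B : 'M[R]_(r, N)) :
  exists2 O : 'M[R]_N, O *m O^T = 1%:M & forall (i : 'I_r) (l : 'I_N), (i < l)%N -> (B *m O) i l = 0.
Proof.
elim: N r B => [|N IH] r B; first by exists 1%:M; [rewrite trmx1 mulmx1|move=> i []].
case: r B => [|r] B; first by exists 1%:M; [rewrite trmx1 mulmx1|case].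
have [Q1 Q1Q B0] := householder (row ord0 B).
pose B1 : 'M[R]_(1 + r, 1 + N) := B *m Q1.
have [Q2 Q2Q L] := IH r (drsubmx B1).
pose Q3 : 'M[R]_(1 + N) := block_mx 1%:M 0 0 Q2.
exists (Q1 *m (Q3 : 'M[R]_N.+1)).
  rewrite trmx_mul mulmxA -(mulmxA Q1) (_ : (Q3 : 'M[R]_N.+1) *m Q3^T = 1%:M) ?mulmx1//.
  have -> : Q3^T = block_mx 1%:M 0 0 Q2^T by rewrite /Q3 tr_block_mx !(trmx0, trmx1).
  rewrite /Q3 [LHS](@mulmx_block R 1 N 1 N 1 N) !(trmx0, trmx1, mulmx0, mul0mx, mulmx1, mul1mx, addr0, add0r) Q2Q.
  by rewrite -scalar_mx_block.
move=> i l il; rewrite mulmxA -[B *m Q1]/B1.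
have ur0 : ursubmx B1 = 0.
  apply/matrixP => i' l'; rewrite [RHS]mxE -(B0 (rshift 1 l') isT) !mxE ord1.
  apply: eq_bigr => k _; rewrite !mxE; congr (B _ _ * _).
  by apply/val_inj.
have -> : B1 *m Q3 = block_mx (ulsubmx B1) 0 (dlsubmx B1) (drsubmx B1 *m Q2).
  rewrite -{1}(submxK B1) ur0 /Q3 [LHS](@mulmx_block R 1 r 1 N 1 N).
  by rewrite !(mulmx0, mul0mx, mulmx1, addr0, add0r).
move: il; case: (@split_ordP 1 r i) => i' ->; case: (@split_ordP 1 N l) => l' ->.
- by rewrite !ord1.
- by move=> _; rewrite [LHS](@block_mxEur R 1 r 1 N) mxE.
- by rewrite !ord1.
- by rewrite /= !add1n ltnS => il; rewrite [LHS](@block_mxEdr R 1 r 1 N); exact: L.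
Qed.

(** The rotation moves the rows of [B] into the first [p] coordinates, and only the remaining
    coordinates of the rotated [y] add volume. It depends on [B] alone, so in [bartlett] it can be
    applied to a random [y] with [B] frozen. *)
Lemma gram_det_step p m (B : 'M[R]_(p, m)) : (p <= m)%N ->
  exists2 O : 'M[R]_m, O *m O^T = 1%:M & forall y : 'rV[R]_m,
    \det (col_mx y B *m (col_mx y B)^T) =
    \det (B *m B^T) * \sum_(l < m | (p <= l)%N) (y *m O) ord0 l ^+ 2.
Proof.
move=> pm; have [k km] : exists k, m = (p + k)%N by exists (m - p)%N; rewrite subnKC.
subst m; have [Q ort L] := orthogonal_triangularization B; exists Q => // y.
have gramE r (C : 'M[R]_(r, p + k)) : C *m C^T = (C *m Q) *m (C *m Q)^T.
  by rewrite trmx_mul mulmxA -(mulmxA C) ort mulmx1.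
rewrite gramE [in RHS]gramE mul_col_mx.
set u := y *m Q; set U := B *m Q.
have -> : U = row_mx (lsubmx U) 0.
  rewrite -[LHS]hsubmxK; congr row_mx; apply/matrixP => i l; rewrite !mxE.
  by have := L i (rshift p l); rewrite !mxE => ->//=; rewrite ltn_addr.
rewrite -{1 2}[u]hsubmxK.
set u1 := lsubmx u; set u2 := rsubmx u; set L1 := lsubmx U.
have -> : \sum_(l < p + k | (p <= l)%N) u ord0 l ^+ 2 = (u2 *m u2^T) ord0 ord0.
  rewrite big_split_ord /= big_pred0 ?add0r; last by move=> i; rewrite leqNgt ltn_ord.
  rewrite mxE; apply: eq_big => [i|i _]; first by rewrite leq_addr.
  by rewrite !mxE expr2.
set s := (u2 *m u2^T) ord0 ord0.
(* The factorization of the Gram matrix as [A *m D *m A^T] isolates [s], and it holds for singular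
   [L1] too: [A] has determinant [\det L1] and [D] has determinant [s]. *)
pose A := block_mx (1%:M : 'M[R]_1) u1 0 L1.
pose D := block_mx (s%:M : 'M[R]_1) 0 0 (1%:M : 'M[R]_p).
rewrite (_ : col_mx _ _ *m _ = A *m D *m A^T).
  rewrite !det_mulmx det_tr (det_ublock (1%:M : 'M[R]_1)) det1 mul1r.
  rewrite (det_ublock (s%:M : 'M[R]_1)) det1 mulr1 det_scalar1.
  by rewrite tr_row_mx trmx0 mul_row_col mulmx0 addr0 det_mulmx det_tr mulrAC.
have -> : col_mx (row_mx u1 u2) (row_mx L1 0) = block_mx u1 u2 L1 0 by [].
rewrite /A /D mulmx_block !(mulmx0, mul0mx, mulmx1, mul1mx, addr0, add0r).
rewrite !tr_block_mx !(trmx0, trmx1) !mulmx_block.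
rewrite !(mulmx0, mul0mx, mulmx1, mul1mx, addr0, add0r).
by rewrite addrC [u2 *m _]mx11_scalar.
Qed.

End orthogonal_triangularization.

Section bartlett.
Context (R : realType).

Definition rows_mx p m (x : 'I_p * 'I_m -> R) : 'M[R]_(p, m) := \matrix_(k, l) x (k, l).
Definition gram_det p m (x : 'I_p * 'I_m -> R) := \det (rows_mx x *m (rows_mx x)^T).
Definition sumsq p m (x : 'I_p * 'I_m -> R) := \sum_k \sum_l x (k, l) ^+ 2.
(* Row [k] keeps its last [m - (p - 1 - k)] entries. *)
Definition tailsq p m (x : 'I_p * 'I_m -> R) (k : 'I_p) :=
  \sum_(l < m | (p.-1 - k <= l)%N) x (k, l) ^+ 2.

Definition head_row p m (x : 'I_p.+1 * 'I_m -> R) (l : 'I_m) := x (ord0, l).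
Definition tail_rows p m (x : 'I_p.+1 * 'I_m -> R) (k : 'I_p * 'I_m) := x (lift ord0 k.1, k.2).

Lemma measurable_det d (T : measurableType d) p (M : T -> 'M[R]_p) :
  (forall i j, measurable_fun setT (fun t => M t i j)) -> measurable_fun setT (fun t => \det (M t)).
Proof.
move=> mM; apply: measurable_sum => s; apply: measurable_funM => //.
by apply: measurable_prod => i _; exact: mM.
Qed.

Lemma measurable_gram_det p m : measurable_fun [set: rvT R ('I_p * 'I_m)%type] (@gram_det p m).
Proof.
apply: (@measurable_det _ (rvT R ('I_p * 'I_m)%type)) => i j.
apply: (eq_measurable_fun (fun x : rvT R ('I_p * 'I_m)%type => \sum_l x (i, l) * x (j, l))).
  by move=> x _; rewrite mxE; apply: eq_bigr => l _; rewrite !mxE.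
by apply: measurable_sum => l; apply: measurable_funM; exact: measurable_coord.
Qed.

Lemma measurable_sumsq p m : measurable_fun [set: rvT R ('I_p * 'I_m)%type] (@sumsq p m).
Proof.
apply: measurable_sum => k; apply: measurable_sum => l.
by apply: measurable_funX; exact: measurable_coord.
Qed.

Lemma measurable_sum_sqr (I : finType) m (a : pred 'I_m) (k : 'I_m -> I) :
  measurable_fun [set: rvT R I] (fun x => \sum_(l | a l) x (k l) ^+ 2).
Proof.
apply: (eq_measurable_fun (fun x : rvT R I => \sum_(l < m) if a l then x (k l) ^+ 2 else 0)).
  by move=> x _; rewrite -big_mkcond.
apply: measurable_sum => l; case: (a l) => //.
by apply: measurable_funX; exact: measurable_coord.
Qed.

Lemma measurable_tailsq p m (k : 'I_p) :
  measurable_fun [set: rvT R ('I_p * 'I_m)%type] (fun x => tailsq x k).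
Proof. exact: (@measurable_sum_sqr _ _ (fun l => (p.-1 - k <= l)%N) (pair k)). Qed.

Lemma sumsq_recl p m (x : 'I_p.+1 * 'I_m -> R) :
  sumsq x = \sum_l head_row x l ^+ 2 + sumsq (tail_rows x).
Proof. by rewrite /sumsq big_ord_recl. Qed.

Lemma prod_tailsq_recl p m (x : 'I_p.+1 * 'I_m -> R) :
  \prod_k tailsq x k = (\sum_(l < m | (p <= l)%N) head_row x l ^+ 2) * \prod_k tailsq (tail_rows x) k.
Proof.
rewrite big_ord_recl; congr (_ * _); first by rewrite /tailsq /= subn0.
apply: eq_bigr => k _; rewrite /tailsq; apply: eq_bigl => l.
by rewrite /= /bump /= add1n; congr (_ <= _)%N; lia.
Qed.

Lemma gram_det_recl p m (x : 'I_p.+1 * 'I_m -> R) : gram_det x =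
  \det (col_mx (\row_l head_row x l) (rows_mx (tail_rows x)) *m
        (col_mx (\row_l head_row x l) (rows_mx (tail_rows x)))^T).
Proof.
have -> : col_mx (\row_l head_row x l) (rows_mx (tail_rows x)) = rows_mx x; last by [].
apply/matrixP => k l; rewrite !mxE; case: splitP => j jk; rewrite !mxE.
  by rewrite /head_row; congr (x (_, _)); apply/val_inj; rewrite /= jk ord1.
by rewrite /tail_rows; congr (x (_, _)); apply/val_inj; rewrite /= jk.
Qed.

Lemma gfam_rotate_row d (T : measurableType d) (P : probability T R) m (eta : 'I_m -> T -> R)
    (Q : 'M[R]_m) : Q *m Q^T = 1%:M -> gfam P eta ->
  gfam P (fun l t => ((\row_l eta l t) *m Q) ord0 l).
Proof.
move=> ort g; have ort' : Q^T *m Q = 1%:M by apply: mulmx1C.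
have := @gfam_isometry _ _ _ P _ _ eta (fun i l => Q i l) _ g.
have H : forall j j', \sum_i Q i j * Q i j' = (j == j')%:R.
  move=> j j'; have /matrixP/(_ j j') := ort'; rewrite !mxE => <-.
  by apply: eq_bigr => i _; rewrite mxE.
move=> /(_ H); congr (gfam P _); apply/funext => l; apply/funext => t.
by rewrite mxE; apply: eq_bigr => i _; rewrite mxE mulrC.
Qed.

(* Adding a row multiplies the Gram determinant by the squared distance of that row to the span of
   the others, which is a [tailsq] after a rotation of the row depending only on the others. *)
Theorem bartlett p m : (p <= m)%N -> forall d (T : measurableType d) (P : probability T R)
  (xi : 'I_p * 'I_m -> T -> R) (F : R * R -> \bar R), gfam P xi ->
  measurable_fun setT F -> (forall z, 0 <= F z)%E ->
  (\int[P]_t F (gram_det (xi^~ t), sumsq (xi^~ t)) =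
   \int[P]_t F ((\prod_k tailsq (xi^~ t) k)%R, sumsq (xi^~ t)))%E.
Proof.
elim: p => [|p IH] pm d T P xi F g mF F0.
  by apply: eq_integral => t _; rewrite /gram_det det_mx00 big_ord0.
pose V := rvT R ('I_p.+1 * 'I_m)%type.
pose c (x : V) := \sum_(l < m | (p <= l)%N) head_row x l ^+ 2.
have mc : measurable_fun [set: V] c.
  exact: (@measurable_sum_sqr _ _ (fun l => (p <= l)%N) (pair ord0)).
have mtail : measurable_fun [set: V] (fun x => tail_rows x : rvT R ('I_p * 'I_m)%type).
  by apply: measurable_torv => k; exact: measurable_coord.
pose H1 (x : V) := F (gram_det x, sumsq x).
pose H2 (x : V) := F (gram_det (tail_rows x) * c x, sumsq x).
pose H3 (x : V) := F (\prod_k tailsq x k, sumsq x).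
have mH1 : measurable_fun [set: V] H1.
  apply: (measurableT_comp mF); apply: measurable_fun_pair.
    exact: measurable_gram_det.
  exact: measurable_sumsq.
have mH2 : measurable_fun [set: V] H2.
  apply: (measurableT_comp mF); apply: measurable_fun_pair.
    by apply: measurable_funM => //; apply: (measurableT_comp (@measurable_gram_det _ _) mtail).
  exact: measurable_sumsq.
have mH3 : measurable_fun [set: V] H3.
  apply: (measurableT_comp mF); apply: measurable_fun_pair.
    by apply: measurable_prod => k _; exact: measurable_tailsq.
  exact: measurable_sumsq.
pose J (k : 'I_p.+1 * 'I_m) := k.1 == ord0.
pose X := mix xi xi J.
have G : gfam (P \x P)%E X := gfam_mix J g g.
have mXX : measurable_fun setT (fun z => (X ^~ z : V)).
  by apply: measurable_torv; case: G.
have head_mix w w' : head_row (X ^~ (w, w')) = fun l => xi (ord0, l) w'.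
  by apply/funext => l; rewrite /head_row /X /mix /=.
have tail_mix w w' : tail_rows (X ^~ (w, w')) = fun k => xi (lift ord0 k.1, k.2) w.
  by apply/funext => k; rewrite /tail_rows /X /mix /=.
have key (H : V -> \bar R) : measurable_fun [set: V] H -> (forall x, 0 <= H x)%E ->
    (\int[P]_t H (xi^~ t) = \int[P]_w \int[P]_w' H (X ^~ (w, w')) /\
     \int[P]_t H (xi^~ t) = \int[P]_w' \int[P]_w H (X ^~ (w, w')))%E.
  move=> mH H0; rewrite (gfam_ge0 g G mH H0).
  have mHX : measurable_fun setT (fun z => H (X ^~ z)) by exact: (measurableT_comp mH mXX).
  have HX0 z : (0 <= H (X ^~ z))%E by exact: H0.
  split; first exact: (fubini_tonelli1 _ mHX HX0).
  exact: (etrans (fubini_tonelli1 _ mHX HX0) (fubini_tonelli _ mHX HX0)).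
have ghead : gfam P (fun l => xi (ord0, l)).
  by apply: (@gfam_sub _ _ _ _ _ _ _ (fun l => (ord0, l))) => // l l' [].
have gtail : gfam P (fun k : 'I_p * 'I_m => xi (lift ord0 k.1, k.2)).
  apply: (@gfam_sub _ _ _ _ _ _ _ (fun k : 'I_p * 'I_m => (lift ord0 k.1, k.2))) => // -[a b] [a' b'] /= [].
  by move=> /val_inj -> ->.
(* With the other rows frozen, the first row is rotated by the matrix they determine; this changes
   neither its law nor its sum of squares. *)
have S12 : (\int[P]_t H1 (xi^~ t) = \int[P]_t H2 (xi^~ t))%E.
  apply: (etrans (key _ mH1 (fun x => F0 _)).1); apply: (etrans _ (esym (key _ mH2 (fun x => F0 _)).1)); apply: eq_integral => w _.
  pose B : 'M[R]_(p, m) := rows_mx (fun k => xi (lift ord0 k.1, k.2) w).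
  have [Q ort HO] := gram_det_step B (ltnW pm).
  pose s := sumsq (fun k : 'I_p * 'I_m => xi (lift ord0 k.1, k.2) w).
  pose K (u : rvT R 'I_m) := F (\det (B *m B^T) * \sum_(l < m | (p <= l)%N) u l ^+ 2, \sum_l u l ^+ 2 + s).
  have mK : measurable_fun [set: rvT R 'I_m] K.
    apply: (measurableT_comp mF); apply: measurable_fun_pair.
      apply: measurable_funM => //.
      exact: (@measurable_sum_sqr _ _ (fun l => (p <= l)%N) id).
    apply: measurable_funD => //.
    exact: (@measurable_sum_sqr _ _ xpredT id).
  have := gfam_ge0 (gfam_rotate_row ort ghead) ghead mK (fun x => F0 _).
  move=> E; transitivity (\int[P]_t K (fun l => (\row_l0 xi (ord0, l0) t *m Q) ord0 l))%E.
    apply: eq_integral => w' _; rewrite /H1 /K gram_det_recl sumsq_recl head_mix tail_mix.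
    congr (F (_, _ + _)); first exact: HO.
    set y := \row_l xi (ord0, l) w'.
    transitivity ((y *m y^T) ord0 ord0).
      by rewrite mxE; apply: eq_bigr => l _; rewrite !mxE expr2.
    have -> : y *m y^T = (y *m Q) *m (y *m Q)^T by rewrite trmx_mul mulmxA -(mulmxA y) ort mulmx1.
    by rewrite mxE; apply: eq_bigr => l _; rewrite [_^T _ _]mxE expr2.
  rewrite E; apply: eq_integral => w' _; rewrite /H2 /K sumsq_recl head_mix tail_mix.
  by congr (F (_ * _, _)); apply: eq_bigr => l _; rewrite head_mix.
(* With the first row frozen, its two contributions are absorbed into the test function and the
   induction hypothesis applies to the other rows. *)
have S23 : (\int[P]_t H2 (xi^~ t) = \int[P]_t H3 (xi^~ t))%E.
  apply: (etrans (key _ mH2 (fun x => F0 _)).2); apply: (etrans _ (esym (key _ mH3 (fun x => F0 _)).2)); apply: eq_integral => w' _.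
  pose c' := \sum_(l < m | (p <= l)%N) xi (ord0, l) w' ^+ 2.
  pose s' := \sum_l xi (ord0, l) w' ^+ 2.
  pose F' (z : R * R) := F (z.1 * c', s' + z.2).
  have mF' : measurable_fun setT F'.
    apply: (measurableT_comp mF); apply: measurable_fun_pair.
      exact: measurable_funM.
    exact: measurable_funD.
  have := IH (ltnW pm) _ _ P _ F' gtail mF' (fun z => F0 _).
  have cE w : c (X ^~ (w, w')) = c' by rewrite /c head_mix.
  rewrite /F' /= => E; apply: (etrans _ (etrans E _)).
    by apply: eq_integral => w _; rewrite /H2 sumsq_recl cE head_mix tail_mix.
  apply: eq_integral => w _; rewrite /H3 prod_tailsq_recl sumsq_recl head_mix tail_mix.
  by rewrite mulrC.
exact: (etrans S12 S23).
Qed.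

End bartlett.

(** * Chi-square variables *)

Section chi_square.
Context (R : realType) d (T : measurableType d) (P : probability T R).
Context (I : finType) (xi : I -> T -> R).
Hypothesis g : gfam P xi.
Implicit Types (F G : (I -> R) -> R) (a : pred I).

Definition mpg (F : (I -> R) -> R) := measurable_fun [set: rvT R I] F /\ pg F.

Lemma mpg_cst c : mpg (fun=> c).
Proof. by split; [exact: measurable_cst|exact: pg_cst]. Qed.

Lemma mpg_coord i : mpg (fun x => x i).
Proof. by split; [exact: measurable_coord|exact: pg_coord]. Qed.

Lemma mpgD F G : mpg F -> mpg G -> mpg (fun x => F x + G x).
Proof. by move=> [? ?] [? ?]; split; [exact: measurable_funD|exact: pgD]. Qed.

Lemma mpgB F G : mpg F -> mpg G -> mpg (fun x => F x - G x).
Proof. by move=> [? ?] [? ?]; split; [exact: measurable_funB|exact: pgB]. Qed.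

Lemma mpgM F G : mpg F -> mpg G -> mpg (fun x => F x * G x).
Proof. by move=> [? ?] [? ?]; split; [exact: measurable_funM|exact: pgM]. Qed.

Lemma mpgX F n : mpg F -> mpg (fun x => F x ^+ n).
Proof. by move=> [? ?]; split; [exact: measurable_funX|exact: pgX]. Qed.

Lemma mpg_sum (J : Type) (s : seq J) (H : J -> (I -> R) -> R) : (forall j, mpg (H j)) ->
  mpg (fun x => \sum_(j <- s) H j x).
Proof. by move=> h; split; [apply: measurable_sum => j; exact: (h j).1|apply: pg_sum => j; exact: (h j).2]. Qed.

Definition expect F := \int[P]_t F (xi^~ t).
Notation ev := expect.

Lemma mpg_intg F : mpg F -> intg P (fun t => F (xi^~ t)).
Proof. by move=> [mF pF]; exact: pg_intg. Qed.

Lemma evD F G : mpg F -> mpg G -> ev (fun x => F x + G x) = ev F + ev G.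
Proof. by move=> /mpg_intg ? /mpg_intg ?; exact: ExD. Qed.

Lemma evB F G : mpg F -> mpg G -> ev (fun x => F x - G x) = ev F - ev G.
Proof. by move=> /mpg_intg ? /mpg_intg ?; exact: ExB. Qed.

Lemma evZ c F : mpg F -> ev (fun x => c * F x) = c * ev F.
Proof. by move=> /mpg_intg ?; exact: ExZ. Qed.

Lemma ev_cst c : ev (fun=> c) = c. Proof. exact: Ex_cst. Qed.

Lemma ev_sum (J : Type) (s : seq J) (H : J -> (I -> R) -> R) : (forall j, mpg (H j)) ->
  ev (fun x => \sum_(j <- s) H j x) = \sum_(j <- s) ev (H j).
Proof. by move=> h; apply: Ex_sum => j; exact: mpg_intg. Qed.

Lemma ev_le F G : mpg F -> mpg G -> (forall x, F x <= G x) -> ev F <= ev G.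
Proof. by move=> /mpg_intg ? /mpg_intg ? H; apply: Ex_le. Qed.

Lemma eq_ev F G : (forall x, F x = G x) -> ev F = ev G.
Proof. by move=> H; apply: eq_Rintegral => t _. Qed.

Definition chisq (a : pred I) (x : I -> R) := \sum_(i | a i) x i ^+ 2.

Lemma chisq_ge0 a (x : I -> R) : 0 <= chisq a x.
Proof. by apply: sumr_ge0 => i _; exact: sqr_ge0. Qed.

Lemma mpg_chisq a : mpg (chisq a).
Proof.
rewrite (_ : chisq a = fun x => \sum_i (a i)%:R * x i ^+ 2).
  by apply: mpg_sum => i; apply: mpgM; [exact: mpg_cst|apply/mpgX/mpg_coord].
by apply/funext => x; rewrite /chisq big_mkcond; apply: eq_bigr => i _; case: (a i); rewrite ?mul1r ?mul0r.
Qed.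

Lemma mpg_comp_chisq a (H : R -> R) K k : measurable_fun setT H ->
  (forall s, 0 <= s -> `|H s| <= K * (1 + s) ^+ k) -> mpg (fun x => H (chisq a x)).
Proof.
move=> mH HK; split; first exact: (measurableT_comp mH (mpg_chisq a).1).
apply: (@pg_le _ _ _ (fun x => K * (1 + chisq a x) ^+ k)).
  by move=> x; rewrite (le_trans (HK _ (chisq_ge0 _ _)))// ler_norm.
by apply: pgZ; apply: pgX; apply: pgD; [exact: pg_cst|exact: (mpg_chisq a).2].
Qed.

Lemma chisq_upd (a : pred I) i (x : I -> R) (t : R) : a i ->
  chisq a (upd x i t) = t ^+ 2 + \sum_(j | a j && (j != i)) x j ^+ 2.
Proof.
move=> ai; rewrite /chisq (bigD1 i)//= {1}/upd eqxx; congr (_ + _).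
by apply: eq_bigr => j /andP[_ /negbTE ji]; rewrite /upd ji.
Qed.

(** The Stein identity of the chi-square law, with a factor [G] carrying the other variables:
    integrate by parts [x i * H (chisq a x) * G x] in each coordinate of [a], where [G] is constant,
    and sum. *)
Lemma chisq_ibp (a : pred I) (H H' : R -> R) G K k : measurable_fun setT H -> measurable_fun setT H' ->
  (forall s : R, 0 <= s -> is_derive s 1 H (H' s)) -> (forall s, 0 <= s -> {for s, continuous H'}) ->
  (forall s, 0 <= s -> `|H s| <= K * (1 + s) ^+ k) ->
  (forall s, 0 <= s -> `|H' s| <= K * (1 + s) ^+ k) ->
  mpg G -> (forall i, a i -> forall x t, G (upd x i t) = G x) ->
  ev (fun x => chisq a x * H (chisq a x) * G x) =
  #|a|%:R * ev (fun x => H (chisq a x) * G x) + 2 * ev (fun x => chisq a x * H' (chisq a x) * G x).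
Proof.
move=> mH mH' dH cH' HK H'K mG GE.
have mpH := mpg_comp_chisq a mH HK; have mpH' := mpg_comp_chisq a mH' H'K.
pose F i x := x i * (H (chisq a x) * G x).
pose F' i x := (H (chisq a x) + 2 * x i ^+ 2 * H' (chisq a x)) * G x.
have mpF i : mpg (F i) by apply: mpgM; [exact: mpg_coord|exact: mpgM].
have mpF' i : mpg (F' i).
  apply: mpgM => //; apply: mpgD => //; apply: mpgM => //.
  by apply: mpgM; [exact: mpg_cst|apply/mpgX/mpg_coord].
have ibp i : a i -> ev (fun x => x i * F i x) = ev (F' i).
  move=> ai; apply: (gfam_ibp g (mpF i).1 (mpF' i).1 (mpF i).2 (mpF' i).2).
    move=> x t; set c := \sum_(j | a j && (j != i)) x j ^+ 2.
    have c0 : 0 <= c by apply: sumr_ge0 => j _; exact: sqr_ge0.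
    rewrite (_ : (fun s => _) = fun s => s * H (s ^+ 2 + c) * G x); last first.
      by apply/funext => s; rewrite /F GE// chisq_upd// -/c mulrA {1}/upd eqxx.
    have d1 : is_derive t 1 (fun s : R => s ^+ 2 + c) (2 * t).
      by apply: is_derive_eq; rewrite /GRing.scale /=; ring.
    have d2 : is_derive (t ^+ 2 + c) 1 H (H' (t ^+ 2 + c)).
      by apply: dH; rewrite addr_ge0// sqr_ge0.
    have d3 := @is_derive1_comp _ H (fun s : R => s ^+ 2 + c) t _ _ d2 d1.
    have d4 := is_deriveM (is_derive_id t 1) d3.
    have d5 := is_deriveM d4 (is_derive_cst (G x) t 1).
    apply: (is_derive_eq d5).
    rewrite /F' GE// chisq_upd// -/c /upd eqxx /GRing.scale /=; ring.
  move=> x t; set c := \sum_(j | a j && (j != i)) x j ^+ 2.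
  have c0 : 0 <= c by apply: sumr_ge0 => j _; exact: sqr_ge0.
  rewrite (_ : (fun s => _) = fun s => (H (s ^+ 2 + c) + 2 * s ^+ 2 * H' (s ^+ 2 + c)) * G x); last first.
    by apply/funext => s; rewrite /F' GE// chisq_upd// -/c /upd eqxx.
  have s0 : 0 <= t ^+ 2 + c by rewrite addr_ge0// sqr_ge0.
  have ct : (fun s : R => s ^+ 2 + c) @ t --> t ^+ 2 + c.
    by apply: cvgD; [exact: exprn_continuous|exact: cvg_cst].
  apply: cvgM; last exact: cvg_cst.
  apply: cvgD.
    apply: (cvg_comp _ _ ct).
    have [dd _] := dH _ s0.
    by have : {for t ^+ 2 + c, continuous H} by apply: differentiable_continuous; apply/derivable1_diffP.
  apply: cvgM; last by apply: (cvg_comp _ _ ct); exact: cH'.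
  by apply: cvgM; [exact: cvg_cst|exact: exprn_continuous].
have mka (f : I -> (I -> R) -> R) x : \sum_(i | a i) f i x = \sum_i (a i)%:R * f i x.
  by rewrite big_mkcond; apply: eq_bigr => i _; case: (a i); rewrite ?mul1r ?mul0r.
have evmk (f : I -> (I -> R) -> R) : (forall i, mpg (f i)) ->
    ev (fun x => \sum_(i | a i) f i x) = \sum_(i | a i) ev (f i).
  move=> mf; transitivity (ev (fun x => \sum_i (a i)%:R * f i x)); first exact: eq_ev.
  rewrite ev_sum => [|i]; last by apply: mpgM => //; exact: mpg_cst.
  rewrite [RHS]big_mkcond; apply: eq_bigr => i _; rewrite evZ//.
  by case: (a i); rewrite ?mul1r ?mul0r.
transitivity (ev (fun x => \sum_(i | a i) x i * F i x)).
  apply: eq_ev => x; rewrite {1}/chisq -mulrA mulr_suml; apply: eq_bigr => i _.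
  by rewrite /F expr2 !mulrA.
rewrite evmk => [|i]; last by apply: mpgM => //; exact: mpg_coord.
rewrite (eq_bigr _ ibp) -evmk// -evZ; last exact: mpgM.
rewrite -evZ; last by apply: mpgM => //; apply: mpgM => //; exact: mpg_chisq.
rewrite -evD; last 2 first.
- by apply: mpgM; [exact: mpg_cst|exact: mpgM].
- apply: mpgM; first exact: mpg_cst.
  by apply: mpgM => //; apply: mpgM => //; exact: mpg_chisq.
apply: eq_ev => x; rewrite /F' -mulr_suml big_split /= sumr_const -mulr_suml -mulr_sumr -/(chisq a x).
by rewrite -mulr_natl; ring.
Qed.

Lemma chisq_powS (a : pred I) G j : mpg G -> (forall i, a i -> forall x t, G (upd x i t) = G x) ->
  ev (fun x => chisq a x ^+ j.+1 * G x) = (#|a|%:R + 2 * j%:R) * ev (fun x => chisq a x ^+ j * G x).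
Proof.
move=> mG GE.
have s1 (s : R) n : 0 <= s -> s ^+ n <= (1 + s) ^+ n by move=> s0; rewrite lerXn2r ?nnegrE ?lerDr ?addr_ge0.
have dX (s : R) : 0 <= s -> is_derive s 1 (fun s => s ^+ j) (j%:R * s ^+ j.-1).
  move=> _; have -> : (fun s : R => s ^+ j) = (id : R -> R) ^+ j by apply/funext => u; rewrite fctE.
  by have := is_deriveX j (is_derive_id s 1); rewrite /GRing.scale /= mulr1.
have cX (s : R) : 0 <= s -> {for s, continuous (fun s : R => j%:R * s ^+ j.-1)}.
  by move=> _; apply: cvgM; [exact: cvg_cst|exact: exprn_continuous].
have mX : measurable_fun setT (fun s : R => s ^+ j) by exact: measurable_funX.
have mX' : measurable_fun setT (fun s : R => j%:R * s ^+ j.-1).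
  by apply: measurable_funM => //; exact: measurable_funX.
have bX (s : R) : 0 <= s -> `|s ^+ j| <= (1 + j%:R) * (1 + s) ^+ j.
  move=> s0; rewrite ger0_norm ?exprn_ge0// (le_trans (s1 _ _ s0))//.
  by rewrite ler_peMl ?lerDl// exprn_ge0// addr_ge0.
have bX' (s : R) : 0 <= s -> `|j%:R * s ^+ j.-1| <= (1 + j%:R) * (1 + s) ^+ j.
  move=> s0; rewrite ger0_norm ?mulr_ge0 ?exprn_ge0// ler_pM ?exprn_ge0 ?lerDr//.
  by rewrite (le_trans (s1 _ _ s0))// ler_weXn2l ?lerDl ?leq_pred.
transitivity (ev (fun x => chisq a x * chisq a x ^+ j * G x)).
  by apply: eq_ev => x; rewrite exprS.
apply: (etrans (chisq_ibp mX mX' dX cX bX bX' mG GE)).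
have -> : ev (fun x => chisq a x * (j%:R * chisq a x ^+ j.-1) * G x) = j%:R * ev (fun x => chisq a x ^+ j * G x); last by ring.
rewrite -evZ.
  apply: eq_ev => x; case: j {dX cX mX mX' bX bX'} => [|j]; first by rewrite !mul0r mulr0 mul0r.
  by rewrite /= exprS; ring.
by apply: mpgM => //; apply: mpgX; exact: mpg_chisq.
Qed.

(** Iterating [chisq_powS] gives the moments [D * (D + 2) * ... * (D + 2 * (j - 1))], with
    [D = #|a|]. All central moments of [ratio] below are instances, with binomial coefficients in
    [c]. *)
Lemma chisq_poly (a : pred I) G (c : nat -> R) n : mpg G ->
  (forall i, a i -> forall x t, G (upd x i t) = G x) ->
  ev (fun x => (\sum_(j < n) c j * chisq a x ^+ j) * G x) =
  (\sum_(j < n) c j * \prod_(l < j) (#|a|%:R + 2 * l%:R)) * ev G.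
Proof.
move=> mG GE.
have mp j : mpg (fun x => chisq a x ^+ j * G x) by apply: mpgM => //; apply: mpgX; exact: mpg_chisq.
have P1 j : ev (fun x => chisq a x ^+ j * G x) = (\prod_(l < j) (#|a|%:R + 2 * l%:R)) * ev G.
  elim: j => [|j IH]; first by rewrite big_ord0 mul1r; apply: eq_ev => x; rewrite mul1r.
  by rewrite chisq_powS// IH big_ord_recr /= mulrA; congr (_ * _); rewrite mulrC.
transitivity (ev (fun x => \sum_(j < n) c j * (chisq a x ^+ j * G x))).
  by apply: eq_ev => x; rewrite mulr_suml; apply: eq_bigr => j _; rewrite mulrA.
rewrite ev_sum => [|j]; last by apply: mpgM => //; exact: mpg_cst.
by rewrite mulr_suml; apply: eq_bigr => j _; rewrite evZ// P1 mulrA.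
Qed.

Section ratio.
Variable a : pred I.
Hypothesis a0 : (0 < #|a|)%N.
Let D : R := #|a|%:R.
Let D0 : D != 0. Proof. by rewrite pnatr_eq0 -lt0n. Qed.

Definition ratio (x : I -> R) := chisq a x / #|a|%:R.

Lemma mpg_ratio : mpg ratio.
Proof. by apply: mpgM; [exact: mpg_chisq|exact: mpg_cst]. Qed.

Lemma ev_ratio1 G : mpg G -> (forall i, a i -> forall x t, G (upd x i t) = G x) ->
  ev (fun x => (ratio x - 1) * G x) = 0.
Proof.
move=> mG GE; have := @chisq_poly a G (nth 0 [:: -1; 1 / D]) 2 mG GE.
rewrite !big_ord_recr !big_ord0 /= -/D => E.
transitivity (0 * ev G); last by rewrite mul0r.
etransitivity; first etransitivity; [|exact: E|congr (_ * _); by field].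
by apply: eq_ev => x; rewrite !big_ord_recr big_ord0 /= /ratio -/D; field.
Qed.

Lemma ev_ratio2 G : mpg G -> (forall i, a i -> forall x t, G (upd x i t) = G x) ->
  ev (fun x => (ratio x - 1) ^+ 2 * G x) = 2 / D * ev G.
Proof.
move=> mG GE; have := @chisq_poly a G (nth 0 [:: 1; - 2 / D; 1 / D ^+ 2]) 3 mG GE.
rewrite !big_ord_recr !big_ord0 /= -/D => E.
etransitivity; first etransitivity; [|exact: E|congr (_ * _); by field].
by apply: eq_ev => x; rewrite !big_ord_recr big_ord0 /= /ratio -/D; field.
Qed.

Lemma ev_ratio3 : ev (fun x => (ratio x - 1) ^+ 3) = 8 / D ^+ 2.
Proof.
have := @chisq_poly a (fun=> 1) (nth 0 [:: -1; 3 / D; - 3 / D ^+ 2; 1 / D ^+ 3]) 4 (mpg_cst 1) (fun _ _ _ _ => erefl).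
rewrite !big_ord_recr !big_ord0 /= -/D ev_cst mulr1 => E.
etransitivity; first etransitivity; [|exact: E|by field].
by apply: eq_ev => x; rewrite !big_ord_recr big_ord0 /= /ratio -/D; field.
Qed.

Lemma ev_ratio4 : ev (fun x => (ratio x - 1) ^+ 4) = 12 / D ^+ 2 + 48 / D ^+ 3.
Proof.
have := @chisq_poly a (fun=> 1) (nth 0 [:: 1; - 4 / D; 6 / D ^+ 2; - 4 / D ^+ 3; 1 / D ^+ 4]) 5 (mpg_cst 1) (fun _ _ _ _ => erefl).
rewrite !big_ord_recr !big_ord0 /= -/D ev_cst mulr1 => E.
etransitivity; first etransitivity; [|exact: E|by field].
by apply: eq_ev => x; rewrite !big_ord_recr big_ord0 /= /ratio -/D; field.
Qed.

End ratio.

End chi_square.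

Section fatou_bound.
Context d (T : measurableType d) (R : realType) (P : probability T R).

(** Fatou's lemma for [min (f n) g], which converges to [g] also where [g] is 0 and [f n] may not
    converge to it. This exception covers the point where a chi-square variable vanishes. *)
Lemma intg_liminf (f : nat -> T -> R) (g : T -> R) (c : R) :
  (forall n, intg P (f n)) -> (forall n t, 0 <= f n t) -> (forall n, \int[P]_t f n t <= c) ->
  measurable_fun setT g -> (forall t, 0 <= g t) -> (forall t, g t = 0 \/ f ^~ t @ \oo --> g t) ->
  intg P g /\ \int[P]_t g t <= c.
Proof.
move=> fi f0 fc mg g0 fg; apply: intg_ge0 => //.
pose h n t := (Num.min (f n t) (g t))%:E.
have mh n : measurable_fun setT (h n).
  by apply/measurable_EFinP; apply: measurable_minr => //; exact: (intg_measurable (fi n)).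
have h0 n t : setT t -> (0 <= h n t)%E by rewrite lee_fin le_min f0 g0.
have hg t : limn_einf (h^~ t) = (g t)%:E.
  suff H : h ^~ t @ \oo --> (g t)%:E by have [-> _] := cvg_limn_einf_sup H.
  apply: cvg_EFin; first exact: nearW.
  have [E|fgt] := fg t.
    rewrite (_ : fine \o h ^~ t = fun=> g t); first exact: cvg_cst.
    by apply/funext => n /=; rewrite E; apply/min_idPr.
  apply/cvgrPdist_le => e e0; have /cvgrPdist_le/(_ e e0) := fgt.
  apply: filterS => n; rewrite /h /=; case: (leP (f n t) (g t)) => // _ _.
  by rewrite subrr normr0 ltW.
have := @fatou _ _ _ P setT measurableT h mh h0.
rewrite (eq_integral (fun t => (g t)%:E)) => [|t _]; last exact: hg.
move=> /le_trans; apply; rewrite limn_einf_lim; apply: lime_le; first exact: is_cvg_einfs.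
apply: nearW => n; apply: (@le_trans _ _ (\int[P]_t h n t)%E).
  by apply: ereal_inf_lbound; exists n => /=.
apply: (@le_trans _ _ (\int[P]_t (f n t)%:E)%E).
  apply: ge0_le_integral => //.
  - by move=> t _; exact: h0.
  - by apply/measurable_EFinP; exact: (intg_measurable (fi n)).
  - by move=> t _; rewrite lee_fin ge_min lexx.
by rewrite ExE// lee_fin.
Qed.

End fatou_bound.

(** * Third-order remainder of the logarithm *)

Section log_remainder.
Context (R : realType).
Implicit Types r s e : R.

Definition pos01 s : R := \1_[set s : R | 0 < s] s.

Lemma pos01E s : 0 < s -> pos01 s = 1.
Proof. by move=> s0; rewrite /pos01 indicE mem_set. Qed.

Lemma pos01_eq0 s : s <= 0 -> pos01 s = 0.
Proof. by move=> s0; rewrite /pos01 indicE memNset//= => /(le_lt_trans s0); rewrite ltxx. Qed.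

Lemma measurable_pos01 : measurable_fun setT pos01.
Proof.
apply: measurable_indic; rewrite (_ : [set _ | _] = [set` `]0, +oo[]); first exact: measurable_itv.
by apply/seteqP; split => s /=; rewrite in_itv/= andbT.
Qed.

(* The factor [pos01 r] discards the junk value of [ln] at [r <= 0]. *)
Definition lnrem r := (ln r - (r - 1) + (r - 1) ^+ 2 / 2) * pos01 r.

Lemma measurable_lnrem : measurable_fun setT lnrem.
Proof.
apply: measurable_funM; last exact: measurable_pos01.
apply: measurable_funD; first by apply: measurable_funB => //; exact: measurable_funB.
by apply: measurable_funM => //; apply: measurable_funX; exact: measurable_funB.
Qed.

(** The function [ln s - (s - 1) + (s - 1) ^+ 2 / 2] vanishes at 1 and has derivative
    [(s - 1) ^+ 2 / s]; apply the mean value theorem between 1 and [r]. *)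
Lemma lnrem_mvt r : 0 < r -> exists c, [/\ 0 < c, (c - 1) ^+ 2 <= (r - 1) ^+ 2, c^-1 <= 1 + r^-1 &
  lnrem r = (c - 1) ^+ 2 / c * (r - 1)].
Proof.
move=> r0; pose f s := ln s - (s - 1) + (s - 1) ^+ 2 / 2.
have df s : 0 < s -> is_derive s 1 f ((s - 1) ^+ 2 / s).
  move=> s0; have d1 := is_derive1_ln s0.
  apply: is_derive_eq; rewrite /GRing.scale /=.
  by field; rewrite gt_eqF.
have cf s : 0 < s -> {for s, continuous f}.
  by move=> s0; apply: differentiable_continuous; apply/derivable1_diffP; case: (df s s0).
have f1 : f 1 = 0 by rewrite /f ln1; ring.
have -> : lnrem r = f r by rewrite /lnrem pos01E// mulr1.
have r'0 : 0 < r^-1 by rewrite invr_gt0.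
have [r1|r1|->] := ltgtP r 1.
- have dfi s : s \in `]r, 1[ -> is_derive s 1 f ((s - 1) ^+ 2 / s).
    by rewrite in_itv /= => /andP[rs _]; apply: df; exact: lt_trans rs.
  have cfi : {within [set` `[r, 1]], continuous f}.
    apply: continuous_in_subspaceT => s; rewrite inE/= in_itv/= => /andP[rs _].
    by apply: cf; exact: lt_le_trans rs.
  have [c] := MVT r1 dfi cfi.
  rewrite in_itv /= => /andP[rc c1]; rewrite f1 sub0r => E.
  have c0 : 0 < c by exact: lt_trans rc.
  exists c; split=> //.
  + by nra.
  + rewrite (@le_trans _ _ r^-1) ?lerDr// lef_pV2 ?posrE// ltW//.
  + by rewrite -[LHS]opprK E; ring.
- have dfi s : s \in `]1, r[ -> is_derive s 1 f ((s - 1) ^+ 2 / s).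
    by rewrite in_itv /= => /andP[rs _]; apply: df; exact: lt_trans rs.
  have cfi : {within [set` `[1, r]], continuous f}.
    apply: continuous_in_subspaceT => s; rewrite inE/= in_itv/= => /andP[rs _].
    by apply: cf; exact: lt_le_trans rs.
  have [c] := MVT r1 dfi cfi.
  rewrite in_itv /= => /andP[rc c1]; rewrite f1 subr0 => E.
  have c0 : 0 < c by exact: lt_trans rc.
  exists c; split=> //.
  + by nra.
  + by rewrite (@le_trans _ _ 1)// ?lerDl ?(ltW r'0)// invf_le1// ltW.
- by exists 1; split => //; rewrite ?f1 ?invr1 ?lerDl// subrr expr0n /= ?mulr0.
Qed.

Lemma lnrem_sign r : 0 <= (r - 1) * lnrem r.
Proof.
have [r0|r0] := leP r 0; first by rewrite /lnrem pos01_eq0// !mulr0.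
have [c [c0 _ _ ->]] := lnrem_mvt r0.
by rewrite mulrCA -expr2 mulr_ge0 ?sqr_ge0// mulr_ge0 ?sqr_ge0// invr_ge0 ltW.
Qed.

(** Within distance [e] of 1 one has [r >= 1/4], and the mean value form is at most [5 * e ^+ 3].
    Beyond it, [1 <= e^-1 * |r - 1|], and by [lnrem_sign] the product with [|lnrem r|] needs no
    absolute value, so its expectation is accessible. *)
Lemma lnrem_le r e : 0 < e -> e <= 3 / 4 -> `|lnrem r| <= 5 * e ^+ 3 + e^-1 * ((r - 1) * lnrem r).
Proof.
move=> e0 e34; have e3 : 0 <= e ^+ 3 by rewrite exprn_ge0// ltW.
have [re|re] := leP `|r - 1| e; last first.
  have -> : (r - 1) * lnrem r = `|r - 1| * `|lnrem r| by rewrite -normrM ger0_norm ?lnrem_sign.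
  have h : 1 <= e^-1 * `|r - 1| by rewrite mulrC ler_pdivlMr// mul1r ltW.
  have := ler_wpM2r (normr_ge0 (lnrem r)) h; rewrite mul1r -mulrA => h'.
  by rewrite (le_trans h')// lerDr; apply: mulr_ge0.
rewrite -[leLHS]addr0 lerD//; last by apply: mulr_ge0; [rewrite invr_ge0 ltW|exact: lnrem_sign].
have r14 : 1 / 4 <= r by move: re; rewrite ler_norml => /andP[]; lra.
have r0 : 0 < r by lra.
have [c [c0 c1 c2 ->]] := lnrem_mvt r0.
have r4 : r^-1 <= 4.
  by rewrite -[leRHS]invrK lef_pV2 ?posrE ?invr_gt0//; lra.
rewrite normrM [e ^+ 3]exprSr mulrA ler_pM//.
rewrite ger0_norm; last by rewrite mulr_ge0 ?sqr_ge0 ?invr_ge0 ?ltW.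
rewrite mulrC ler_pM ?sqr_ge0 ?invr_ge0 ?(ltW c0)//; first by lra.
by rewrite (le_trans c1)// -real_normK ?num_real// lerXn2r ?nnegrE// ltW.
Qed.

End log_remainder.

Section chisq_log.
Context (R : realType) d (T : measurableType d) (P : probability T R).
Context (I : finType) (xi : I -> T -> R).
Hypothesis g : gfam P xi.
Variable a : pred I.
Hypothesis a0 : (0 < #|a|)%N.
Notation D := (#|a|%:R : R).
Notation ev := (expect P xi).
Let D0 : 0 < D. Proof. by rewrite ltr0n. Qed.

Lemma mpg_pos_chisq : mpg (fun x : I -> R => pos01 (chisq a x)).
Proof.
apply: (@mpg_comp_chisq _ _ a (@pos01 R) 1 0); first exact: measurable_pos01.
by move=> s _; rewrite expr0 mulr1; have [? ?] := indic01 R [set s : R | 0 < s] s; rewrite ger0_norm.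
Qed.

(** If the sum of squares is 0, then so is any one of its coordinates, an event of Gaussian measure
    0. *)
Lemma ev_chisq_eq0 : ev (fun x : I -> R => 1 - pos01 (chisq a x)) = 0.
Proof.
have /card_gt0P[i ai] := a0.
have m1 : measurable [set 0 : R] by exact: measurable_set1.
have mi : mpg (fun x : I -> R => \1_[set 0 : R] (x i)).
  split; first by apply: (@measurable_indic_comp _ _ (rvT R I)) => //; exact: measurable_coord.
  by apply: (@pg_bounded _ _ _ 1) => x; have [? ?] := indic01 R [set 0 : R] (x i); rewrite ger0_norm.
have mp : mpg (fun x : I -> R => 1 - pos01 (chisq a x)) by apply: mpgB; [exact: mpg_cst|exact: mpg_pos_chisq].
have [p0 p1] : (forall x : I -> R, 0 <= 1 - pos01 (chisq a x)) /\ (forall x : I -> R, 1 - pos01 (chisq a x) <= \1_[set 0 : R] (x i)).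
  split=> x; first by rewrite subr_ge0; have [] := indic01 R [set s : R | 0 < s] (chisq a x).
  have [c0|c0] := ltP 0 (chisq a x).
    by rewrite pos01E// subrr; have [] := indic01 R [set 0 : R] (x i).
  rewrite pos01_eq0// subr0 indicE mem_set//=.
  apply/eqP; rewrite -sqrf_eq0 eq_le sqr_ge0 andbT (le_trans _ c0)// /chisq (bigD1 i)//= lerDl.
  by apply: sumr_ge0 => j _; exact: sqr_ge0.
apply/eqP; rewrite eq_le; apply/andP; split; last first.
  by rewrite -(ev_cst P xi 0) ev_le//; exact: mpg_cst.
apply: (le_trans (ev_le g mp mi p1)).
rewrite /expect (@gfam_coordE _ _ _ _ _ _ g i (\1_[set 0 : R])); last exact: measurable_indic.
rewrite Ex_indic//.
have := @normal_prob_dominates R 0 1; rewrite null_content_dominatesP => H.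
by rewrite [X in fine X](H _ m1 (lebesgue_measure_set1 0)).
Qed.

(* Integration by parts against [s |-> ln (s + e)], the shift [e] avoiding the singularity at 0. *)
Lemma ev_chisq_ln (e : R) : 0 < e ->
  let F x := (chisq a x - D) * (ln (chisq a x + e) - ln (D + e)) in mpg F /\ ev F <= 2.
Proof.
move=> e0 F.
(* [H'] is [(s + e)^-1] in a form whose measurability is immediate. *)
pose H (s : R) := ln (s + e); pose H' (s : R) := expR (- ln (s + e)).
have se (s : R) : 0 <= s -> 0 < s + e by move=> s0; rewrite ltr_wpDl.
have H'E s : 0 <= s -> H' s = (s + e)^-1.
  by move=> s0; rewrite /H' -lnV ?posrE ?se// lnK ?posrE ?invr_gt0 ?se.
have mH : measurable_fun setT H by apply: measurableT_comp => //; exact: measurable_funD.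
have mH' : measurable_fun setT H'.
  by apply: measurableT_comp => //; apply: measurableT_comp.
have dH (s : R) : 0 <= s -> is_derive s 1 H (H' s).
  move=> s0; rewrite H'E//; have d1 := is_derive1_ln (se _ s0).
  have d2 : is_derive s 1 (fun s => s + e) 1 by apply: is_derive_eq; rewrite addr0.
  by have := @is_derive1_comp _ (@ln R) (fun s => s + e) s _ _ d1 d2; rewrite mulr1.
have cH' (s : R) : 0 <= s -> {for s, continuous H'}.
  move=> s0; have [d1 _] := dH _ s0.
  have cH : {for s, continuous H} by apply: differentiable_continuous; apply/derivable1_diffP.
  by apply: (cvg_comp _ _ (cvgN cH)); exact: continuous_expR.
pose K := 1 + e + `|ln e| + e^-1.
have K0 : 0 <= e^-1 by rewrite invr_ge0 ltW.
have n0 := normr_ge0 (ln e).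
have HK (s : R) : 0 <= s -> `|H s| <= K * (1 + s) ^+ 1.
  move=> s0; rewrite expr1 /H /K.
  have h1 := ln_sublinear (se _ s0).
  have h2 : ln e <= ln (s + e) by rewrite ler_ln ?posrE ?se// lerDr.
  have h3 := ler_norm (- ln e); rewrite normrN in h3.
  rewrite ler_norml; apply/andP; split; nra.
have HK' (s : R) : 0 <= s -> `|H' s| <= K * (1 + s) ^+ 1.
  move=> s0; rewrite expr1 H'E// ger0_norm ?invr_ge0 ?(ltW (se _ s0))//.
  apply: (@le_trans _ _ e^-1); first by rewrite lef_pV2 ?posrE ?se// lerDr.
  by rewrite /K; nra.
have mpH := mpg_comp_chisq a mH HK; have mpH' := mpg_comp_chisq a mH' HK'.
have mpC := @mpg_chisq R I a.
have mc c : mpg (fun _ : I -> R => c) by exact: mpg_cst.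
have ibp := chisq_ibp g mH mH' dH cH' HK HK' (mc 1) (fun _ _ _ _ => erefl).
have mF : mpg F by apply: mpgM; apply: mpgB.
split=> //.
have E1 : ev (fun x => (chisq a x - D) * ln (D + e)) = 0.
  have := ev_ratio1 g a0 (mc (D * ln (D + e))) (fun _ _ _ _ => erefl).
  move=> <-; apply: eq_ev => x; rewrite /ratio; field.
  by rewrite gt_eqF.
have -> : ev F = ev (fun x => chisq a x * H (chisq a x) * 1 - (D * (H (chisq a x) * 1) + (chisq a x - D) * ln (D + e))).
  by apply: eq_ev => x; rewrite /F /H; ring.
rewrite evB//; last 2 first.
- by apply: mpgM => //; apply: mpgM.
- by apply: mpgD; apply: mpgM => //; [apply: mpgM|apply: mpgB].
rewrite evD//; last 2 first.
- by apply: mpgM => //; apply: mpgM.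
- by apply: mpgM => //; apply: mpgB.
rewrite E1 evZ//; last by apply: mpgM.
(* The terms in [D * E (H C)] cancel; what remains is [2 * E (C / (C + e))], at most 2 uniformly in
   the shift. *)
rewrite ibp addr0 addrAC subrr add0r.
rewrite -[leRHS]mulr1 ler_pM2l// -[leRHS](ev_cst P xi) ev_le//.
  by apply: mpgM => //; apply: mpgM.
move=> x; have C0 := chisq_ge0 a x; rewrite mulr1 H'E// ler_pdivrMr ?se// mul1r lerDl ltW//.
Qed.

(** The shift in [ev_chisq_ln] tends to 0 along [harmonic]. The shifted products are nonnegative
    because [ln] is increasing, so Fatou keeps the uniform bound. *)
Lemma ev_ratio_ln : let F (x : I -> R) := (ratio a x - 1) * ln (ratio a x) * pos01 (ratio a x) in
  intg P (fun t => F (xi^~ t)) /\ ev F <= 2 / D.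
Proof.
move=> F; have mx : measurable_fun setT (fun t => xi^~ t : rvT R I) by apply: measurable_torv; case: g.
pose f n t := D^-1 * ((chisq a (xi^~ t) - D) * (ln (chisq a (xi^~ t) + harmonic n) - ln (D + harmonic n))).
have h0 n : 0 < harmonic n :> R := harmonic_gt0 n.
have mono (u v : R) : 0 < u -> 0 < v -> 0 <= (u - v) * (ln u - ln v).
  move=> u0 v0; have [uv|uv] := leP u v.
    by rewrite -mulrNN mulr_ge0// oppr_ge0 subr_le0// ler_ln ?posrE.
  by rewrite mulr_ge0// subr_ge0; [exact: ltW|rewrite ler_ln ?posrE// ltW].
have FE x : F x = D^-1 * ((chisq a x - D) * (ln (chisq a x) - ln D)) * pos01 (chisq a x).
  rewrite /F /ratio; have [c0|c0] := ltP 0 (chisq a x).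
    by rewrite !pos01E ?divr_gt0// ln_div ?posrE//; field; rewrite gt_eqF.
  by rewrite !pos01_eq0 ?mulr0// pmulr_lle0 ?invr_gt0.
apply: (@intg_liminf _ _ _ P f).
- by move=> n; apply: intgZ; exact: (mpg_intg g (ev_chisq_ln (h0 n)).1).
- move=> n t; apply: mulr_ge0; first by rewrite invr_ge0 ltW.
  have -> : chisq a (xi^~ t) - D = (chisq a (xi^~ t) + harmonic n) - (D + harmonic n) by ring.
  rewrite mono// ltr_wpDl ?chisq_ge0 ?(ltW D0)//.
- move=> n; have [mF le2] := ev_chisq_ln (h0 n).
  by rewrite /f ExZ; [rewrite mulrC ler_pM2r ?invr_gt0|exact: (mpg_intg g mF)].
- apply: (measurableT_comp (f := F : rvT R I -> R)) => //.
  apply: measurable_funM; first apply: measurable_funM.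
  + by apply: measurable_funB => //; exact: (mpg_ratio _ _).1.
  + by apply: measurableT_comp => //; exact: (mpg_ratio _ _).1.
  + by apply: measurableT_comp; [exact: measurable_pos01|exact: (mpg_ratio _ _).1].
- move=> t; rewrite FE; have [c0|c0] := ltP 0 (chisq a (xi^~ t)).
    by rewrite pos01E// mulr1; apply: mulr_ge0; [rewrite invr_ge0 ltW|exact: mono].
  by rewrite pos01_eq0 ?mulr0.
- move=> t; rewrite FE; have [c0|c0] := ltP 0 (chisq a (xi^~ t)); last by left; rewrite pos01_eq0 ?mulr0.
  right; rewrite pos01E// mulr1; apply: cvgM; first exact: cvg_cst.
  apply: cvgM; first exact: cvg_cst.
  have cl (u : R) : 0 < u -> (fun n => ln (u + harmonic n)) @ \oo --> ln u.
    move=> u0; have hu : (fun n => u + harmonic n) @ \oo --> u.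
      by rewrite -[X in _ --> X]addr0; apply: cvgD; [exact: cvg_cst|exact: cvg_harmonic].
    exact: (cvg_comp _ _ hu (continuous_ln u0)).
  by apply: cvgB; apply: cl.
Qed.

(* Since [(r - 1) * lnrem r >= 0] has expectation at most [4 / D ^+ 2], the values of [r] at distance
   more than [1 / sqrt D] from 1 are under control, and [lnrem_le] covers the others. *)
Lemma ev_lnrem : (2 <= #|a|)%N -> let F (x : I -> R) := lnrem (ratio a x) in
  intg P (fun t => F (xi^~ t)) /\ ev (fun x => `|F x|) <= 9 / (D * Num.sqrt D).
Proof.
move=> a2 F; have [iL eL] := ev_ratio_ln.
have mx : measurable_fun setT (fun t => xi^~ t : rvT R I) by apply: measurable_torv; case: g.
have mpr := @mpg_ratio R I a.
have mc c : mpg (fun _ : I -> R => c) by exact: mpg_cst.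
have pr (x : I -> R) : pos01 (ratio a x) = pos01 (chisq a x).
  rewrite /ratio; have [c0|c0] := ltP 0 (chisq a x); first by rewrite !pos01E ?divr_gt0//.
  by rewrite !pos01_eq0// pmulr_lle0 ?invr_gt0.
pose A (x : I -> R) := (ratio a x - 1) * ln (ratio a x) * pos01 (ratio a x).
(* The last term compensates the value -3/2 that the polynomial takes at ratio 0, where [A] and
   [lnrem] are 0. *)
pose B (x : I -> R) := (ratio a x - 1) ^+ 3 / 2 - (ratio a x - 1) ^+ 2 + 3 / 2 * (1 - pos01 (chisq a x)).
have mB : mpg B.
  apply: mpgD; first apply: mpgB.
  - by apply: mpgM => //; apply: mpgX; exact: mpgB.
  - by apply: mpgX; exact: mpgB.
  - by apply: mpgM => //; apply: mpgB => //; exact: mpg_pos_chisq.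
have sE x : (ratio a x - 1) * F x = A x + B x.
  rewrite /F /A /B /lnrem pr; have [c0|c0] := ltP 0 (chisq a x); first by rewrite pos01E//; field.
  have -> : ratio a x = 0 by rewrite /ratio (_ : chisq a x = 0) ?mul0r//; apply/eqP; rewrite eq_le c0 chisq_ge0.
  by rewrite pos01_eq0//; field.
have iS : intg P (fun t => (ratio a (xi^~ t) - 1) * F (xi^~ t)).
  under eq_fun do rewrite sE.
  by apply: intgD => //; exact: mpg_intg.
have eS : ev (fun x => (ratio a x - 1) * F x) <= 4 / D ^+ 2.
  rewrite (eq_ev P xi sE) /expect ExD//; last exact: mpg_intg.
  rewrite -/(expect P xi B) -/(expect P xi A).
  (* The [- 2 / D] offsets the bound of [ev_ratio_ln] exactly, so only half of the third moment, of
     order [D ^- 2], survives. *)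
  have -> : ev B = 4 / D ^+ 2 - 2 / D.
    rewrite /B evD//; last 2 first.
    - by apply: mpgB; [apply: mpgM => //|]; apply: mpgX; exact: mpgB.
    - by apply: mpgM => //; apply: mpgB => //; exact: mpg_pos_chisq.
    rewrite evB//; last 2 first.
    - by apply: mpgM => //; apply: mpgX; exact: mpgB.
    - by apply: mpgX; exact: mpgB.
    rewrite (evZ g); last by apply: mpgB => //; exact: mpg_pos_chisq.
    rewrite ev_chisq_eq0 mulr0 addr0.
    have E2 := ev_ratio2 g a0 (mc 1) (fun _ _ _ _ => erefl).
    rewrite ev_cst mulr1 in E2.
    have -> : ev (fun x => (ratio a x - 1) ^+ 2) = 2 / D.
      by rewrite -E2; apply: eq_ev => x; rewrite mulr1.
    congr (_ - _); transitivity (2^-1 * (8 / D ^+ 2)); last by field; rewrite gt_eqF.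
    rewrite -(ev_ratio3 g a0) -(evZ g)//; last by apply: mpgX; exact: mpgB.
    by apply: eq_ev => x; rewrite mulrC.
  by rewrite addrCA -[leRHS]addr0 lerD2l subr_le0.
(* This choice gives both terms of [lnrem_le] the size [1 / (D * sqrt D)], with constants 5 + 4 = 9.
   It is at most 3/4 because [D >= 2]. *)
pose e := (Num.sqrt D)^-1.
have s0 : 0 < Num.sqrt D by rewrite sqrtr_gt0.
have e0 : 0 < e by rewrite invr_gt0.
have ss : Num.sqrt D ^+ 2 = D by rewrite sqr_sqrtr// ltW.
have D2 : 2 <= D by rewrite (ler_nat _ 2).
have e34 : e <= 3 / 4.
  by rewrite /e -div1r ler_pdivrMr//; rewrite -(@ler_pXn2r _ 2) ?nnegrE ?mulr_ge0 ?(ltW s0)// expr1n exprMn ss; lra.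
have bnd x : `|F x| <= 5 * e ^+ 3 + e^-1 * ((ratio a x - 1) * F x) by exact: lnrem_le.
have iU : intg P (fun t => 5 * e ^+ 3 + e^-1 * ((ratio a (xi^~ t) - 1) * F (xi^~ t))).
  by apply: intgD; [exact: intg_cst|exact: intgZ].
have mF : measurable_fun setT (fun t => F (xi^~ t)).
  apply: (measurableT_comp (f := F : rvT R I -> R)) => //.
  by apply: measurableT_comp; [exact: measurable_lnrem|exact: mpr.1].
have iF : intg P (fun t => F (xi^~ t)) by apply: (intg_le mF _ iU) => t; exact: bnd.
split=> //.
apply: (@le_trans _ _ (\int[P]_t (5 * e ^+ 3 + e^-1 * ((ratio a (xi^~ t) - 1) * F (xi^~ t))))).
  by apply: (Ex_le (intg_abs iF) iU) => t; exact: bnd.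
rewrite ExD ?Ex_cst; [|exact: intg_cst|exact: intgZ].
rewrite ExZ// -/(expect P xi (fun x => (ratio a x - 1) * F x)).
apply: (@le_trans _ _ (5 * e ^+ 3 + e^-1 * (4 / D ^+ 2))).
  by rewrite lerD2l ler_pM2l ?invr_gt0.
rewrite /e -[X in X ^+ 2]ss -[X in 9 / (X * _)]ss.
rewrite le_eqVlt; apply/orP; left; apply/eqP; field.
by rewrite gt_eqF.
Qed.

End chisq_log.

(** * Central limit theorem for a quadratic chaos *)

Section gfam_option.
Context (R : realType) d (T : measurableType d) (P : probability T R).
Context (J : finType) (xi : J -> T -> R).
Notation gam := (@normal_prob R 0 1).

(** Adjoins an independent standard normal coordinate at index [None], the end point of the rotation
    that starts at the chaos. *)
Definition extend_gauss (i : option J) (t : T * R) : R := if i is Some j then xi j t.1 else t.2.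

Lemma gfam_extend : gfam P xi -> gfam (P \x gam)%E extend_gauss.
Proof.
move=> [m1 g1]; split.
  case=> [j|]; rewrite /extend_gauss; last exact: measurable_snd.
  exact: (measurableT_comp (m1 j) measurable_fst).
move=> A mA.
rewrite (_ : [set t | _] = [set t | forall j, A (Some j) (xi j t)] `*` A None).
  have B1 := measurable_boxpre m1 (fun j => mA (Some j)).
  rewrite [X in fine X](product_measure1E P gam B1 (mA None)).
  rewrite fineM ?fin_num_measure//; last exact: mA.
  rewrite (bigD1 None)//= mulrC; congr (_ * _); rewrite (g1 (fun j => A (Some j)))//.
  by rewrite (reindex_omap Some id) => [|[]//]; apply: eq_bigl => j; rewrite /= eqxx.
apply/seteqP; split => -[a b] /=; first by move=> H; split => [j|]; [exact: (H (Some j))|exact: (H None)].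
by move=> [H K] [j|]; [exact: H|exact: K].
Qed.

End gfam_option.

Section interpolation.
Context (R : realType) d (T : measurableType d) (P : probability T R).
Context (J : finType) (xi : option J -> T -> R).
Hypothesis g : gfam P xi.
Variables (c : J -> R) (h h' h'' : R -> R).
Hypotheses (dh : forall u : R, is_derive u 1 h (h' u)) (dh' : forall u : R, is_derive u 1 h' (h'' u)).
Hypotheses (ch'' : continuous h'') (h1 : forall u, `|h u| <= 1) (h'1 : forall u, `|h' u| <= 1)
  (h''1 : forall u, `|h'' u| <= 1).
Notation ev := (expect P xi).

Let ch : continuous h.
Proof. by move=> u; apply: differentiable_continuous; apply/derivable1_diffP; case: (dh u). Qed.
Let ch' : continuous h'.
Proof. by move=> u; apply: differentiable_continuous; apply/derivable1_diffP; case: (dh' u). Qed.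

Let W (x : option J -> R) := \sum_j c j * (x (Some j) ^+ 2 - 1).
(** Half the squared gradient of [W]. Its mean is the variance of [W], and its fluctuation measures
    the distance of [W] from normality. *)
Let V (x : option J -> R) := \sum_j 2 * c j ^+ 2 * x (Some j) ^+ 2.
Let U (a b : R) x := a * W x + b * x None.

Let mpW : mpg W.
Proof.
apply: mpg_sum => j; apply: mpgM; first exact: mpg_cst.
by apply: mpgB; [apply/mpgX/mpg_coord|exact: mpg_cst].
Qed.

Let mpV : mpg V.
Proof. by apply: mpg_sum => j; apply: mpgM; [exact: mpg_cst|apply/mpgX/mpg_coord]. Qed.

Let mpU a b : mpg (U a b).
Proof. by apply: mpgD; apply: mpgM; [exact: mpg_cst|exact: mpW|exact: mpg_cst|exact: mpg_coord]. Qed.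

Let mp_comp (f : R -> R) a b : continuous f -> (forall u, `|f u| <= 1) -> mpg (fun x => f (U a b x)).
Proof.
move=> cf f1; split; last by apply: (@pg_bounded _ _ _ 1).
by apply: measurableT_comp; [exact: continuous_measurable_fun|exact: (mpU a b).1].
Qed.

Let W_upd x j t : W (upd x (Some j) t) = c j * (t ^+ 2 - 1) + \sum_(i | i != j) c i * (x (Some i) ^+ 2 - 1).
Proof.
rewrite /W (bigD1 j)//= {1}/upd eqxx; congr (_ + _).
by apply: eq_bigr => i ij; rewrite /upd (_ : (Some i == Some j) = (i == j))// (negbTE ij).
Qed.

Let U_upd a b x j t : U a b (upd x (Some j) t) =
  a * c j * t ^+ 2 + (a * (\sum_(i | i != j) c i * (x (Some i) ^+ 2 - 1) - c j) + b * x None).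
Proof. by rewrite /U W_upd {1}/upd /=; ring. Qed.

Lemma ibp_gauss a b : ev (fun x => x None * h' (U a b x)) = b * ev (fun x => h'' (U a b x)).
Proof.
rewrite -evZ//; last exact: mp_comp.
have m1 := mp_comp a b ch' h'1.
have m2 : mpg (fun x => b * h'' (U a b x)) by apply: mpgM; [exact: mpg_cst|exact: mp_comp].
have W_updN x t : W (upd x None t) = W x by [].
apply: (gfam_ibp g m1.1 m2.1 m1.2 m2.2) => x.
  move=> t; rewrite (_ : (fun s => _) = fun s => h' (b * s + a * W x)); last first.
    by apply/funext => s; rewrite /U W_updN /upd eqxx addrC.
  have d1 : is_derive t 1 (fun s : R => b * s + a * W x) b.
    by apply: is_derive_eq; rewrite /GRing.scale /=; ring.
  have d2 := @is_derive1_comp _ h' (fun s : R => b * s + a * W x) t _ _ (dh' _) d1.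
  by apply: (is_derive_eq d2); rewrite /U W_updN /upd eqxx [in RHS]addrC mulrC.
rewrite (_ : (fun s => _) = fun s => b * h'' (b * s + a * W x)); last first.
  by apply/funext => s; rewrite /U W_updN /upd eqxx addrC.
move=> t; apply: cvgM; first exact: cvg_cst.
have ct : (fun s : R => b * s + a * W x) @ t --> b * t + a * W x.
  by apply: cvgD; [apply: cvgM; [exact: cvg_cst|exact: cvg_id]|exact: cvg_cst].
by apply: (cvg_comp _ _ ct); exact: ch''.
Qed.

(** In the term [c j * (x j ^+ 2 - 1) * h'], integration by parts spends one factor [x j]:
    differentiating the other one cancels the [- 1], and differentiating [h'] produces
    [2 * a * c j * x j ^+ 2 * h'']. *)
Lemma ibp_chaos a b : ev (fun x => W x * h' (U a b x)) = a * ev (fun x => V x * h'' (U a b x)).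
Proof.
have m1 := mp_comp a b ch' h'1; have m2 := mp_comp a b ch'' h''1.
have mx j : mpg (fun x : option J -> R => x (Some j)) by exact: mpg_coord.
have mc k : mpg (fun _ : option J -> R => k) by exact: mpg_cst.
pose F j x := x (Some j) * h' (U a b x).
pose F' j x := h' (U a b x) + 2 * a * c j * x (Some j) ^+ 2 * h'' (U a b x).
have mF j : mpg (F j) by apply: mpgM.
have mF2 j : mpg (fun x => 2 * a * c j * x (Some j) ^+ 2 * h'' (U a b x)).
  by apply: mpgM => //; apply: mpgM => //; exact: mpgX.
have mF' j : mpg (F' j) by apply: mpgD.
have ibp j : ev (fun x => x (Some j) * F j x) = ev (F' j).
  apply: (gfam_ibp g (mF j).1 (mF' j).1 (mF j).2 (mF' j).2) => x.
    move=> t; set k := a * (\sum_(i | i != j) c i * (x (Some i) ^+ 2 - 1) - c j) + b * x None.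
    rewrite (_ : (fun s => _) = fun s => s * h' (a * c j * s ^+ 2 + k)); last first.
      by apply/funext => s; rewrite /F U_upd {1}/upd eqxx.
    have d1 : is_derive t 1 (fun s : R => a * c j * s ^+ 2 + k) (2 * a * c j * t).
      by apply: is_derive_eq; rewrite /GRing.scale /=; ring.
    have d2 := @is_derive1_comp _ h' (fun s : R => a * c j * s ^+ 2 + k) t _ _ (dh' _) d1.
    have d3 := is_deriveM (is_derive_id t 1) d2.
    by apply: (is_derive_eq d3); rewrite /F' U_upd /upd eqxx /GRing.scale /=; ring.
  move=> t; set k := a * (\sum_(i | i != j) c i * (x (Some i) ^+ 2 - 1) - c j) + b * x None.
  rewrite (_ : (fun s => _) = fun s => h' (a * c j * s ^+ 2 + k) + 2 * a * c j * s ^+ 2 * h'' (a * c j * s ^+ 2 + k)); last first.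
    by apply/funext => s; rewrite /F' U_upd {1}/upd eqxx.
  have ct : (fun s : R => a * c j * s ^+ 2 + k) @ t --> a * c j * t ^+ 2 + k.
    by apply: cvgD; [apply: cvgM; [exact: cvg_cst|exact: exprn_continuous]|exact: cvg_cst].
  apply: cvgD; first by apply: (cvg_comp _ _ ct); exact: ch'.
  apply: cvgM; last by apply: (cvg_comp _ _ ct); exact: ch''.
  by apply: cvgM; [exact: cvg_cst|exact: exprn_continuous].
transitivity (ev (fun x => \sum_j c j * (x (Some j) * F j x - h' (U a b x)))).
  by apply: eq_ev => x; rewrite /W mulr_suml; apply: eq_bigr => j _; rewrite /F; ring.
rewrite -evZ//; last by apply: mpgM.
transitivity (ev (fun x => \sum_j c j * (2 * a * c j * x (Some j) ^+ 2 * h'' (U a b x)))); last first.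
  by apply: eq_ev => x; rewrite /V mulr_suml mulr_sumr; apply: eq_bigr => j _; ring.
have mxF j : mpg (fun x => x (Some j) * F j x) by apply: mpgM.
rewrite !ev_sum//; last 2 first.
- by move=> j; apply: mpgM.
- by move=> j; apply: mpgM => //; exact: mpgB.
apply: eq_bigr => j _; rewrite !evZ//; last by apply: mpgB.
congr (_ * _); rewrite evB// ibp evD//.
by rewrite addrAC subrr add0r.
Qed.

(* Rotate from [W] to an independent standard normal: by the two integrations by parts, the derivative
   of [E h (cos u * W + sin u * Z)] in [u] is [cos u * sin u * E ((1 - V) * h'' (cos u * W + sin u * Z))]. *)
Lemma interpolation_le : `|ev (fun x => h (W x)) - ev (fun x => h (x None))| <= 2 * ev (fun x => `|1 - V x|).
Proof.
pose E1 := ev (fun x => `|1 - V x|).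
pose f (u : R) t := h (U (cos u) (sin u) (xi^~ t)).
have intf u : intg P (f u) by exact: (mpg_intg g (mp_comp (cos u) (sin u) ch h1)).
pose df' u x := h' (U (cos u) (sin u) x) * (- (sin u * W x) + cos u * x None).
have mdf' u : mpg (df' u).
  apply: mpgM; first exact: mp_comp.
  apply: mpgD; last by apply: mpgM; [exact: mpg_cst|exact: mpg_coord].
  have : mpg (fun x => - sin u * W x) by apply: mpgM; [exact: mpg_cst|exact: mpW].
  by congr mpg; apply/funext => x; rewrite mulNr.
have df (u : R) t : is_derive u 1 (f ^~ t) (df' u (xi^~ t)).
  have d1 : is_derive u 1 (fun v : R => cos v * W (xi^~ t) + sin v * xi None t)
     (- (sin u * W (xi^~ t)) + cos u * xi None t).
    have := is_deriveD (is_deriveM (is_derive_cos u) (is_derive_cst (W (xi^~ t)) u 1))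
      (is_deriveM (is_derive_sin u) (is_derive_cst (xi None t) u 1)).
    by move=> h3; apply: (is_derive_eq h3); rewrite /GRing.scale /=; ring.
  exact: (@is_derive1_comp _ h (fun v : R => cos v * W (xi^~ t) + sin v * xi None t) u _ _ (dh _) d1).
pose B t := `|W (xi^~ t)| + `|xi None t|.
have iB : intg P B.
  apply: intgD; apply: intg_abs; first exact: (mpg_intg g mpW).
  by apply: (mpg_intg g (F := fun x => x None)); exact: mpg_coord.
have mpE : mpg (fun x => `|1 - V x|).
  have m1V : mpg (fun x => 1 - V x) by apply: mpgB; [exact: mpg_cst|exact: mpV].
  split; first by apply: measurableT_comp => //; exact: m1V.1.
  by apply: (pg_le _ m1V.2) => x; rewrite normr_id.
pose psi u := \int[P]_t f u t.
pose psi' u := ev (df' u).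
have dpsi (u : R) : is_derive u 1 psi (psi' u).
  have uI : [set` `]u - 1, u + 1[] u by rewrite /= in_itv/=; apply/andP; split; lra.
  have d1E a y : partial1of2 f a y = df' a (xi^~ y).
    by rewrite partial1of2E; case: (df a y).
  have d1 a y : [set` `]u - 1, u + 1[] a -> setT y -> derivable (f ^~ y) a 1.
    by move=> _ _; case: (df a y).
  have ub a y : [set` `]u - 1, u + 1[] a -> setT y -> `|partial1of2 f a y| <= B y.
    move=> _ _; rewrite d1E /df' normrM -[leRHS]mul1r ler_pM// (le_trans (ler_normD _ _))// normrN !normrM.
    by rewrite lerD// ler_piMl// ler_norml ?sin_geN1 ?sin_le1 ?cos_geN1 ?cos_le1.
  have B0 y : 0 <= B y by exact: addr_ge0.
  have D := @derivable_under_integral _ _ _ P f setT measurableT u (u - 1) (u + 1) uI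
     (fun a _ => intf a) d1 B B0 iB ub.
  have E := @differentiation_under_integral _ _ _ P f setT measurableT u (u - 1) (u + 1) uI
     (fun a _ => intf a) d1 B B0 iB ub.
  apply: DeriveDef => //.
  by rewrite -derive1E E; apply: eq_Rintegral => y _; exact: d1E.
have psi'_le u : `|psi' u| <= E1.
  have m1 := mp_comp (cos u) (sin u) ch' h'1; have m2 := mp_comp (cos u) (sin u) ch'' h''1.
  have mc k : mpg (fun _ : option J -> R => k) by exact: mpg_cst.
  have mN : mpg (fun x : option J -> R => x None) by exact: mpg_coord.
  pose G x := (1 - V x) * h'' (U (cos u) (sin u) x).
  have mG : mpg G by apply: mpgM => //; apply: mpgB.
  have -> : psi' u = cos u * sin u * ev G.
    transitivity (ev (fun x => cos u * (x None * h' (U (cos u) (sin u) x)) - sin u * (W x * h' (U (cos u) (sin u) x)))).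
      by apply: eq_ev => x; rewrite /df'; ring.
    rewrite evB//; last 2 first.
    - by apply: mpgM => //; apply: mpgM.
    - by apply: mpgM => //; apply: mpgM.
    rewrite (evZ g); last by apply: mpgM.
    rewrite (evZ g); last by apply: mpgM.
    rewrite ibp_gauss ibp_chaos.
    have -> : ev G = ev (fun x => h'' (U (cos u) (sin u) x)) - ev (fun x => V x * h'' (U (cos u) (sin u) x)).
      rewrite -evB//; last by apply: mpgM.
      by apply: eq_ev => x; rewrite /G; ring.
    by ring.
  rewrite normrM -[leRHS]mul1r ler_pM//.
    by rewrite normrM -[leRHS]mulr1 ler_pM// ler_norml ?sin_geN1 ?sin_le1 ?cos_geN1 ?cos_le1.
  apply: (le_trans (Ex_abs (mpg_intg g mG))).
  apply: (Ex_le (intg_abs (mpg_intg g mG)) (mpg_intg g mpE)) => t.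
  by rewrite /G normrM -[leRHS]mulr1 ler_pM.
have pi2 : 0 < pi / 2 :> R by rewrite divr_gt0// pi_gt0.
have cpsi : {within [set` `[0, pi / 2]], continuous psi}.
  apply: continuous_subspaceT => u.
  by apply: differentiable_continuous; apply/derivable1_diffP; case: (dpsi u).
(* Mean value theorem along the whole rotation; the interval has length [pi / 2 <= 2], the source of
   the factor 2. *)
have [v _] := MVT pi2 (fun u _ => dpsi u) cpsi.
rewrite subr0 => E.
have -> : ev (fun x => h (W x)) = psi 0.
  by apply: eq_Rintegral => t _; rewrite /f /U cos0 sin0 mul1r mul0r addr0.
have -> : ev (fun x => h (x None)) = psi (pi / 2).
  by apply: eq_Rintegral => t _; rewrite /f /U cos_pihalf sin_pihalf mul1r mul0r add0r.
rewrite distrC E normrM mulrC ler_pM//.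
by rewrite ger0_norm ?(ltW pi2)// ltW// pihalf_lt2.
Qed.

End interpolation.

Section chaos_clt.
Context (R : realType) d (T : measurableType d) (P : probability T R).
Context (J : finType) (xi : J -> T -> R).
Hypothesis g : gfam P xi.
Notation gam := (@normal_prob R 0 1).

Definition chaos (c : J -> R) (x : J -> R) := \sum_j c j * (x j ^+ 2 - 1).

Lemma mpg_chaos c : mpg (chaos c).
Proof.
apply: mpg_sum => j; apply: mpgM; first exact: mpg_cst.
by apply: mpgB; [apply/mpgX/mpg_coord|exact: mpg_cst].
Qed.

(** Each [x j ^+ 2 - 1] is a centered ratio with one degree of freedom, hence of variance 2, and
    independence kills the cross terms. *)
Lemma ev_sqr_chaos c : expect P xi (fun x => chaos c x ^+ 2) = 2 * \sum_j c j ^+ 2.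
Proof.
have mc k : mpg (fun _ : J -> R => k) by exact: mpg_cst.
have mx j : mpg (fun x : J -> R => x j) by exact: mpg_coord.
have mq j : mpg (fun x : J -> R => x j ^+ 2 - 1) by apply: mpgB => //; exact: mpgX.
have mqq i j : mpg (fun x : J -> R => (x j ^+ 2 - 1) * (x i ^+ 2 - 1)) by apply: mpgM.
have r1 j x : ratio (pred1 j) x = x j ^+ 2.
  by rewrite /ratio card1 divr1 /chisq big_pred1_eq.
have c0 (j : J) : (0 < #|pred1 j|)%N by rewrite card1.
transitivity (expect P xi (fun x => \sum_j \sum_i c j * c i * ((x j ^+ 2 - 1) * (x i ^+ 2 - 1)))).
  apply: eq_ev => x; rewrite expr2 /chaos mulr_suml; apply: eq_bigr => j _.
  by rewrite mulr_sumr; apply: eq_bigr => i _; ring.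
rewrite ev_sum//; last by move=> j; apply: mpg_sum => i; apply: mpgM.
rewrite mulr_sumr; apply: eq_bigr => j _.
rewrite ev_sum//; last by move=> i; apply: mpgM.
rewrite (bigD1 j)//= big1 ?addr0 => [|i ij].
  rewrite evZ//.
  have := ev_ratio2 g (c0 j) (mc 1) (fun _ _ _ _ => erefl).
  rewrite ev_cst mulr1 card1 divr1 => <-.
  by rewrite -expr2 mulrC; congr (_ * _); apply: eq_ev => x; rewrite r1 mulr1 expr2.
rewrite evZ// -[RHS](mulr0 (c j * c i)); congr (_ * _).
rewrite -[RHS](@ev_ratio1 _ _ _ P _ xi g (pred1 j) (c0 j) (fun x => x i ^+ 2 - 1)) //.
  by apply: eq_ev => x; rewrite r1.
by move=> k /eqP -> x t; rewrite /upd (negbTE ij).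
Qed.

(** The pointwise inequality [2 * |u| <= u ^+ 2 / t + t] replaces Cauchy-Schwarz; the free [t] is
    chosen later to balance the two terms. *)
Lemma ev_abs_le F (t : R) : 0 < t -> mpg F -> intg P (fun w => `|F (xi^~ w)|) /\
  expect P xi (fun x => `|F x|) <= (expect P xi (fun x => F x ^+ 2) / t + t) / 2.
Proof.
move=> t0 mF; have i1 := intg_abs (mpg_intg g mF); split=> //.
have mF2 : mpg (fun x => t^-1 * F x ^+ 2 + t) by apply: mpgD; [apply: mpgM; [|exact: mpgX]|]; exact: mpg_cst.
apply: (@le_trans _ _ (expect P xi (fun x => 2^-1 * (t^-1 * F x ^+ 2 + t)))).
  have m2 : mpg (fun x => 2^-1 * (t^-1 * F x ^+ 2 + t)) by apply: mpgM => //; exact: mpg_cst.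
  apply: (Ex_le i1 (mpg_intg g m2)) => w.
  set u := F _; have := sqr_ge0 (`|u| - t); rewrite sqrrB real_normK ?num_real// -mulr_natr => H.
  have t2 : 0 < 2 * t by rewrite mulr_gt0.
  rewrite -(ler_pM2l t2) (_ : 2 * t * (2^-1 * (t^-1 * u ^+ 2 + t)) = u ^+ 2 + t ^+ 2); last by field; rewrite gt_eqF.
  move: H; set a := `|u|; set b := u ^+ 2; set e := t ^+ 2; clearbody a b e; lra.
rewrite evZ// evD//; [|by apply: mpgM; [exact: mpg_cst|exact: mpgX]|exact: mpg_cst].
by rewrite evZ//; [rewrite ev_cst mulrC (mulrC t^-1)|exact: mpgX].
Qed.

(** In [interpolation_le], [1 - V] is the defect of the variance minus the centered [V]. The latter
    is again a chaos, with coefficients [2 * c j ^+ 2] and second moment [8 * \sum_j c j ^+ 4]. *)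
Lemma chaos_clt (c : J -> R) (h h' h'' : R -> R) (t : R) : 0 < t ->
  (forall u : R, is_derive u 1 h (h' u)) -> (forall u : R, is_derive u 1 h' (h'' u)) ->
  continuous h'' -> (forall u, `|h u| <= 1) -> (forall u, `|h' u| <= 1) -> (forall u, `|h'' u| <= 1) ->
  `|expect P xi (fun x => h (chaos c x)) - \int[gam]_z h z| <=
  2 * `|1 - 2 * \sum_j c j ^+ 2| + 8 * (\sum_j c j ^+ 4) / t + t.
Proof.
move=> t0 dh dh' ch'' b0 b1 b2.
have ge := gfam_extend g.
have ch : continuous h.
  by move=> u; apply: differentiable_continuous; apply/derivable1_diffP; case: (dh u).
have gs : gfam (P \x gam)%E (fun j => extend_gauss xi (Some j)).
  by apply: (gfam_sub (f := @Some J)) ge => i j [].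
have mch : measurable_fun [set: rvT R J] (fun x => h (chaos c x)).
  by apply: measurableT_comp; [exact: continuous_measurable_fun|exact: (mpg_chaos c).1].
have -> : expect P xi (fun x => h (chaos c x)) =
    expect (P \x gam)%E (extend_gauss xi) (fun x => h (\sum_j c j * (x (Some j) ^+ 2 - 1))).
  exact: (gfam_Ex g gs mch).
have -> : \int[gam]_z h z = expect (P \x gam)%E (extend_gauss xi) (fun x => h (x None)).
  by rewrite /expect -(gfam_coordE ge None)//; exact: continuous_measurable_fun.
apply: (le_trans (interpolation_le ge c dh dh' ch'' b0 b1 b2)).
have -> : expect (P \x gam)%E (extend_gauss xi) (fun x => `|1 - \sum_j 2 * c j ^+ 2 * x (Some j) ^+ 2|) =
   expect P xi (fun x => `|1 - \sum_j 2 * c j ^+ 2 * x j ^+ 2|).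
  have mV : measurable_fun [set: rvT R J] (fun x => `|1 - \sum_j 2 * c j ^+ 2 * x j ^+ 2|).
    apply: measurableT_comp => //; apply: measurable_funB => //; apply: measurable_sum => j.
    by apply: measurable_funM => //; apply: measurable_funX; exact: measurable_coord.
  exact: (esym (gfam_Ex g gs mV)).
pose s := 1 - 2 * \sum_j c j ^+ 2.
pose Y (x : J -> R) := \sum_j (2 * c j ^+ 2) * (x j ^+ 2 - 1).
have mY : mpg Y.
  apply: mpg_sum => j; apply: mpgM; first exact: mpg_cst.
  by apply: mpgB; [apply/mpgX/mpg_coord|exact: mpg_cst].
have VE x : 1 - \sum_j 2 * c j ^+ 2 * x j ^+ 2 = s - Y x.
  rewrite /s /Y; under [X in _ = _ - X]eq_bigr do rewrite mulrBr mulr1.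
  by rewrite sumrB -mulr_sumr; ring.
have [iY Yle] := ev_abs_le t0 mY.
have i2 : intg P (fun w => `|s| + `|Y (xi^~ w)|) by apply: intgD => //; exact: intg_cst.
have iV : intg P (fun w => `|1 - \sum_j 2 * c j ^+ 2 * xi j w ^+ 2|).
  apply: intg_abs; apply: (mpg_intg g (F := fun x => 1 - \sum_j 2 * c j ^+ 2 * x j ^+ 2)).
  apply: mpgB; first exact: mpg_cst.
  by apply: mpg_sum => j; apply: mpgM; [exact: mpg_cst|apply/mpgX/mpg_coord].
have H1 : expect P xi (fun x => `|1 - \sum_j 2 * c j ^+ 2 * x j ^+ 2|) <= `|s| + expect P xi (fun x => `|Y x|).
  apply: (@le_trans _ _ (\int[P]_w (`|s| + `|Y (xi^~ w)|))).
    by apply: (Ex_le iV i2) => w; rewrite (VE (xi^~ w)) ler_normB.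
  by rewrite ExD ?Ex_cst//; exact: intg_cst.
have -> : 8 * (\sum_j c j ^+ 4) = expect P xi (fun x => Y x ^+ 2).
  rewrite (@ev_sqr_chaos (fun j => 2 * c j ^+ 2)) !mulr_sumr; apply: eq_bigr => j _.
  by rewrite exprMn -exprM; ring.
rewrite -/s; set A := expect _ _ _ in H1 *; set B := expect _ _ _ in H1 Yle *; set C := expect _ _ _ in Yle *.
have : 2 * A <= 2 * `|s| + 2 * B by rewrite -mulrDr ler_pM2l.
have : 2 * B <= C / t + t by move: Yle; lra.
lra.
Qed.

End chaos_clt.

(** * From smooth test functions to distribution functions *)

Section logistic.
Context (R : realType).
Implicit Types u v w x K : R.

(** The decreasing logistic function: its derivatives are polynomials in itself, hence bounded, and
    it approaches its limits 1 and 0 exponentially fast. *)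
Definition logi u : R := (1 + expR u)^-1.

Lemma logi_gt0 u : 0 < logi u.
Proof. by rewrite invr_gt0 addr_gt0// expR_gt0. Qed.

Lemma logi_lt1 u : logi u < 1.
Proof. by rewrite invf_lt1 ?addr_gt0 ?expR_gt0// ltrDl expR_gt0. Qed.

Lemma logi_le_exp u : logi u <= expR (- u).
Proof. by rewrite expRN lef_pV2 ?posrE ?expR_gt0 ?addr_gt0 ?expR_gt0// lerDr. Qed.

Lemma logiC_le_exp u : 1 - logi u <= expR u.
Proof.
have e0 := expR_gt0 u; rewrite /logi lerBlDr -(@ler_pM2r _ (1 + expR u)) ?addr_gt0//.
rewrite mulrDl mulVf ?gt_eqF ?addr_gt0// mul1r; nra.
Qed.

Lemma is_derive_logi u : is_derive u 1 logi (- (logi u * (1 - logi u))).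
Proof.
have n0 : 1 + expR u != 0 by rewrite gt_eqF// addr_gt0// expR_gt0.
have d1 : is_derive u 1 (fun v : R => 1 + expR v) (expR u).
  have := is_deriveD (is_derive_cst (1 : R) u 1) (is_derive_expR u).
  by rewrite add0r.
have := @is_deriveV _ (fun v : R => 1 + expR v) u _ 1 n0 d1.
by move=> d2; apply: (is_derive_eq d2); rewrite /GRing.scale /= /logi; field.
Qed.

Lemma continuous_logi : continuous logi.
Proof. by move=> u; apply: differentiable_continuous; apply/derivable1_diffP; case: (is_derive_logi u). Qed.

Lemma measurable_logi : measurable_fun setT logi.
Proof. by apply: continuous_measurable_fun; exact: continuous_logi. Qed.

Let dlogi_le1 u : `|- (logi u * (1 - logi u))| <= 1.
Proof. have := logi_gt0 u; have := logi_lt1 u => h1 h0; rewrite ler_norml; apply/andP; split; nra. Qed.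

Lemma logi_lip u v : `|logi u - logi v| <= `|u - v|.
Proof.
wlog uv : u v / v < u => [H|].
  have [uv|uv|->] := ltgtP u v; last by rewrite !subrr.
    by rewrite distrC (distrC u); exact: H.
  exact: H.
have [c _ ->] := MVT uv (fun x _ => is_derive_logi x) (continuous_subspaceT continuous_logi).
by rewrite normrM ler_piMl.
Qed.

(* Smooth approximation, as [K] grows, of the indicator of [w <= x]. *)
Definition step K x w : R := logi (K * (w - x)).

Lemma step_lip K x w w' : 0 <= K -> `|step K x w - step K x w'| <= K * `|w - w'|.
Proof.
move=> K0; apply: (le_trans (logi_lip _ _)).
by rewrite -mulrBr (_ : w - x - (w' - x) = w - w'); [rewrite normrM ger0_norm|ring].
Qed.

Lemma step_ge K x w (e : R) : 0 <= K -> w <= x - e -> 1 - expR (- (K * e)) <= step K x w.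
Proof.
move=> K0 we; have := logiC_le_exp (K * (w - x)); rewrite -/(step K x w) => H.
suff : expR (K * (w - x)) <= expR (- (K * e)) by move: H; lra.
by rewrite ler_expR -mulrN ler_wpM2l//; lra.
Qed.

Lemma step_le K x w (e : R) : 0 <= K -> x + e <= w -> step K x w <= expR (- (K * e)).
Proof.
move=> K0 we; apply: (le_trans (logi_le_exp _)).
by rewrite ler_expR lerN2 ler_wpM2l//; lra.
Qed.

Lemma step_ge0 K x w : 0 <= step K x w. Proof. exact/ltW/logi_gt0. Qed.
Lemma step_le1 K x w : step K x w <= 1. Proof. exact/ltW/logi_lt1. Qed.

Lemma measurable_step K x : measurable_fun setT (step K x).
Proof.
apply: measurableT_comp; first exact: measurable_logi.
by apply: measurable_funM => //; exact: measurable_funB.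
Qed.

Section step_clt.
Context d (T : measurableType d) (P : probability T R).
Context (J : finType) (xi : J -> T -> R).
Hypothesis g : gfam P xi.
Notation gam := (@normal_prob R 0 1).

Lemma step_clt (c : J -> R) K x (t : R) : 0 < t -> 1 <= K ->
  `|expect P xi (fun z => step K x (chaos c z)) - \int[gam]_z step K x z| <=
  K ^+ 2 * (2 * `|1 - 2 * \sum_j c j ^+ 2| + 8 * (\sum_j c j ^+ 4) / t + t).
Proof.
move=> t0 K1; have K0 : 0 < K by lra.
have KK0 : 0 < K ^+ 2 by rewrite exprn_gt0.
pose a w := K * (w - x).
(* Two derivatives of the step cost [K ^+ 2]; after dividing by it, and since [K >= 1], [h], [h']
   and [h''] are all bounded by 1 as [chaos_clt] requires. *)
pose h w := (K ^+ 2)^-1 * logi (a w).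
pose h' w := - (K^-1 * (logi (a w) - logi (a w) ^+ 2)).
pose h'' w := logi (a w) * (1 - logi (a w)) * (1 - 2 * logi (a w)).
have da w : is_derive w 1 a K by apply: is_derive_eq; rewrite /GRing.scale /=; ring.
have dla w : is_derive w 1 (logi \o a) (- (logi (a w) * (1 - logi (a w))) * K).
  exact: (@is_derive1_comp _ logi a w _ _ (is_derive_logi _) (da w)).
have dh w : is_derive w 1 h (h' w).
  have := is_deriveZ (K ^+ 2)^-1 (dla w) => d2; apply: (is_derive_eq d2).
  by rewrite /h' /GRing.scale /=; field; rewrite gt_eqF.
have dh' w : is_derive w 1 h' (h'' w).
  have := is_deriveN (is_deriveZ K^-1 (is_deriveB (dla w) (is_deriveX 2 (dla w)))) => d2.
  by apply: (is_derive_eq d2); rewrite /h'' /GRing.scale /=; field; rewrite gt_eqF.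
have cla : continuous (logi \o a).
  by move=> w; apply: differentiable_continuous; apply/derivable1_diffP; case: (dla w).
have ch'' : continuous h''.
  move=> w; apply: cvgM; first apply: cvgM.
  - exact: cla.
  - by apply: cvgB; [exact: cvg_cst|exact: cla].
  - apply: cvgB; first exact: cvg_cst.
    by apply: cvgM; [exact: cvg_cst|exact: cla].
have Ki : 0 < K^-1 <= 1 by rewrite invr_gt0 K0 invf_le1.
have KKi : 0 < (K ^+ 2)^-1 <= 1 by rewrite invr_gt0 KK0 invf_le1// exprn_ege1.
have l01 w : 0 < logi (a w) < 1 by rewrite logi_gt0 logi_lt1.
have b0 w : `|h w| <= 1.
  rewrite /h; move: (l01 w) KKi => /andP[? ?] /andP[? ?].
  rewrite ger0_norm; last by rewrite mulr_ge0// ltW.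
  by rewrite -[leRHS]mulr1 ler_pM// ltW.
have b1 w : `|h' w| <= 1.
  rewrite /h' normrN normrM; move: (l01 w) Ki => /andP[? ?] /andP[? ?].
  rewrite -[leRHS]mulr1 ler_pM//; first by rewrite ger0_norm// ltW.
  by rewrite ler_norml; apply/andP; split; nra.
have b2 w : `|h'' w| <= 1.
  rewrite /h''; move: (l01 w) => /andP[]; set l := logi _ => l0 l1.
  rewrite normrM -[leRHS]mulr1 ler_pM// ler_norml; apply/andP; split; nra.
have H := chaos_clt g c t0 dh dh' ch'' b0 b1 b2.
have stepE w : step K x w = K ^+ 2 * h w by rewrite /h mulrA mulfV ?mul1r ?gt_eqF.
have mh : measurable_fun setT h.
  apply: measurable_funM => //; apply: continuous_measurable_fun; exact: cla.
have E1 : expect P xi (fun z => step K x (chaos c z)) = K ^+ 2 * expect P xi (fun z => h (chaos c z)).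
  have mp : mpg (fun z => h (chaos c z)).
    split; last exact: (@pg_bounded _ _ _ 1).
    by apply: measurableT_comp; [exact: mh|exact: (mpg_chaos c).1].
  by rewrite -evZ//; apply: eq_ev => z; exact: stepE.
have E2 : \int[gam]_z step K x z = K ^+ 2 * \int[gam]_z h z.
  rewrite -ExZ; last exact: (@intg_bound _ _ _ _ _ 1).
  by apply: eq_Rintegral => z _; exact: stepE.
by rewrite E1 E2 -mulrBr normrM ger0_norm ?(ltW KK0)// ler_pM2l.
Qed.

End step_clt.

Section cdf.
Notation gam := (@normal_prob R 0 1).

(** The normal density is at most its peak [1 / sqrt (2 * pi)], which is below 1. *)
Lemma std_normal_cdf_lip x x' : x <= x' -> std_normal_cdf x' <= std_normal_cdf x + (x' - x).
Proof.
move=> xx'; have m1 : measurable (`]-oo, x]%classic : set R) by exact: measurable_itv.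
have m2 : measurable (`]x, x']%classic : set R) by exact: measurable_itv.
have -> : std_normal_cdf x' = std_normal_cdf x + fine (gam `]x, x']%classic).
  rewrite /std_normal_cdf -fineD ?fin_num_measure// -measureU//.
    congr (fine (normal_prob _ _ _)); apply/seteqP; split => w /=; rewrite !in_itv/=.
      by move=> wx'; have [?|?] := leP w x; [left|right].
    by case=> [wx|/andP[]//]; exact: le_trans xx'.
  apply/seteqP; split => w //=; rewrite !in_itv/= => -[wx /andP[xw _]].
  by move: (lt_le_trans xw wx); rewrite ltxx.
rewrite lerD2l -lee_fin fineK ?fin_num_measure//.
have pk1 : normal_peak 1 <= 1 :> R.
  have pp : 1 <= pi *+ 2 :> R by have := @pi_ge2 R; rewrite -mulr_natr; lra.
  rewrite /normal_peak expr1n mul1r invf_le1 ?sqrtr_gt0 ?(lt_le_trans ltr01 pp)//.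
  by rewrite -[leLHS]sqrtr1 ler_sqrt// (le_trans ler01 pp).
apply: (@le_trans _ _ (\int[@lebesgue_measure R]_(w in `]x, x']) (normal_peak 1)%:E)%E).
  apply: ge0_le_integral => //.
  - by move=> w _; rewrite lee_fin normal_pdf_ge0.
  - by apply/measurable_EFinP; apply: measurable_funTS; exact: measurable_normal_pdf.
  - by move=> w _; rewrite lee_fin normal_pdf_ub// oner_neq0.
rewrite integral_cst//= lebesgue_measure_itv/= lte_fin.
move: xx'; rewrite le_eqVlt => /orP[/eqP ->|xx']; first by rewrite ltxx mule0 subrr.
rewrite xx' -EFinB -EFinM lee_fin; have : 0 < x' - x by lra.
nra.
Qed.

Lemma measurable_sublevel d (T : measurableType d) (Y : T -> R) y : measurable_fun setT Y ->
  measurable [set t | Y t <= y].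
Proof.
move=> mY; rewrite (_ : [set t | _] = Y @^-1` [set` `]-oo, y]]); last by apply/seteqP; split => t /=; rewrite in_itv.
by rewrite -[_ @^-1` _]setTI; apply: mY => //; exact: measurable_itv.
Qed.

Lemma cdf_step d (T : measurableType d) (Q : probability T R) (Y : T -> R) K x (e : R) :
  0 <= K -> 0 <= e -> measurable_fun setT Y ->
  fine (Q [set t | Y t <= x - e]) <= \int[Q]_t step K x (Y t) + expR (- (K * e)) /\
  \int[Q]_t step K x (Y t) <= fine (Q [set t | Y t <= x + e]) + expR (- (K * e)).
Proof.
move=> K0 e0 mY; set eta := expR _.
have eta0 : 0 <= eta by exact: expR_ge0.
have mA (y : R) := measurable_sublevel y mY.
have mi (y : R) : measurable_fun setT (\1_[set t | Y t <= y] : T -> R) by exact: measurable_indic.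
have ii (y : R) : intg Q (\1_[set t | Y t <= y] : T -> R).
  by apply: (@intg_bound _ _ _ _ _ 1) => // t; have [? ?] := indic01 R [set t | Y t <= y] t; rewrite ger0_norm.
have is' : intg Q (fun t => step K x (Y t)).
  apply: (@intg_bound _ _ _ _ _ 1); first by apply: measurableT_comp => //; exact: measurable_step.
  by move=> t; rewrite ger0_norm ?step_ge0// step_le1.
have iE (y : R) t : (\1_[set t | Y t <= y] t : R) = ((Y t <= y)%R)%:R.
  rewrite indicE; case: (boolP (Y t <= y)) => h; first by rewrite mem_set.
  by rewrite memNset//=; exact/negP.
split.
  rewrite -(Ex_indic Q (mA _)) -(Ex_cst Q eta) -ExD//; last exact: intg_cst.
  apply: Ex_le => //; first by apply: intgD => //; exact: intg_cst.
  move=> t; rewrite iE; case: (leP (Y t) (x - e)) => h /=; last by rewrite mulr0n; apply: addr_ge0 => //; exact: step_ge0.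
  by have := step_ge K0 h; rewrite mulr1n -/eta lerBlDr.
rewrite -(Ex_indic Q (mA _)) -(Ex_cst Q eta) -ExD//; last exact: intg_cst.
apply: Ex_le => //; first by apply: intgD => //; exact: intg_cst.
move=> t; rewrite iE; case: (leP (Y t) (x + e)) => h /=; first by rewrite mulr1n (le_trans (step_le1 _ _ _))// lerDl.
by rewrite mulr0n add0r step_le// ltW.
Qed.

(** For the upper bound: pass from the event to the step at [x + e], from [Y] to the normal law at
    cost [r], then to the normal cdf at [x + 2 * e], and back to [x] by the Lipschitz bound. Each
    passage between step and cdf costs [expR (- (K * e))]. The lower bound uses the step at
    [x - e]. *)
Lemma cdf_close d (T : measurableType d) (Q : probability T R) (Y : T -> R) x (e K r : R) :
  0 <= K -> 0 <= e -> measurable_fun setT Y ->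
  (forall z, `|\int[Q]_t step K z (Y t) - \int[gam]_w step K z w| <= r) ->
  `|fine (Q [set t | Y t <= x]) - std_normal_cdf x| <= r + 2 * e + 2 * expR (- (K * e)).
Proof.
move=> K0 e0 mY H.
have cdfE (z : R) : std_normal_cdf z = fine (gam [set w | w <= z]).
  by congr (fine (normal_prob _ _ _)); apply/seteqP; split => w /=; rewrite in_itv.
have [u1 _] := cdf_step Q (x + e) K0 e0 mY.
have [_ u2] := cdf_step Q (x - e) K0 e0 mY.
have mid : measurable_fun setT (fun w : R => w) by exact: measurable_id.
have [_ v1] := @cdf_step _ _ gam (fun w => w) K (x + e) e K0 e0 mid.
have [v2 _] := @cdf_step _ _ gam (fun w => w) K (x - e) e K0 e0 mid.
rewrite addrK in u1; rewrite subrK in u2.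
have l1 : x <= x + e + e by rewrite -addrA lerDl addr_ge0.
have l2 : x - e - e <= x by rewrite -addrA gerDl -opprD oppr_le0 addr_ge0.
have := std_normal_cdf_lip l1; have := std_normal_cdf_lip l2.
rewrite (cdfE (x + e + e)) (cdfE (x - e - e)).
have := H (x + e); have := H (x - e); rewrite !ler_norml => /andP[h1 h2] /andP[h3 h4] k1 k2.
move: u1 u2 v1 v2 h1 h2 h3 h4 k1 k2; clear.
set a1 := fine _; set a2 := Rintegral _ _ _; set a3 := expR _; set a4 := Rintegral _ _ _.
set a5 := fine _; set a6 := fine _; set a7 := Rintegral _ _ _; set a8 := Rintegral _ _ _; set a9 := std_normal_cdf x.
by clearbody a1 a2 a3 a4 a5 a6 a7 a8 a9; move=> *; apply/andP; split; lra.
Qed.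

End cdf.

End logistic.

(** * Reduction to a centered Gaussian matrix *)

Section centering.
Context (R : realType).

(* The first column of [Q] is constant, so that it carries the sample mean. *)
Lemma centering_rotation m : exists2 Q : 'M[R]_m.+1, Q *m Q^T = 1%:M &
  (forall l, l != ord0 -> \sum_i Q i l = 0) /\ exists c, forall i, Q i ord0 = c.
Proof.
pose u : 'rV[R]_m.+1 := const_mx 1.
have [Q ort Qu] := householder u; exists Q => //.
have uQ l : (u *m Q) ord0 l = \sum_i Q i l.
  by rewrite mxE; apply: eq_bigr => i _; rewrite mxE mul1r.
split=> [l l0|]; first by rewrite -uQ Qu.
pose a := (u *m Q) ord0 ord0; exists a^-1 => i.
(* Row of ones: [u = (u *m Q) *m Q^T], and [u *m Q] has only its first entry nonzero, so every
   [Q i ord0] is the inverse of that entry. *)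
have E : a * Q i ord0 = 1.
  have := congr1 (fun M : 'rV[R]_m.+1 => M ord0 i) (mulmx1 u).
  rewrite -ort mulmxA mxE (bigD1 ord0)//= big1 => [|l l0]; last by rewrite Qu// mul0r.
  by rewrite addr0 [RHS]mxE [_^T _ _]mxE.
have a0 : a != 0 by apply/eqP => a0; move: E; rewrite a0 mul0r => /esym/eqP; rewrite oner_eq0.
by apply: (mulfI a0); rewrite E mulfV.
Qed.

(** Subtracting row means annihilates the first column of [y *m Q], proportional to these means, and
    leaves the others unchanged since their coefficients sum to 0. The rotation preserves the Gram
    matrix. *)
Lemma centered_gram m p (Q : 'M[R]_m.+1) (y : 'M[R]_(p, m.+1)) : Q *m Q^T = 1%:M ->
  (forall l, l != ord0 -> \sum_i Q i l = 0) -> (exists c, forall i, Q i ord0 = c) ->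
  let ybar j := (m.+1%:R)^-1 * \sum_i y j i in
  forall j j', \sum_i (y j i - ybar j) * (y j' i - ybar j') =
    \sum_(l < m) (y *m Q) j (lift ord0 l) * (y *m Q) j' (lift ord0 l).
Proof.
move=> ort Q0 [c Qc] ybar j j'.
pose C : 'M[R]_(p, m.+1) := \matrix_(j, i) (y j i - ybar j).
have CQ0 k : (C *m Q) k ord0 = 0.
  rewrite mxE; under eq_bigr do rewrite Qc mxE.
  rewrite -mulr_suml sumrB sumr_const card_ord -mulr_natl /ybar mulrA mulfV ?pnatr_eq0//.
  by rewrite mul1r subrr mul0r.
have CQl k l : (C *m Q) k (lift ord0 l) = (y *m Q) k (lift ord0 l).
  rewrite !mxE; under eq_bigr do rewrite mxE mulrBl.
  by rewrite sumrB -mulr_sumr Q0// mulr0 subr0.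
transitivity ((C *m C^T) j j').
  by rewrite mxE; apply: eq_bigr => i _; rewrite !mxE.
have -> : C *m C^T = (C *m Q) *m (C *m Q)^T by rewrite trmx_mul mulmxA -(mulmxA C) ort mulmx1.
rewrite mxE big_ord_recl CQ0 mul0r add0r; apply: eq_bigr => l _.
by rewrite [X in _ * X]mxE !CQl.
Qed.

Context d (T : measurableType d) (P : probability T R).

(** Standardizing and centering remove [mu]; the scale [lam / n] multiplies the determinant by its
    [p]-th power and the trace factor by the inverse power, so it cancels as well. *)
Lemma sphericity_stat_gram m p (X : 'I_m.+1 -> T -> 'cV[R]_p) (mu : 'cV[R]_p) (lam : R) : 0 < lam ->
  (forall i j, measurable_fun setT (fun t => X i t j ord0)) ->
  mutually_independent_vectors P X -> (forall i, mvnormal P (X i) mu lam%:M) ->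
  exists2 xi : 'I_p * 'I_m -> T -> R, gfam P xi &
    forall t, sphericity_stat (X^~ t) = gram_det (xi^~ t) * (sumsq (xi^~ t) / p%:R) ^- p.
Proof.
move=> l0 mX ind N; have g := data_gfam l0 mX ind N.
have [Q ort [Q0 Qc]] := centering_rotation m.
pose y t : 'M[R]_(p, m.+1) := \matrix_(j, i) ((X i t j ord0 - mu j ord0) / Num.sqrt lam).
(* The identity on rows tensored with [Q] deprived of its first column: orthonormal columns, so the
   family stays Gaussian. *)
pose L (k : 'I_p * 'I_m.+1) (k' : 'I_p * 'I_m) : R := (k.1 == k'.1)%:R * Q k.2 (lift ord0 k'.2).
have ort' : Q^T *m Q = 1%:M by apply: mulmx1C.
have LL k k' : \sum_i L i k * L i k' = (k == k')%:R.
  case: k k' => [j l] [j' l'].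
  rewrite (eq_bigr (fun i => L (i.1, i.2) (j, l) * L (i.1, i.2) (j', l'))) => [|[]//].
  rewrite -(pair_bigA _ (fun a b => L (a, b) (j, l) * L (a, b) (j', l'))) /= /L /=.
  rewrite (bigD1 j)//= [X in _ + X]big1 ?addr0 => [|a /negbTE aj]; last by rewrite big1// => b _; rewrite aj !mul0r.
  rewrite eqxx xpair_eqE; under eq_bigr do rewrite mul1r mulrCA.
  rewrite -mulr_sumr -mulnb natrM; congr (_ * _).
  transitivity ((Q^T *m Q) (lift ord0 l) (lift ord0 l')).
    by rewrite mxE; apply: eq_bigr => i _; rewrite mxE.
  by rewrite ort' mxE (inj_eq (@lift_inj _ ord0)).
exists (fun k t => (y t *m Q) k.1 (lift ord0 k.2)).
  have := gfam_isometry LL g; congr gfam; apply/funext => -[j l]; apply/funext => t.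
  rewrite mxE /=.
  rewrite (eq_bigr (fun i => L (i.1, i.2) (j, l) * ((X i.2 t i.1 ord0 - mu i.1 ord0) / Num.sqrt lam))) => [|[]//].
  rewrite -(pair_bigA _ (fun a b => L (a, b) (j, l) * ((X b t a ord0 - mu a ord0) / Num.sqrt lam))) /= /L /=.
  rewrite (bigD1 j)//= [X in _ + X]big1 ?addr0 => [|a /negbTE aj]; last by rewrite big1// => b _; rewrite aj !mul0r.
  by apply: eq_bigr => i _; rewrite eqxx mul1r mulrC mxE.
move=> t; set xi := fun x : 'I_p * 'I_m => (y t *m Q) x.1 (lift ord0 x.2).
have s0 : Num.sqrt lam != 0 by rewrite gt_eqF// sqrtr_gt0.
have ss : Num.sqrt lam ^+ 2 = lam by rewrite sqr_sqrtr// ltW.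
pose G := rows_mx xi *m (rows_mx xi)^T.
have SE : sample_cov (X^~ t) = (lam / m.+1%:R) *: G.
  apply/matrixP => j j'; rewrite [LHS]mxE [RHS]mxE [lam / _]mulrC -mulrA summxE; congr (_ * _).
  transitivity (lam * \sum_(l < m) (y t *m Q) j (lift ord0 l) * (y t *m Q) j' (lift ord0 l)); last first.
    by congr (_ * _); rewrite [RHS]mxE; apply: eq_bigr => l _; rewrite [_^T _ _]mxE ![rows_mx _ _ _]mxE.
  rewrite -(@centered_gram m p Q (y t) ort Q0 Qc) mulr_sumr; apply: eq_bigr => i _.
  have bar k : sample_mean (X^~ t) k ord0 = mu k ord0 + Num.sqrt lam * ((m.+1%:R)^-1 * \sum_i y t k i).
    have -> : \sum_i y t k i = (\sum_i X i t k ord0 - m.+1%:R * mu k ord0) / Num.sqrt lam.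
      under eq_bigr do rewrite mxE.
      by rewrite -mulr_suml sumrB sumr_const card_ord mulr_natl.
    have N0 : m.+1%:R != 0 :> R by rewrite pnatr_eq0.
    rewrite !mxE summxE; set c : R := m.+1%:R in N0 *; clearbody c; field.
    by rewrite s0 N0.
  have dev k : (X i t - sample_mean (X^~ t)) k ord0 = Num.sqrt lam * (y t k i - (m.+1%:R)^-1 * \sum_i y t k i).
    rewrite mxE [X in _ + X]mxE; have -> : X i t k ord0 = mu k ord0 + Num.sqrt lam * y t k i by rewrite mxE mulrC divfK// subrKC.
    by rewrite bar opprD addrACA subrr add0r -mulrBr.
  by rewrite mxE big_ord1 [_^T _ _]mxE !dev mulrACA -expr2 ss.
have e0 : lam / m.+1%:R != 0 :> R by rewrite mulf_neq0 ?invr_eq0 ?pnatr_eq0// gt_eqF.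
have trG : \tr G = sumsq xi.
  by rewrite /mxtrace; apply: eq_bigr => j _; rewrite mxE; apply: eq_bigr => l _; rewrite [_^T _ _]mxE ![rows_mx _ _ _]mxE expr2.
rewrite /sphericity_stat SE detZ mxtraceZ trG; set u := lam / _ in e0 *.
rewrite -[u * sumsq xi / _]mulrA [(u * _) ^+ p]exprMn invfM mulrACA.
by rewrite mulfV ?expf_neq0// mul1r.
Qed.

End centering.

(** * Sums over the degrees of freedom *)

Section log_sums.
Context (R : realType).

Lemma le_telescope (f F : nat -> R) p : (forall k, f k <= F k - F k.+1) ->
  \sum_(k < p) f k <= F 0%N - F p.
Proof.
move=> H; elim: p => [|p IH]; first by rewrite big_ord0 subrr.
by rewrite big_ord_recr /=; have := H p; move: IH; lra.
Qed.

Variable q : nat.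
Hypothesis q0 : (0 < q)%N.
Notation D k := ((q + k.+1)%:R : R).
Let D' k : R := (q + k)%:R.

Let D'0 k : 0 < D' k. Proof. by rewrite /D' ltr0n addn_gt0 q0. Qed.
Let D0 k : 0 < D k. Proof. exact: D'0. Qed.
Let DE k : D k = D' k + 1. Proof. by rewrite /D' addnS -natr1. Qed.
Let DS k : D' k.+1 = D' k + 1. Proof. exact: DE. Qed.
Let D1 k : 1 <= D' k. Proof. by rewrite /D' (ler_nat _ 1) addn_gt0 q0. Qed.

Lemma sum_inv_sqr p : \sum_(k < p) (D k)^-1 ^+ 2 <= q%:R^-1.
Proof.
apply: (@le_trans _ _ ((D' 0)^-1 - (D' p)^-1)); last first.
  by rewrite /D' addn0 gerBl invr_ge0.
apply: (@le_telescope (fun k => (D k)^-1 ^+ 2) (fun k => (D' k)^-1)) => k.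
have -> : (D' k)^-1 - (D' k.+1)^-1 = (D' k)^-1 * (D k)^-1.
  rewrite DS DE; move: (D' k) (D'0 k) => a a0; field.
  by rewrite !gt_eqF ?addr_gt0.
rewrite expr2 ler_pM2r ?invr_gt0// lef_pV2 ?posrE// DE lerDl//.
Qed.

Lemma sum_inv_cube p : \sum_(k < p) (D k)^-1 ^+ 3 <= q%:R^-1 ^+ 2.
Proof.
rewrite expr2; apply: (@le_trans _ _ (q%:R^-1 * \sum_(k < p) (D k)^-1 ^+ 2)).
  rewrite mulr_sumr; apply: ler_sum => k _; rewrite exprS ler_pM2r ?exprn_gt0 ?invr_gt0//.
  rewrite lef_pV2 ?posrE ?ltr0n//; last by rewrite addn_gt0 q0.
  by rewrite ler_nat leq_addr.
by rewrite ler_wpM2l ?invr_ge0// sum_inv_sqr.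
Qed.

(** With [a] and [b] the square roots of consecutive degrees of freedom,
    [2 / a - 2 / b = 2 / (a * b * (a + b))], which is at least [1 / b ^+ 3] because [a <= b]; then
    telescope. *)
Lemma sum_inv_three_halves p : \sum_(k < p) (D k * Num.sqrt (D k))^-1 <= 2 * (Num.sqrt q%:R)^-1.
Proof.
apply: (@le_trans _ _ (2 * (Num.sqrt (D' 0))^-1 - 2 * (Num.sqrt (D' p))^-1)); last first.
  by rewrite /D' addn0 gerBl mulr_ge0// invr_ge0 sqrtr_ge0.
apply: (@le_telescope (fun k => (D k * Num.sqrt (D k))^-1) (fun k => 2 * (Num.sqrt (D' k))^-1)) => k.
rewrite -/(D' k.+1); set a := Num.sqrt (D' k); set b := Num.sqrt (D' k.+1).
have a0 : 0 < a by rewrite sqrtr_gt0.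
have b0 : 0 < b by rewrite sqrtr_gt0.
have aa : a ^+ 2 = D' k by rewrite sqr_sqrtr// ltW.
have bb : b ^+ 2 = D' k.+1 by rewrite sqr_sqrtr// ltW.
have ba : (b - a) * (b + a) = 1 by rewrite -subr_sqr bb aa DS; ring.
have ab : a <= b by rewrite ler_sqrt ?(ltW (D'0 _))// DS lerDl.
have -> : 2 * a^-1 - 2 * b^-1 = 2 / (a * b * (b + a)).
  have -> : 2 * a^-1 - 2 * b^-1 = 2 * (b - a) / (a * b) by field; rewrite !gt_eqF.
  rewrite -[b - a]mulr1 -[X in _ * (_ * X)](@mulfV _ (b + a)); last by rewrite gt_eqF// addr_gt0.
  by rewrite (mulrA (b - a)) ba; field; rewrite !gt_eqF// addr_gt0.
rewrite -bb -div1r ler_pdivrMr; last by rewrite mulr_gt0// exprn_gt0.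
rewrite mulrAC ler_pdivlMr; last by rewrite !mulr_gt0// addr_gt0.
rewrite mul1r expr2.
have h1 : a * b <= b * b by rewrite ler_pM2r.
have h2 : b + a <= 2 * b by lra.
have h3 : 0 <= b + a by lra.
have h4 : 0 <= a * b by rewrite mulr_ge0// ltW.
by have := ler_pM h4 h3 h1 h2; lra.
Qed.

Lemma ln_sub_bounds k : (D k)^-1 <= ln (D k) - ln (D' k) /\ ln (D k) - ln (D' k) <= (D' k)^-1.
Proof.
rewrite -ln_div ?posrE//; split; last first.
  have -> : D k / D' k = 1 + (D' k)^-1 by rewrite DE mulrDl mul1r mulfV ?gt_eqF.
  by apply: le_ln1Dx; rewrite (lt_trans (ltrN10 _))// invr_gt0.
rewrite -[leRHS]opprK -lnV ?posrE ?divr_gt0// lerNr.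
have -> : (D k / D' k)^-1 = 1 + - (D k)^-1.
  rewrite DE; move: (D' k) (D'0 k) => a a0; field.
  by rewrite !gt_eqF ?addr_gt0.
by apply: le_ln1Dx; rewrite ltrN2 invf_lt1// DE ltrDr.
Qed.

Lemma sum_inv_ln p : `|\sum_(k < p) (D k)^-1 - (ln (q + p)%:R - ln q%:R)| <= q%:R^-1.
Proof.
have h1 : \sum_(k < p) (D k)^-1 <= (- ln (D' 0)) - (- ln (D' p)).
  apply: (@le_telescope (fun k => (D k)^-1) (fun k => - ln (D' k))) => k.
  by have [] := ln_sub_bounds k; rewrite -/(D' k.+1); lra.
have h2 : \sum_(k < p) (- (D k)^-1) <= (ln (D' 0) + (D' 0)^-1) - (ln (D' p) + (D' p)^-1).
  apply: (@le_telescope (fun k => - (D k)^-1) (fun k => ln (D' k) + (D' k)^-1)) => k.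
  by have [] := ln_sub_bounds k; rewrite -/(D' k.+1); lra.
have p0 : 0 < (D' p)^-1 by rewrite invr_gt0.
move: h1 h2; rewrite sumrN /D' addn0 => h1 h2.
rewrite /D' in p0; have q0' : 0 < q%:R^-1 :> R by rewrite invr_gt0 ltr0n.
by rewrite ler_norml; apply/andP; split; lra.
Qed.

(** Stirling's main term for a sum of logarithms is [(x + 1 / 2) * ln x - x]; the sum of the
    inverses takes off one [ln x]. *)
Let gs (x : R) := (x - 1 / 2) * ln x - x.

(** With [u = 1 / x], expanding [ln (1 - u)] to second order cancels everything down to order [u].
    What is left is [3 / 4 * u ^+ 2] minus [(x - 3 / 2)] times a remainder between 0 and
    [3 * u ^+ 3]. *)
Lemma stirling_step k : `|ln (D k) - (D k)^-1 - (gs (D k) - gs (D' k))| <= 4 * (D k)^-1 ^+ 2.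
Proof.
set x := D k; set u := x^-1.
have x0 : 0 < x by exact: D0.
have u0 : 0 < u by rewrite invr_gt0.
have x2 : 2 <= x by rewrite /x DE; have := D1 k; lra.
have ux : u * x = 1 by rewrite mulVf// gt_eqF.
have u12 : u <= 1 / 2 by rewrite div1r lef_pV2 ?posrE.
have r0 : 0 < 1 - u by lra.
have lnD' : ln (D' k) = ln x + ln (1 - u).
  rewrite -lnM ?posrE//; congr ln; rewrite mulrBr mulr1 mulrC ux /x DE; ring.
have [c [c0 c1 c2 cE]] := lnrem_mvt r0.
have c3 : c^-1 <= 3.
  apply: (le_trans c2); suff : (1 - u)^-1 <= 2 by lra.
  by rewrite -[leRHS]invrK lef_pV2 ?posrE ?invr_gt0//; lra.
have ci : 0 < c^-1 by rewrite invr_gt0.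
pose rho := (c - 1) ^+ 2 / c * u.
have lnE : ln (1 - u) = - u - u ^+ 2 / 2 - rho.
  move: cE; rewrite /lnrem pos01E// mulr1 /rho => E; lra.
have rho0 : 0 <= rho by rewrite /rho mulr_ge0 ?(ltW u0)// mulr_ge0 ?sqr_ge0// ltW.
have rho3 : rho <= 3 * u ^+ 3.
  rewrite /rho (_ : 3 * u ^+ 3 = u ^+ 2 * 3 * u); last by ring.
  rewrite ler_pM2r// ler_pM ?sqr_ge0 ?(ltW ci)//.
  by rewrite (le_trans c1)// (_ : 1 - u - 1 = - u) ?sqrrN//; ring.
have D'E : D' k = x - 1 by rewrite /x DE; ring.
have -> : ln x - u - (gs x - gs (D' k)) = 3 / 4 * u ^+ 2 - (x - 3 / 2) * rho.
  rewrite /gs lnD' D'E lnE.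
  have -> : 3 / 4 * u ^+ 2 - (x - 3 / 2) * rho =
    1 - u + (x - 3 / 2) * (- u - u ^+ 2 / 2 - rho) + (u * x - 1) * (1 + u / 2) by field.
  by rewrite ux subrr mul0r addr0; field.
have xr : x * rho <= 3 * u ^+ 2.
  have := ler_wpM2l (ltW x0) rho3; rewrite (_ : x * (3 * u ^+ 3) = 3 * u ^+ 2 * (u * x)); last by ring.
  by rewrite ux mulr1.
have h1 : 0 <= (x - 3 / 2) * rho by rewrite mulr_ge0//; lra.
have h2 : (x - 3 / 2) * rho <= 3 * u ^+ 2 by lra.
have h3 : 0 <= u ^+ 2 by exact: sqr_ge0.
by rewrite ler_norml; apply/andP; split; lra.
Qed.

Lemma sum_ln_stirling p :
  `|\sum_(k < p) (ln (D k) - (D k)^-1) -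
    (((q + p)%:R - 1 / 2) * ln (q + p)%:R - (q%:R - 1 / 2) * ln q%:R - p%:R)| <= 4 * q%:R^-1.
Proof.
have -> : ((q + p)%:R - 1 / 2) * ln (q + p)%:R - (q%:R - 1 / 2) * ln q%:R - p%:R =
   \sum_(k < p) (gs (D k) - gs (D' k)).
  elim: p => [|p IH]; first by rewrite big_ord0 addn0 subr0 subrr.
  rewrite big_ord_recr /= -IH /gs /D' addnS -!natr1 natrD; ring.
rewrite -sumrB; apply: (le_trans (ler_norm_sum _ _ _)).
apply: (@le_trans _ _ (\sum_(k < p) 4 * (D k)^-1 ^+ 2)).
  by apply: ler_sum => k _; exact: stirling_step.
by rewrite -mulr_sumr ler_pM2l// sum_inv_sqr.
Qed.

End log_sums.

(** * Second-order expansion of the logarithm of the statistic *)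

Section deviation.
Context (R : realType) d (T : measurableType d) (P : probability T R).
Context (I : finType) (xi : I -> T -> R).
Hypothesis g : gfam P xi.
Variable a : pred I.
Hypothesis a0 : (0 < #|a|)%N.
Notation ev := (expect P xi).
Notation D := (#|a|%:R : R).
Let D0 : D != 0. Proof. by rewrite pnatr_eq0 -lt0n. Qed.

Lemma chisq_upd_out (i : I) (x : I -> R) (t : R) : ~~ a i -> chisq a (upd x i t) = chisq a x.
Proof.
move=> ai; apply: eq_bigr => j aj; rewrite /upd.
by case: eqP => // ji; rewrite -ji aj in ai.
Qed.

(** The second-order term of [ln] up to sign, centered: [(#|a|%:R)^-1] is the mean of
    [(ratio - 1) ^+ 2 / 2]. *)
Definition sqdev (x : I -> R) : R := (ratio a x - 1) ^+ 2 / 2 - (#|a|%:R)^-1.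

Let mpr : mpg (fun x : I -> R => ratio a x - 1).
Proof. by apply: mpgB; [exact: mpg_ratio|exact: mpg_cst]. Qed.

Lemma mpg_sqdev : mpg sqdev.
Proof. by apply: mpgB; [apply: mpgM; [exact: mpgX|]|]; exact: mpg_cst. Qed.

Lemma ev_sqdev_mul (G : (I -> R) -> R) : mpg G -> (forall i, a i -> forall x t, G (upd x i t) = G x) ->
  ev (fun x => sqdev x * G x) = 0.
Proof.
move=> mG GE.
transitivity (ev (fun x => 2^-1 * ((ratio a x - 1) ^+ 2 * G x) - D^-1 * G x)).
  by apply: eq_ev => x; rewrite /sqdev; ring.
have m1 : mpg (fun x : I -> R => (ratio a x - 1) ^+ 2 * G x) by apply: mpgM => //; exact: mpgX.
rewrite (evB g); [|by apply: mpgM => //; exact: mpg_cst..].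
by rewrite !(evZ g)// (ev_ratio2 g a0 mG GE); field.
Qed.

Lemma ev_sqdev_sqr : ev (fun x => sqdev x ^+ 2) = 2 / D ^+ 2 + 12 / D ^+ 3.
Proof.
transitivity (ev (fun x => (4^-1 * (ratio a x - 1) ^+ 4 - D^-1 * ((ratio a x - 1) ^+ 2 * 1)) + D^-1 ^+ 2)).
  by apply: eq_ev => x; rewrite /sqdev; field.
have m4 : mpg (fun x : I -> R => (ratio a x - 1) ^+ 4) by exact: mpgX.
have m1 : mpg (fun _ : I -> R => 1) by exact: mpg_cst.
have m2 : mpg (fun x : I -> R => (ratio a x - 1) ^+ 2 * 1) by apply: mpgM => //; exact: mpgX.
have z4 : mpg (fun x : I -> R => 4^-1 * (ratio a x - 1) ^+ 4) by apply: mpgM => //; exact: mpg_cst.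
have z2 : mpg (fun x : I -> R => D^-1 * ((ratio a x - 1) ^+ 2 * 1)) by apply: mpgM => //; exact: mpg_cst.
rewrite (evD g); [|exact: mpgB|exact: mpg_cst].
have E2 := ev_ratio2 g a0 m1 (fun _ _ _ _ => erefl); rewrite ev_cst mulr1 in E2.
rewrite (evB g)// (evZ g _ m4) (evZ g _ m2) ev_cst (ev_ratio4 g a0) E2.
by field.
Qed.

End deviation.

Section decomposition.
Context (R : realType) d (T : measurableType d) (P : probability T R).
(* [m = q + p] stands for [n - 1]; the degrees of freedom are [q + 1], ..., [q + p]. *)
Variables (p q : nat).
Hypotheses (p0 : (0 < p)%N) (q0 : (0 < q)%N).
Notation m := (q + p)%N.
Notation I := ('I_p * 'I_m)%type.
Variable xi : I -> T -> R.
Hypothesis g : gfam P xi.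
Notation ev := (expect P xi).
Notation D k := ((q + k.+1)%:R : R).
Notation M := (m%:R : R).

Definition tail (k : 'I_p) : pred I := fun i => (i.1 == k) && (p.-1 - k <= i.2)%N.

Lemma tail_card k : #|tail k| = (q + k.+1)%N.
Proof.
rewrite -sum1_card; transitivity (\sum_(i < p | i == k) \sum_(l < m | (p.-1 - i <= l)%N) 1)%N.
  rewrite pair_big_dep /=; apply: eq_bigl => -[i l]; rewrite /tail /=.
  by rewrite unfold_in /=; case: eqP => // ->.
rewrite big_pred1_eq -(big_geq_mkord _ _ xpredT (fun=> 1%N)) sum_nat_const_nat muln1.
by have := ltn_ord k; have := p0; lia.
Qed.

Lemma tailsq_chisq (x : I -> R) k : tailsq x k = chisq (tail k) x.
Proof.
rewrite /tailsq /chisq; transitivity (\sum_(i < p | i == k) \sum_(l < m | (p.-1 - i <= l)%N) x (i, l) ^+ 2).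
  by rewrite big_pred1_eq.
rewrite pair_big_dep /=; apply: eq_big => -[i l]; rewrite /tail //=.
by case: eqP => // ->.
Qed.

Lemma sumsq_chisq (x : I -> R) : sumsq x = chisq predT x.
Proof. by rewrite /sumsq /chisq pair_bigA; apply: eq_bigr => -[]. Qed.

Lemma all_card : #|(predT : pred I)| = (p * m)%N.
Proof. by rewrite cardT -cardE card_prod !card_ord. Qed.

Let tail_gt0 k : (0 < #|tail k|)%N. Proof. by rewrite tail_card addnS. Qed.
Let tail_ge2 k : (2 <= #|tail k|)%N. Proof. by rewrite tail_card; lia. Qed.
Let all_ge2 : (2 <= #|(predT : pred I)|)%N. Proof. by rewrite all_card; nia. Qed.
Let all_gt0 : (0 < #|(predT : pred I)|)%N. Proof. exact: ltn_trans all_ge2. Qed.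
Let D2 (k : 'I_p) : 2 <= D k. Proof. by rewrite (ler_nat _ 2); lia. Qed.
Let D0 (k : 'I_p) : 0 < D k. Proof. by have := D2 k; lra. Qed.
Let M0 : 0 < M. Proof. by rewrite ltr0n; lia. Qed.
Let p0' : 0 < p%:R :> R. Proof. by rewrite ltr0n. Qed.
Let q0' : 0 < q%:R :> R. Proof. by rewrite ltr0n. Qed.
Let qi0 : 0 < q%:R^-1 :> R. Proof. by rewrite invr_gt0. Qed.
Let MqE : M = q%:R + p%:R. Proof. exact: natrD. Qed.

Definition lin_part (x : I -> R) := \sum_k (ratio (tail k) x - 1) - p%:R * (ratio predT x - 1).
Definition quad_part (x : I -> R) := \sum_k sqdev (tail k) x.
Definition log_part (x : I -> R) := \sum_k lnrem (ratio (tail k) x).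
(** Left uncentered: with [p * m] degrees of freedom its mean is only [1 / m]. *)
Definition tr_quad (x : I -> R) := p%:R * ((ratio predT x - 1) ^+ 2 / 2).
Definition tr_log (x : I -> R) := p%:R * lnrem (ratio predT x).
Notation mu := (mu_n R m.+1 p).
Notation s2 := (sigma2_n R m.+1 p).
(** The deterministic part of the expansion; the terms [(D k)^-1] are the means taken out of the
    second-order terms in [sqdev]. *)
Definition shift := \sum_(k < p) (ln (D k) - (D k)^-1) - p%:R * ln M - mu.
Definition remainder (x : I -> R) := shift - quad_part x + log_part x + tr_quad x - tr_log x.

Let lnqm : ln (1 - p%:R / ((m.+1)%:R - 1)) = ln q%:R - ln M :> R.
Proof.
rewrite -natr1 addrK -ln_div ?posrE//; congr ln.
by rewrite MqE; field; rewrite -MqE gt_eqF.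
Qed.

(** For [n = q + p + 1] one has [n - p - 3 / 2 = q - 1 / 2] and [1 - p / (n - 1) = q / m], so
    [p * ln m + mu_n] is exactly the main term of [sum_ln_stirling]. *)
Lemma shift_le : `|shift| <= 4 * q%:R^-1.
Proof.
suff -> : shift = \sum_(k < p) (ln (D k) - (D k)^-1) -
    ((M - 1 / 2) * ln M - (q%:R - 1 / 2) * ln q%:R - p%:R) by exact: sum_ln_stirling.
by rewrite /shift /mu_n lnqm -natr1 MqE; field.
Qed.

Lemma log_decomposition x : (forall k, 0 < chisq (tail k) x) ->
  ln (\prod_k tailsq x k * (sumsq x / p%:R) ^- p) - mu = lin_part x + remainder x.
Proof.
move=> C0; have S0 : 0 < chisq predT x.
  apply: (lt_le_trans (C0 (Ordinal p0))); rewrite /chisq [leRHS](bigID (tail (Ordinal p0)))/= lerDl.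
  by apply: sumr_ge0 => i _; exact: sqr_ge0.
have N0 : 0 < p%:R * M by rewrite mulr_gt0.
have r0 k : 0 < ratio (tail k) x by rewrite divr_gt0// ltr0n.
have rr0 : 0 < ratio predT x by rewrite divr_gt0// ltr0n.
have lnprod (s : seq 'I_p) (F : 'I_p -> R) : (forall k, 0 < F k) -> ln (\prod_(k <- s) F k) = \sum_(k <- s) ln (F k).
  move=> F0; elim: s => [|k s IH]; first by rewrite !big_nil ln1.
  by rewrite !big_cons lnM ?posrE ?IH// prodr_gt0.
have tE k : tailsq x k = D k * ratio (tail k) x.
  by rewrite tailsq_chisq /ratio tail_card mulrCA mulfV ?mulr1// gt_eqF.
have sE : sumsq x / p%:R = M * ratio predT x.
  rewrite sumsq_chisq /ratio all_card natrM; field; rewrite -MqE.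
  by rewrite !gt_eqF.
rewrite sE ln_div ?posrE; [|by apply: prodr_gt0 => k _; rewrite tE mulr_gt0|by rewrite exprn_gt0// mulr_gt0].
rewrite lnprod => [|k]; last by rewrite tE mulr_gt0.
rewrite lnXn ?(mulr_gt0 M0 rr0)//.
have lnMM (u v : R) : 0 < u -> 0 < v -> ln (u * v) = ln u + ln v by move=> u0 v0; rewrite lnM ?posrE.
rewrite (lnMM M)//.
have lnr (r : R) : 0 < r -> ln r = (r - 1) - (r - 1) ^+ 2 / 2 + lnrem r.
  by move=> h; rewrite /lnrem pos01E// mulr1; ring.
rewrite (lnr (ratio predT x))//.
have -> : \sum_k ln (tailsq x k) = \sum_(k < p) (ln (D k) - (D k)^-1) + \sum_k (ratio (tail k) x - 1)
     - quad_part x + log_part x.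
  rewrite /quad_part /log_part -sumrN -!big_split; apply: eq_bigr => k _ /=.
  by rewrite tE lnMM// (lnr (ratio (tail k) x))// /sqdev tail_card; ring.
rewrite /lin_part /remainder /shift /tr_quad /tr_log -mulr_natl; ring.
Qed.

Let mpg1 : mpg (fun _ : I -> R => 1). Proof. exact: mpg_cst. Qed.

Lemma ev_quad : ev (fun x => quad_part x ^+ 2) <= 8 * q%:R^-1.
Proof.
have md k : mpg (sqdev (R := R) (tail k)) by exact: mpg_sqdev.
have mdd k l : mpg (fun x => sqdev (R := R) (tail k) x * sqdev (tail l) x) by apply: mpgM.
have -> : ev (fun x => quad_part x ^+ 2) = ev (fun x => \sum_k \sum_l sqdev (tail k) x * sqdev (tail l) x).
  by apply: eq_ev => x; rewrite expr2 mulr_suml; apply: eq_bigr => k _; rewrite mulr_sumr.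
rewrite ev_sum// => [|k]; last exact: mpg_sum.
apply: (@le_trans _ _ (\sum_(k < p) 8 * (D k)^-1 ^+ 2)); last by rewrite -mulr_sumr ler_pM2l// sum_inv_sqr.
apply: ler_sum => k _; rewrite ev_sum// (bigD1 k)//= big1 ?addr0 => [|l lk].
  have -> : ev (fun x => sqdev (tail k) x * sqdev (tail k) x) = ev (fun x => sqdev (tail k) x ^+ 2) by apply: eq_ev => x.
  rewrite (ev_sqdev_sqr g (tail_gt0 k)) tail_card; set u := D k.
  (* Since [u >= 2], the term [12 / u ^+ 3] is absorbed by [6 / u ^+ 2]. *)
  have u2 : 2 <= u by exact: D2.
  rewrite (_ : 8 * u^-1 ^+ 2 = 2 / u ^+ 2 + 6 * u^-1 ^+ 2); last by field; rewrite gt_eqF//; lra.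
  rewrite lerD2l (_ : 12 / u ^+ 3 = 12 * u^-1 * u^-1 ^+ 2); last by field; rewrite gt_eqF//; lra.
  rewrite ler_wpM2r ?sqr_ge0// ler_pdivrMr; lra.
apply: (ev_sqdev_mul g (tail_gt0 k) (md l)) => i /andP[/eqP ik _] x t.
rewrite /sqdev /ratio chisq_upd_out//; first by rewrite /tail ik eq_sym (negbTE lk).
Qed.

Let s := Num.sqrt (q%:R : R).
Let s0 : 0 < s. Proof. by rewrite sqrtr_gt0. Qed.
Let ss : s ^+ 2 = q%:R. Proof. by rewrite sqr_sqrtr// ltW. Qed.
Let s1 : 1 <= s.
Proof. by rewrite -[leLHS]sqrtr1 ler_sqrt// (ler_nat _ 1). Qed.
Let si0 : 0 < s^-1. Proof. by rewrite invr_gt0. Qed.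
Let qis : q%:R^-1 = s^-1 ^+ 2 :> R. Proof. by rewrite -ss exprVn. Qed.
Let qile : q%:R^-1 <= s^-1. Proof. by rewrite qis expr2 ler_piMl ?(ltW si0)// invf_le1. Qed.
Let Mile : M^-1 <= s^-1.
Proof. by rewrite (le_trans _ qile)// lef_pV2 ?posrE// MqE lerDl ltW. Qed.

(** In units of [s^-1], [shift], [quad_part], [log_part], [tr_quad] and [tr_log] contribute at most
    4, 9/2, 18, 1 and 9, in total less than 40. *)
Lemma ev_remainder_le : measurable_fun [set: rvT R I] remainder /\
  intg P (fun t => remainder (xi^~ t)) /\ ev (fun x => `|remainder x|) <= 40 * s^-1.
Proof.
have mx : measurable_fun setT (fun t => xi^~ t : rvT R I) by apply: measurable_torv; case: g.
have mq : mpg quad_part by apply: mpg_sum => k; exact: mpg_sqdev.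
have [iq' eq'] := ev_abs_le g si0 mq.
have eq : ev (fun x => `|quad_part x|) <= 9 / 2 * s^-1.
  apply: (le_trans eq'); rewrite ler_pdivrMr// invrK.
  have := ev_quad; rewrite qis => h.
  have := ler_wpM2r (ltW s0) h; rewrite (_ : 8 * s^-1 ^+ 2 * s = 8 * s^-1); first lra.
  by field; rewrite gt_eqF.
have L k := ev_lnrem g (tail_gt0 k) (tail_ge2 k).
have mlog : measurable_fun [set: rvT R I] log_part.
  by apply: measurable_sum => k; apply: measurableT_comp; [exact: measurable_lnrem|exact: (mpg_ratio _ _).1].
have mtl : measurable_fun [set: rvT R I] tr_log.
  by apply: measurable_funM => //; apply: measurableT_comp; [exact: measurable_lnrem|exact: (mpg_ratio _ _).1].
have ilog : intg P (fun t => log_part (xi^~ t)) by apply: intg_sum => k; exact: (L k).1.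
have elog : ev (fun x => `|log_part x|) <= 18 * s^-1.
  have i1 k : intg P (fun t => `|lnrem (ratio (tail k) (xi^~ t))|) by exact: intg_abs (L k).1.
  apply: (@le_trans _ _ (\int[P]_t \sum_k `|lnrem (ratio (tail k) (xi^~ t))|)).
    by apply: (Ex_le (intg_abs ilog) (intg_sum _ i1)) => t; exact: ler_norm_sum.
  rewrite Ex_sum//; apply: (@le_trans _ _ (\sum_(k < p) 9 * (D k * Num.sqrt (D k))^-1)).
    by apply: ler_sum => k _; have := (L k).2; rewrite tail_card.
  rewrite -mulr_sumr; have := sum_inv_three_halves R q0 p; rewrite -/s => h; lra.
have mtq : mpg tr_quad.
  apply: mpgM; first exact: mpg_cst.
  apply: mpgM; last exact: mpg_cst.
  by apply: mpgX; apply: mpgB; [exact: mpg_ratio|exact: mpg_cst].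
have tq0 x : 0 <= tr_quad x.
  by apply: mulr_ge0; [exact: ltW|apply: divr_ge0 => //; exact: sqr_ge0].
have etq : ev (fun x => `|tr_quad x|) <= s^-1.
  have -> : ev (fun x => `|tr_quad x|) = ev (fun x => (p%:R / 2) * ((ratio predT x - 1) ^+ 2 * 1)).
    by apply: eq_ev => x; rewrite ger0_norm// /tr_quad; ring.
  rewrite (evZ g); last first.
    by apply: mpgM => //; apply: mpgX; apply: mpgB; [exact: mpg_ratio|exact: mpg_cst].
  rewrite (ev_ratio2 g all_gt0 mpg1 (fun _ _ _ _ => erefl)) ev_cst all_card.
  apply: (le_trans _ Mile); rewrite natrM le_eqVlt; apply/orP; left; apply/eqP.
  by move: M M0 => u u0; field; rewrite !gt_eqF.
have [il el] := ev_lnrem g all_gt0 all_ge2.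
have itl : intg P (fun t => tr_log (xi^~ t)) by exact: intgZ.
have etl : ev (fun x => `|tr_log x|) <= 9 * s^-1.
  have -> : ev (fun x => `|tr_log x|) = p%:R * ev (fun x => `|lnrem (ratio predT x)|).
    rewrite -[RHS]ExZ; last exact: intg_abs.
    by apply: eq_Rintegral => t _; rewrite /tr_log normrM ger0_norm// ltW.
  apply: (@le_trans _ _ (9 * M^-1)); last by rewrite ler_pM2l.
  have := ler_wpM2l (ltW p0') el; move=> /le_trans; apply.
  rewrite all_card natrM; set w := Num.sqrt _.
  have N1 : 1 <= p%:R * M by rewrite -natrM (ler_nat _ 1) muln_gt0 p0 addn_gt0 q0.
  have w1 : 1 <= w by rewrite -[leLHS]sqrtr1 ler_sqrt// (lt_le_trans ltr01 N1).
  have w0 : 0 < w by lra.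
  rewrite (_ : p%:R * _ = 9 * M^-1 * w^-1); first by rewrite ler_piMr ?mulr_ge0 ?invr_ge0 ?(ltW M0)// invf_le1.
  by move: M M0 => u u0; field; rewrite !gt_eqF.
have mR : measurable_fun [set: rvT R I] remainder.
  apply: measurable_funB => //; apply: measurable_funD; last exact: mtq.1.
  by apply: measurable_funD => //; apply: measurable_funB => //; exact: mq.1.
have iq := mpg_intg g mq; have itq := mpg_intg g mtq.
have ic := intg_cst P `|shift|.
pose B t := `|shift| + `|quad_part (xi^~ t)| + `|log_part (xi^~ t)| + `|tr_quad (xi^~ t)| + `|tr_log (xi^~ t)|.
have i1 := intgD ic (intg_abs iq); have i2 := intgD i1 (intg_abs ilog).
have i3 := intgD i2 (intg_abs itq); have iB : intg P B := intgD i3 (intg_abs itl).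
have RB t : `|remainder (xi^~ t)| <= B t.
  rewrite /remainder /B; apply: (le_trans (ler_normB _ _)); rewrite lerD2r.
  apply: (le_trans (ler_normD _ _)); rewrite lerD2r; apply: (le_trans (ler_normD _ _)); rewrite lerD2r.
  exact: ler_normB.
have iR : intg P (fun t => remainder (xi^~ t)).
  by apply: (intg_le _ RB iB); exact: (measurableT_comp mR mx).
split=> //; split=> //; apply: (le_trans (Ex_le (intg_abs iR) iB RB)).
rewrite /B (ExD i3 (intg_abs itl)) (ExD i2 (intg_abs itq)) (ExD i1 (intg_abs ilog)) (ExD ic (intg_abs iq)) Ex_cst.
have := shift_le; move: eq elog etq etl qile si0; rewrite /expect; lra.
Qed.

End decomposition.

(* [x^-1 = x * (x ^+ 2)^-1], and [y^-1 = exp (- ln y)] for [y > 0]. *)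
Lemma measurable_inv (R : realType) : measurable_fun setT (fun x : R => x^-1).
Proof.
apply: (eq_measurable_fun (fun x : R => x * (expR (- ln (x ^+ 2)) * pos01 (x ^+ 2)))); last first.
  apply: measurable_funM => //; apply: measurable_funM.
    by do 3 (apply: measurableT_comp => //).
  by apply: measurableT_comp; [exact: measurable_pos01|exact: measurable_funX].
move=> x _; have [->|x0] := eqVneq x 0; first by rewrite mul0r invr0.
have x2 : 0 < x ^+ 2 by rewrite exprn_even_gt0.
by rewrite pos01E// mulr1 expRN lnK ?posrE//; field.
Qed.

(** * Normal approximation of the statistic for fixed dimensions *)

Section approximation.
Context (R : realType) d (T : measurableType d) (P : probability T R).
Variables (p q : nat).
Hypotheses (p0 : (0 < p)%N) (q0 : (0 < q)%N).
Notation m := (q + p)%N.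
Notation I := ('I_p * 'I_m)%type.
Variable xi : I -> T -> R.
Hypothesis g : gfam P xi.
Notation ev := (expect P xi).
Notation gam := (@normal_prob R 0 1).
Notation D k := ((q + k.+1)%:R : R).
Notation M := (m%:R : R).
Notation mu := (mu_n R m.+1 p).
Notation s2 := (sigma2_n R m.+1 p).
Hypothesis s20 : 0 < s2.

Let D0 (k : nat) : 0 < D k. Proof. by rewrite ltr0n addnS. Qed.
Let M0 : 0 < M. Proof. by rewrite ltr0n addn_gt0 q0. Qed.
Let p0' : 0 < p%:R :> R. Proof. by rewrite ltr0n. Qed.
Let q0' : 0 < q%:R :> R. Proof. by rewrite ltr0n. Qed.
Let qi0 : 0 < q%:R^-1 :> R. Proof. by rewrite invr_gt0. Qed.
Let MqE : M = q%:R + p%:R. Proof. exact: natrD. Qed.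

Definition in_tail (k : 'I_p) (l : 'I_m) : R := (p.-1 - k <= l)%N%:R.
(** The weight of a squared entry: the inverse degrees of freedom of its row if it is counted there,
    minus the trace weight [p / (p * m)]. *)
Definition lin_coef (k : 'I_p) (l : 'I_m) : R := in_tail k l / D k - M^-1.

Lemma sum_in_tail k : \sum_l in_tail k l = D k.
Proof.
rewrite -(tail_card p0 q0 k) -sum1_card natr_sum.
transitivity (\sum_(i < p | i == k) \sum_(l < m | (p.-1 - i <= l)%N) (1 : R)).
  by rewrite big_pred1_eq [RHS]big_mkcond; apply: eq_bigr => l _; rewrite /in_tail; case: (p.-1 - k <= l)%N.
rewrite pair_big_dep /=; apply: eq_bigl => -[i l]; rewrite /tail /=.
by rewrite unfold_in /=; case: eqP => // ->.
Qed.

(** In a row the coefficient takes two values, on the [D k] entries of the tail and off it; [v] is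
    the value of [f] off the tail and [u] the excess on it. *)
Lemma sum_lin_coef (f : R -> R) (u v : R) (k : 'I_p) : f ((D k)^-1 - M^-1) = u + v -> f (- M^-1) = v ->
  \sum_l f (lin_coef k l) = D k * u + M * v.
Proof.
move=> f1 f2; transitivity (\sum_(l < m) (in_tail k l * u + v)).
  apply: eq_bigr => l _; rewrite /lin_coef /in_tail.
  by case: (p.-1 - k <= l)%N; rewrite ?mul0r ?sub0r ?add0r ?mul1r.
by rewrite big_split /= -mulr_suml sum_in_tail sumr_const card_ord -[_ *+ m]mulr_natl.
Qed.

(** Row [k] contributes [(D k)^-1 - M^-1], so twice the total is a harmonic sum close to
    [2 * (ln (m / q) - p / m)], which is [sigma_n ^ 2]. *)
Lemma sum_lin_coef_sqr : `|s2 - 2 * \sum_(i : I) lin_coef i.1 i.2 ^+ 2| <= 2 * q%:R^-1.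
Proof.
have -> : \sum_(i : I) lin_coef i.1 i.2 ^+ 2 = \sum_(k < p) (D k)^-1 - p%:R / M.
  rewrite -(pair_bigA _ (fun k l => lin_coef k l ^+ 2)) /=.
  rewrite (_ : p%:R / M = \sum_(k < p) M^-1); last by rewrite sumr_const card_ord mulr_natl.
  rewrite -sumrB; apply: eq_bigr => k _.
  rewrite (@sum_lin_coef (fun x => x ^+ 2) ((D k)^-1 ^+ 2 - 2 * (D k)^-1 * M^-1) (M^-1 ^+ 2)).
  - move: (D k) M (D0 k) M0 => a b a0 b0; field; rewrite !gt_eqF//.
  - by ring.
  - by rewrite sqrrN.
have -> : s2 = 2 * (ln M - ln q%:R - p%:R / M).
  rewrite /sigma2_n (_ : m.+1%:R - 1 = M); last by rewrite -[m.+1%:R]natr1 addrK.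
  rewrite (_ : 1 - p%:R / M = q%:R / M); last first.
    by rewrite MqE; field; rewrite -MqE gt_eqF.
  by rewrite ln_div ?posrE//; ring.
have := sum_inv_ln R q0 p; set S := \sum_(k < p) _ => h.
rewrite -mulrBr normrM ger0_norm// ler_pM2l//.
by rewrite distrC (_ : _ - _ = S - (ln M - ln q%:R)) //; ring.
Qed.

(** Row [k] contributes at most [(D k)^-1 ^+ 3 + M^-1 ^+ 3]; the first part sums to at most
    [q ^- 2], the second to [p / M ^+ 3 <= q ^- 2]. *)
Lemma sum_lin_coef_pow4 : \sum_(i : I) lin_coef i.1 i.2 ^+ 4 <= 2 * q%:R^-1 ^+ 2.
Proof.
rewrite -(pair_bigA _ (fun k l => lin_coef k l ^+ 4)) /=.
apply: (@le_trans _ _ (\sum_(k < p) ((D k)^-1 ^+ 3 + M^-1 ^+ 3))).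
  apply: ler_sum => k _.
  apply: (@le_trans _ _ (\sum_(l < m) (in_tail k l * (D k)^-1 ^+ 4 + M^-1 ^+ 4))).
    apply: ler_sum => l _; rewrite /lin_coef /in_tail; case: (p.-1 - k <= l)%N.
      rewrite !mul1r.
      have a0 : 0 < (D k)^-1 by rewrite invr_gt0.
      have b0 : 0 < M^-1 by rewrite invr_gt0.
      have ba : M^-1 <= (D k)^-1 by rewrite lef_pV2 ?posrE// ler_nat leq_add2l.
      have h : ((D k)^-1 - M^-1) ^+ 4 <= (D k)^-1 ^+ 4.
        by rewrite lerXn2r ?nnegrE; lra.
      by apply: (le_trans h); rewrite lerDl exprn_ge0// ltW.
    by rewrite !mul0r sub0r add0r (_ : 4 = 2 * 2)%N// !exprM sqrrN.
  rewrite big_split /= -mulr_suml sum_in_tail sumr_const card_ord -[_ *+ m]mulr_natl.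
  rewrite (_ : D k * (D k)^-1 ^+ 4 = (D k)^-1 ^+ 3); last by rewrite [_ ^+ 4]exprS mulrA mulfV ?mul1r// gt_eqF.
  by rewrite (_ : M * M^-1 ^+ 4 = M^-1 ^+ 3)// [_ ^+ 4]exprS mulrA mulfV ?mul1r// gt_eqF.
rewrite big_split /= mulr2n mulrDl mul1r lerD ?sum_inv_cube// sumr_const card_ord -[_ *+ p]mulr_natl.
rewrite exprS mulrA -[leRHS]mul1r ler_pM//.
- by rewrite ler_pdivrMr// mul1r MqE lerDr ltW.
- by rewrite lerXn2r ?nnegrE ?invr_ge0 ?(ltW M0)// lef_pV2 ?posrE// MqE lerDl ltW.
Qed.

Lemma lin_part_chaos (x : I -> R) : lin_part x = chaos (fun i => lin_coef i.1 i.2) x.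
Proof.
rewrite /chaos (eq_bigr (fun i : I => lin_coef i.1 i.2 * (x (i.1, i.2) ^+ 2 - 1))) => [|[]//].
rewrite -(pair_bigA _ (fun k l => lin_coef k l * (x (k, l) ^+ 2 - 1))) /=.
rewrite /lin_part /ratio all_card -sumsq_chisq natrM.
transitivity (\sum_k (chisq (tail k) x / D k - 1 - (M^-1 * \sum_l x (k, l) ^+ 2 - 1))).
  rewrite [RHS]sumrB; congr (_ - _); first by apply: eq_bigr => k _; rewrite tail_card.
  rewrite sumrB sumr_const card_ord -mulr_sumr -/(sumsq x).
  by move: M M0 => u u0; field; rewrite !gt_eqF.
apply: eq_bigr => k _; rewrite -tailsq_chisq.
have -> : tailsq x k = \sum_l in_tail k l * x (k, l) ^+ 2.
  rewrite /tailsq big_mkcond; apply: eq_bigr => l _; rewrite /in_tail.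
  by case: (p.-1 - k <= l)%N; rewrite ?mul1r ?mul0r.
transitivity (\sum_l ((D k)^-1 * (in_tail k l * x (k, l) ^+ 2) - (D k)^-1 * in_tail k l -
   (M^-1 * x (k, l) ^+ 2 - M^-1))); last first.
  by apply: eq_bigr => l _; rewrite /lin_coef; ring.
rewrite !sumrB -!mulr_sumr sum_in_tail sumr_const card_ord mulVf ?gt_eqF// -[M^-1 *+ m]mulr_natl mulfV ?gt_eqF//.
by rewrite mulrC.
Qed.

Notation sg := (Num.sqrt s2).
Let sg0 : 0 < sg. Proof. by rewrite sqrtr_gt0. Qed.
Let sgsg : sg ^+ 2 = s2. Proof. by rewrite sqr_sqrtr// ltW. Qed.
Notation tau := (q%:R * s2).
Let tau0 : 0 < tau. Proof. by rewrite mulr_gt0. Qed.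

Definition approx_stat (x : I -> R) : R := (lin_part x + remainder x) / sg.

Lemma measurable_approx_stat : measurable_fun [set: rvT R I] approx_stat.
Proof.
apply: measurable_funM => //; apply: measurable_funD; last exact: (ev_remainder_le p0 q0 g).1.
apply: (eq_measurable_fun (fun x : rvT R I => chaos (fun i : I => lin_coef i.1 i.2) x)); first by move=> x _; rewrite lin_part_chaos.
exact: (mpg_chaos _).1.
Qed.

(** The remainder displaces the argument of a [K]-Lipschitz step by its mean size, at most
    [40 / sqrt q], divided by [sg]; the chaos alone is handled by [step_clt]. *)
Lemma ev_step_approx (K z : R) : 1 <= K ->
  `|ev (fun x => step K z (approx_stat x)) - \int[gam]_w step K z w| <=
  K * (40 * (Num.sqrt tau)^-1) + K ^+ 2 * (21 * tau^-1).
Proof.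
move=> K1; have K0 : 0 <= K by lra.
have mx : measurable_fun setT (fun t => xi^~ t : rvT R I) by apply: measurable_torv; case: g.
pose c (i : I) := sg^-1 * lin_coef i.1 i.2.
have chE x : chaos c x = lin_part x / sg.
  by rewrite lin_part_chaos /chaos mulr_suml; apply: eq_bigr => i _; rewrite /c; ring.
have ti0 : 0 < tau^-1 by rewrite invr_gt0.
(* With [t = tau^-1] the three terms of the bound are at most 4, 16 and 1 times [tau^-1], whence
   21. *)
have H := step_clt g c z ti0 K1.
have b2 : `|1 - 2 * \sum_i c i ^+ 2| <= 2 * tau^-1.
  have -> : \sum_i c i ^+ 2 = s2^-1 * \sum_(i : I) lin_coef i.1 i.2 ^+ 2.
    by rewrite mulr_sumr; apply: eq_bigr => i _; rewrite /c exprMn exprVn sgsg.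
  rewrite (_ : 1 - _ = s2^-1 * (s2 - 2 * \sum_(i : I) lin_coef i.1 i.2 ^+ 2)); last first.
    by rewrite mulrBr mulVf ?gt_eqF//; ring.
  rewrite normrM ger0_norm ?invr_ge0 ?(ltW s20)//.
  rewrite (_ : 2 * tau^-1 = s2^-1 * (2 * q%:R^-1)); last by field; rewrite !gt_eqF.
  by rewrite ler_pM2l ?invr_gt0//; exact: sum_lin_coef_sqr.
have b4 : 8 * (\sum_i c i ^+ 4) / tau^-1 <= 16 * tau^-1.
  have -> : \sum_i c i ^+ 4 = s2^-1 ^+ 2 * \sum_(i : I) lin_coef i.1 i.2 ^+ 4.
    by rewrite mulr_sumr; apply: eq_bigr => i _; rewrite /c exprMn (_ : 4 = 2 * 2)%N// (exprM sg^-1) (exprVn sg) sgsg.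
  rewrite invrK (_ : 16 * tau^-1 = 8 * (s2^-1 ^+ 2 * (2 * q%:R^-1 ^+ 2)) * tau); last first.
    by field; rewrite !gt_eqF.
  rewrite ler_pM2r// ler_pM2l// ler_pM2l ?exprn_gt0 ?invr_gt0//.
  exact: sum_lin_coef_pow4.
have H' : `|ev (fun x => step K z (chaos c x)) - \int[gam]_w step K z w| <= K ^+ 2 * (21 * tau^-1).
  apply: (le_trans H); rewrite ler_pM2l; last by rewrite exprn_gt0//; lra.
  lra.
have [mR [iR eR]] := ev_remainder_le p0 q0 g.
have mst (F : (I -> R) -> R) : measurable_fun [set: rvT R I] F -> intg P (fun t => step K z (F (xi^~ t))).
  move=> mF; apply: (@intg_bound _ _ _ _ _ 1); last by move=> t; rewrite ger0_norm ?step_ge0// step_le1.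
  apply: (measurableT_comp (measurable_step K z)).
  exact: (measurableT_comp mF mx).
have i1 := mst _ measurable_approx_stat; have i2 := mst _ (mpg_chaos c).1.
have iKR : intg P (fun t => K * (sg^-1 * `|remainder (xi^~ t)|)) by apply/intgZ/intgZ/intg_abs.
have E : `|ev (fun x => step K z (approx_stat x)) - ev (fun x => step K z (chaos c x))| <= K * (40 * (Num.sqrt tau)^-1).
  rewrite /expect -ExB//; apply: (le_trans (Ex_abs (intgB i1 i2))).
  apply: (@le_trans _ _ (\int[P]_t (K * (sg^-1 * `|remainder (xi^~ t)|)))).
    apply: (Ex_le (intg_abs (intgB i1 i2)) iKR) => t; apply: (le_trans (step_lip _ _ _ K0)).
    rewrite ler_wpM2l// chE /approx_stat -mulrBl addrAC subrr add0r normrM mulrC.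
    by rewrite ger0_norm// invr_ge0 ltW.
  rewrite ExZ; last by apply/intgZ/intg_abs.
  rewrite ExZ ?ler_wpM2l//; last exact: intg_abs.
  have sq0 : 0 < Num.sqrt (q%:R : R) by rewrite sqrtr_gt0.
  rewrite (_ : 40 * (Num.sqrt tau)^-1 = sg^-1 * (40 * (Num.sqrt q%:R)^-1)); last first.
    rewrite (sqrtrM s2 (ltW q0')); move: sg (Num.sqrt q%:R) sg0 sq0 => a b a0 b0.
    by field; rewrite !gt_eqF.
  by rewrite ler_pM2l ?invr_gt0//; exact: eR.
by apply: (le_trans (ler_distD (ev (fun x => step K z (chaos c x))) _ _)); apply: lerD.
Qed.

(** [log_decomposition] holds where every chi-square is positive; elsewhere the indicators differ by
    at most [B], a nonnegative function of expectation 0. *)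
Lemma tailsq_pos_ae (x : R) :
  fine (P [set t | (ln (\prod_k tailsq (xi^~ t) k * (sumsq (xi^~ t) / p%:R) ^- p) - mu) / sg <= x]) =
  fine (P [set t | approx_stat (xi^~ t) <= x]).
Proof.
have mx : measurable_fun setT (fun t => xi^~ t : rvT R I) by apply: measurable_torv; case: g.
pose f t := (ln (\prod_k tailsq (xi^~ t) k * (sumsq (xi^~ t) / p%:R) ^- p) - mu) / sg.
pose h t := approx_stat (xi^~ t).
have mf : measurable_fun setT f.
  apply: (measurableT_comp (f := fun x : rvT R I => (ln (\prod_k tailsq x k * (sumsq x / p%:R) ^- p) - mu) / sg)) => //.
  apply: measurable_funM => //; apply: measurable_funB => //; apply: measurableT_comp => //.
  apply: measurable_funM; first by apply: measurable_prod => k _; exact: measurable_tailsq.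
  apply: (measurableT_comp (@measurable_inv R)); apply: measurable_funX.
  by apply: measurable_funM => //; exact: measurable_sumsq.
have mh : measurable_fun setT h by exact: (measurableT_comp measurable_approx_stat mx).
have mA (u : T -> R) (mu' : measurable_fun setT u) := measurable_sublevel x mu'.
have ii (u : T -> R) : measurable_fun setT u -> intg P (\1_[set t | u t <= x] : T -> R).
  move=> mu'; apply: (@intg_bound _ _ _ _ _ 1); first by apply: measurable_indic; exact: mA.
  by move=> t; have [? ?] := indic01 R [set t | u t <= x] t; rewrite ger0_norm.
rewrite -(Ex_indic P (mA f mf)) -(Ex_indic P (mA h mh)).
pose B (y : I -> R) := \sum_k (1 - pos01 (chisq (tail k) y)).
have mB k : mpg (fun y : I -> R => 1 - pos01 (chisq (tail k) y)).
  by apply: mpgB; [exact: mpg_cst|exact: mpg_pos_chisq].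
have B0 (y : I -> R) k : 0 <= 1 - pos01 (chisq (tail k) y).
  by rewrite subr_ge0; have [] := indic01 R [set s : R | 0 < s] (chisq (tail k) y).
have eB : ev B = 0.
  rewrite /B ev_sum// big1// => k _; apply: (ev_chisq_eq0 g).
  by rewrite tail_card// addnS.
apply/eqP; rewrite -subr_eq0 -normr_le0 -eB -ExB; [|exact: ii..].
have ifh := intgB (ii f mf) (ii h mh).
apply: (le_trans (Ex_abs ifh)).
apply: (Ex_le (intg_abs ifh) (mpg_intg g (mpg_sum _ mB))) => t.
have [ap|/existsNP[k /negP]] := pselect (forall k, 0 < chisq (tail k) (xi^~ t)).
  have -> : \1_[set t | f t <= x] t = \1_[set t | h t <= x] t :> R.
    by rewrite !indicE /=; congr (_%:R); congr (nat_of_bool _); apply/idP/idP; rewrite !inE /= /f /h /approx_stat log_decomposition.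
  by rewrite subrr normr0; apply: sumr_ge0 => k _.
rewrite -leNgt => Ck; rewrite (bigD1 k)//= pos01_eq0// subr0.
apply: (@le_trans _ _ 1); last by rewrite lerDl; apply: sumr_ge0 => l _.
have [? ?] := indic01 R [set t | f t <= x] t; have [? ?] := indic01 R [set t | h t <= x] t.
by rewrite ler_norml; apply/andP; split; lra.
Qed.

(** The statistic is a function of the Gram determinant and the trace alone, so [bartlett], applied
    to the indicator of a sublevel set, replaces the determinant by the product of chi-squares. *)
Lemma tail_approx (x K e : R) : 1 <= K -> 0 <= e ->
  `|fine (P [set t | (ln (gram_det (xi^~ t) * (sumsq (xi^~ t) / p%:R) ^- p) - mu) / sg <= x]) - std_normal_cdf x| <=
  K * (40 * (Num.sqrt tau)^-1) + K ^+ 2 * (21 * tau^-1) + 2 * e + 2 * expR (- (K * e)).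
Proof.
move=> K1 e0; have K0 : 0 <= K by lra.
pose f (z : R * R) := (ln (z.1 * (z.2 / p%:R) ^- p) - mu) / sg.
have mf : measurable_fun setT f.
  apply: measurable_funM => //; apply: measurable_funB => //; apply: measurableT_comp => //.
  apply: measurable_funM => //; apply: (measurableT_comp (@measurable_inv R)); apply: measurable_funX.
  exact: measurable_funM.
have mS := measurable_sublevel x mf.
pose F (z : R * R) : \bar R := (\1_[set z | f z <= x] z)%:E.
have mF : measurable_fun setT F by apply/measurable_EFinP; exact: measurable_indic.
have F0 z : (0 <= F z)%E by rewrite lee_fin; have [] := indic01 R [set z | f z <= x] z.
have mx : measurable_fun setT (fun t => xi^~ t : rvT R I) by apply: measurable_torv; case: g.
have pm : (p <= m)%N by exact: leq_addl.
have B := bartlett pm g mF F0.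
have Pint (u : T -> R * R) : measurable_fun setT u -> (\int[P]_t F (u t) = P [set t | (f (u t) <= x)%R])%E.
  move=> mu'; have mA : measurable [set t | f (u t) <= x].
    by rewrite (_ : [set t | _] = u @^-1` [set z | f z <= x])// -[_ @^-1` _]setTI; exact: mu'.
  rewrite -[X in _ = P X](setIT _) -(integral_indic P measurableT mA).
  by apply: eq_integral => t _; rewrite /F !indicE; congr (_%:R%:E); congr nat_of_bool; apply/idP/idP; rewrite !inE.
have mdet : measurable_fun setT (fun t => gram_det (xi^~ t)) := measurableT_comp (@measurable_gram_det R p m) mx.
have msum : measurable_fun setT (fun t => sumsq (xi^~ t)) := measurableT_comp (@measurable_sumsq R p m) mx.
have mprod : measurable_fun setT (fun t => \prod_k tailsq (xi^~ t) k).
  by apply: measurable_prod => k _; exact: (measurableT_comp (@measurable_tailsq R p m k) mx).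
have E := etrans (esym (Pint _ (measurable_fun_pair mdet msum))) (etrans B (Pint _ (measurable_fun_pair mprod msum))).
rewrite [X in fine X](_ : _ = P [set t | (ln (\prod_k tailsq (xi^~ t) k * (sumsq (xi^~ t) / p%:R) ^- p) - mu) / sg <= x]); last exact: E.
rewrite tailsq_pos_ae; apply: cdf_close => //.
  exact: (measurableT_comp measurable_approx_stat mx).
by move=> z; exact: ev_step_approx.
Qed.

End approximation.

(** * Asymptotics *)

Section asymptotics.
Context (R : realType).

Lemma sphericity_cdf_bound d (T : measurableType d) (P : probability T R) (n p : nat)
    (X : 'I_n -> T -> 'cV[R]_p) (mu : 'cV[R]_p) (lam x K e : R) :
  (0 < p)%N -> (p + 1 < n)%N -> 0 < lam ->
  (forall i j, measurable_fun setT (fun t => X i t j ord0)) ->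
  mutually_independent_vectors P X -> (forall i, mvnormal P (X i) mu lam%:M) ->
  0 < sigma2_n R n p -> 1 <= K -> 0 <= e ->
  let tau := (n.-1 - p)%:R * sigma2_n R n p in
  `|fine (P [set t | (ln (sphericity_stat (X^~ t)) - mu_n R n p) / Num.sqrt (sigma2_n R n p) <= x]) -
    std_normal_cdf x| <=
  K * (40 * (Num.sqrt tau)^-1) + K ^+ 2 * (21 * tau^-1) + 2 * e + 2 * expR (- (K * e)).
Proof.
move=> p0 pn; have [q q0 nE] : exists2 q, (0 < q)%N & n = (q + p).+1.
  by exists (n - p.+1)%N; lia.
move: X; rewrite nE => X l0 mX ind N s20 K1 e0; rewrite /= addnK.
have [xi g stat] := sphericity_stat_gram l0 mX ind N.
have := tail_approx p0 q0 g s20 x K1 e0.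
by under eq_set do rewrite -stat.
Qed.

(** The remainder of [ln (1 - u)] after its second-order expansion is nonpositive, by the mean value
    form. *)
Lemma sigma2_ge_sqr (u : R) : 0 <= u -> u < 1 -> u ^+ 2 <= - 2 * (u + ln (1 - u)).
Proof.
move=> u0 u1; have r0 : 0 < 1 - u by lra.
have [c [c0 _ _ cE]] := lnrem_mvt r0.
have : 0 <= (c - 1) ^+ 2 / c by rewrite divr_ge0 ?sqr_ge0// ltW.
move: cE; rewrite /lnrem pos01E// mulr1; set w := _ / c; set l := ln _ => E w0.
have : 0 <= w * u by rewrite mulr_ge0.
move: E; rewrite (_ : 1 - u - 1 = - u); last by ring.
rewrite sqrrN => E h; lra.
Qed.

(* Either [n - 1 - p] is large, and the variance is bounded below by [u ^+ 2] with [u = p / (n - 1)],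
   or it is bounded, and the variance is of order [2 * ln n]. *)
Lemma sigma2_tau_large (p : nat -> nat) (y A : R) :
  (forall n, (3 <= n)%N -> (p n + 1 < n)%N) -> 0 < y ->
  (fun n => (p n)%:R / n%:R : R) @ \oo --> y -> 0 < A ->
  \forall n \near \oo, [/\ (p n + 1 < n)%N, 0 < sigma2_n R n (p n) &
    A <= (n.-1 - p n)%:R * sigma2_n R n (p n)].
Proof.
move=> pn y0 py A0.
(* Threshold between the two regimes: the variance is eventually at least [y ^+ 2 / 4], and
   [Q * (y ^+ 2 / 4) = A]. *)
pose Q := 4 * A / y ^+ 2.
have y20 : 0 < y ^+ 2 by rewrite exprn_gt0.
have Q0 : 0 < Q by rewrite divr_gt0// mulr_gt0.
(* When [q < Q] the variance is [2 * (ln (n - 1) - ln q - u)] with [u < 1]; once [n - 1 >= B] it is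
   at least [A], and [q >= 1] concludes. *)
pose B := expR (A / 2 + ln Q + 1).
have y2 : 0 < y / 2 by rewrite divr_gt0.
near=> n.
have n3 : (3 <= n)%N by near: n; exact: nbhs_infty_ge.
have pnn := pn n n3.
have nB : B + 1 <= n%:R by near: n; exact: nbhs_infty_ger.
have pyn : y / 2 <= (p n)%:R / n%:R.
  have : `|y - (p n)%:R / n%:R| <= y / 2.
    by near: n; move/cvgrPdist_le : py; apply.
  by rewrite ler_norml => /andP[_]; lra.
have [q q0 nE] : exists2 q, (0 < q)%N & n = (q + p n).+1 by exists (n - (p n).+1)%N; lia.
have n1E : n%:R - 1 = q%:R + (p n)%:R :> R by rewrite {1}nE -natr1 addrK natrD.
have q1 : 1 <= q%:R :> R by rewrite (ler_nat _ 1).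
have qE : (n.-1 - p n)%N = q by lia.
rewrite qE /sigma2_n n1E.
set P' := (p n)%:R in pyn n1E *; set N' := n%:R in pyn n1E nB *.
have P0 : 0 <= P' by rewrite /P'.
have N0 : 0 < N' by move: n1E; lra.
have M0 : 0 < q%:R + P' by lra.
set u := P' / (q%:R + P').
have u0 : 0 <= u by rewrite divr_ge0// ltW.
have u1 : u < 1 by rewrite ltr_pdivrMr// mul1r; lra.
have uy : y / 2 <= u.
  apply: (le_trans pyn); rewrite /u -n1E ler_wpM2l// lef_pV2 ?posrE; lra.
have h1 := sigma2_ge_sqr u0 u1.
have u2 : y ^+ 2 / 4 <= u ^+ 2.
  have -> : y ^+ 2 / 4 = (y / 2) ^+ 2 by field.
  by rewrite lerXn2r ?nnegrE// ltW.
have s0 : 0 < - 2 * (u + ln (1 - u)).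
  by apply: (lt_le_trans _ (le_trans u2 h1)); rewrite divr_gt0.
split=> //.
have [qQ|qQ] := leP Q q%:R.
  have -> : A = Q * (y ^+ 2 / 4) by rewrite /Q; field; rewrite gt_eqF.
  rewrite ler_pM ?(ltW Q0)//; last exact: le_trans u2 h1.
  by rewrite divr_ge0// ltW.
have lnu : ln (1 - u) = ln q%:R - ln (q%:R + P').
  rewrite -ln_div ?posrE//; last lra.
  by congr ln; rewrite /u; field; rewrite gt_eqF.
have lnq : ln q%:R <= ln Q by rewrite ler_ln ?posrE; lra.
have lnM' : A / 2 + ln Q + 1 <= ln (q%:R + P').
  rewrite -(expRK (A / 2 + ln Q + 1)) ler_ln ?posrE ?expR_gt0//.
  by rewrite -/B -n1E; lra.
apply: (@le_trans _ _ (- 2 * (u + ln (1 - u)))); first by rewrite lnu; lra.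
by rewrite ler_peMl// ltW.
Unshelve. all: by end_near. Qed.

End asymptotics.

Theorem theorem1 (R : realType) (p : nat -> nat) (y : R)
  (d : nat -> measure_display) (T : forall n, measurableType (d n))
  (P : forall n, probability (T n) R)
  (X : forall n, 'I_n -> T n -> 'cV[R]_(p n))
  (mu : forall n, 'cV[R]_(p n)) (lam : nat -> R) :
  (forall n, (0 < p n)%N) ->
  (forall n, (3 <= n)%N -> (p n + 1 < n)%N) ->
  0 < y -> y <= 1 ->
  (fun n => (p n)%:R / n%:R : R) @ \oo --> y ->
  (forall n, 0 < lam n) ->
  (forall n (i : 'I_n) (j : 'I_(p n)), measurable_fun setT (fun t => X n i t j ord0)) ->
  (forall n, mutually_independent_vectors (P n) (X n)) ->
  (forall n (i : 'I_n), mvnormal (P n) (X n i) (mu n) (lam n)%:M) ->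
  forall x : R,
    (fun n => fine (P n [set t | (ln (sphericity_stat (fun i => X n i t)) - mu_n R n (p n))
                                  / Num.sqrt (sigma2_n R n (p n)) <= x]))
      @ \oo --> std_normal_cdf x.
Proof.
move=> p0 pn y0 _ py lam0 mX ind N x; apply/cvgrPdist_le => e0 e0_gt0.
(* Each of the four error terms receives [e0 / 4]: [e] handles the Lipschitz loss, [K] the
   exponential tail through [expR z >= 1 + z], and [A1 ^+ 2] and [A2] are the lower bounds on [tau]
   demanded by the remainder and by the chaos. [K] and [e] depend on [e0] only. *)
pose e := e0 / 8; have e_gt0 : 0 < e by rewrite divr_gt0.
pose K := 1 + 8 / (e0 * e).
have Kp : 0 < 8 / (e0 * e) by rewrite divr_gt0// mulr_gt0.
have K1 : 1 <= K by rewrite lerDl ltW.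
have K0 : 0 < K by lra.
have expK : expR (- (K * e)) <= e0 / 8.
  rewrite expRN -[leRHS]invrK lef_pV2 ?posrE ?invr_gt0 ?expR_gt0//.
  apply: (le_trans _ (expR_ge1Dx _)); rewrite /K mulrDl mul1r.
  have -> : 8 / (e0 * e) * e = (e0 / 8)^-1 by rewrite /e; field; rewrite gt_eqF.
  by rewrite addrA lerDr addr_ge0// ltW.
pose A1 := 160 * K / e0; pose A2 := 84 * K ^+ 2 / e0.
have A10 : 0 < A1 by rewrite divr_gt0// mulr_gt0.
have A20 : 0 < A2 by rewrite divr_gt0// mulr_gt0// exprn_gt0.
have A0 : 0 < A1 ^+ 2 + A2 by rewrite addr_gt0// exprn_gt0.
apply: filterS (sigma2_tau_large pn y0 py A0) => n [pnn s0 tauA].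
rewrite distrC.
apply: (le_trans (sphericity_cdf_bound x (p0 n) pnn (lam0 n) (mX n) (ind n) (N n) s0 K1 (ltW e_gt0))).
set tau := _ * _ in tauA *.
have tau0 : 0 < tau := lt_le_trans A0 tauA.
have h1 : K * (40 * (Num.sqrt tau)^-1) <= e0 / 4.
  have sq : A1 <= Num.sqrt tau.
    rewrite -[leLHS](ger0_norm (ltW A10)) -sqrtr_sqr ler_sqrt ?(ltW tau0)//.
    by apply: (le_trans _ tauA); rewrite lerDl ltW.
  have -> : e0 / 4 = K * (40 * A1^-1) by rewrite /A1; field; rewrite !gt_eqF.
  by rewrite ler_pM2l// ler_pM2l// lef_pV2 ?posrE// (lt_le_trans A10 sq).
have h2 : K ^+ 2 * (21 * tau^-1) <= e0 / 4.
  have -> : e0 / 4 = K ^+ 2 * (21 * A2^-1) by rewrite /A2; field; rewrite !gt_eqF.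
  rewrite ler_pM2l ?exprn_gt0// ler_pM2l// lef_pV2 ?posrE//.
  by apply: (le_trans _ tauA); rewrite lerDr ltW// exprn_gt0.
have h3 : 2 * e = e0 / 4 by rewrite /e; field.
lra.
Qed.
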